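(* We have \begin{align*} 2 n \alpha(n) - O(n) \leq p_3(n) & \leq O(n \alpha(n)),\\ p_{2t+2}(n) &= n 2^{(1/t!) \alpha(n)^t \pm O(\alpha(n)^{t-1}) } \quad \text{for every fixed integer } t \geq 1, \text{ and} \\ n 2^{(1/t!) \alpha(n)^t - O(\alpha(n)^{t-1})} \leq p_{2t+3}(n) &\leq n 2^{(1/t!) \alpha(n)^t \log_2(\alpha(n)) + O(\alpha(n)^t)} \quad \text{for every fixed integer } t \geq 1. \end{align*}
   Context: A $k$-permutation matrix is a $k\times k$ $(0,1)$-matrix with exactly one $1$-entry in every row and every column. A $(0,1)$-matrix $B$ contains a $k\times l$ $(0,1)$-matrix $S$ if $B$ has a $k\times l$ submatrix $T$ (rows and columns kept in order, not necessarily contiguous) that can be obtained from $S$ by changing some (possibly none) $0$-entries to $1$-entries. A tuple of columns of a matrix contains $S$ if the submatrix formed by these columns (in their order) contains $S$. $p_k(n)$ denotes the maximum number of $1$-entries in an $n\times n$ $(0,1)$-matrix such that no $(k+1)$-tuple of its columns contains all $(k+1)$-permutation matrices. Inverse Ackermann function: $\alpha_1(m)=\lceil m/2\rceil$; $\alpha_d(1)=0$ for $d\ge 2$; $\alpha_d(m)=1+\alpha_d(\alpha_{d-1}(m))$ for $m,d\ge 2$; and $\alpha(m)=\min\{k\ge 1:\alpha_k(m)\le 3\}$. Asymptotic notation is for $n\to\infty$, with implied constants depending only on $t$ where $t$ occurs. The equality with $\pm O(\cdot)$ means that $p_{2t+2}(n)$ is at least the expression with $-O(\cdot)$ and at most the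 expression with $+O(\cdot)$. *)

(* Defs.v *)
From mathcomp Require Import all_boot all_algebra.
From mathcomp Require Import zify.

Set Implicit Arguments.
Unset Strict Implicit.
Unset Printing Implicit Defensive.

(* (0,1)-matrices are boolean matrices, with [true] for a 1-entry. *)

Definition increasing m n (f : {ffun 'I_m -> 'I_n}) : bool :=
  [forall i : 'I_m, forall j : 'I_m, (i < j) ==> (f i < f j)].

Definition permutation_matrix k (S : 'M[bool]_k) : bool :=
  [forall i, #|[set j | S i j]| == 1] && [forall j, #|[set i | S i j]| == 1].

Definition contains m n k l (B : 'M[bool]_(m, n)) (S : 'M[bool]_(k, l)) : bool :=
  [exists f : {ffun 'I_k -> 'I_m}, exists g : {ffun 'I_l -> 'I_n},
    [&& increasing f, increasing g
      & [forall i, forall j, S i j ==> mxsub f g B i j]]].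

Definition weight m n (B : 'M[bool]_(m, n)) : nat :=
  #|[set ij : 'I_m * 'I_n | B ij.1 ij.2]|.

(* A k-tuple of columns of B is a choice of k distinct columns, listed in the
   order in which they occur in B. *)
Definition columns_contain_all m n k (B : 'M[bool]_(m, n)) : bool :=
  [exists g : {ffun 'I_k -> 'I_n},
    increasing g &&
    [forall S : 'M[bool]_k, permutation_matrix S ==> contains (colsub g B) S]].

(* The zero matrix is always admissible, so the maximum is attained. *)
Definition p (k n : nat) : nat :=
  \max_(B : 'M[bool]_n | ~~ columns_contain_all k.+1 B) weight B.

(* Number of times [f] is applied, starting from [m], before reaching a value
   <= 1; [fuel] bounds the number of applications. *)
Fixpoint iterations_to_one (f : nat -> nat) (fuel m : nat) : nat :=
  if fuel is fuel'.+1 then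
    if m <= 1 then 0 else (iterations_to_one f fuel' (f m)).+1
  else 0.

(* The hierarchy is indexed by d >= 1; the value at d = 0 is irrelevant.  The
   recursive equations are [alpha1E], [alpha_hier_one] and [alpha_hier_rec]. *)
Fixpoint alpha_hier (d m : nat) : nat :=
  match d with
  | 0 => 0
  | d'.+1 => match d' with
             | 0 => uphalf m
             | _ => iterations_to_one (alpha_hier d') m m
             end
  end.

Lemma alpha1E m : alpha_hier 1 m = uphalf m.
Proof. by []. Qed.

Lemma alpha_hier_one d : 2 <= d -> alpha_hier d 1 = 0.
Proof. by case: d => [|[|d]]. Qed.

Lemma iterations_to_one_le f fuel m :
  (forall k, f k <= uphalf k) -> iterations_to_one f fuel m <= uphalf m.
Proof.
move=> fle; elim: fuel m => [|fuel IH] m //=.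
case: ifP => // m_gt1; have [fm_le1|fm_gt1] := leqP (f m) 1.
  by case: fuel {IH} => [|fuel] /=; rewrite ?fm_le1; lia.
by have := IH (f m); have := fle m; lia.
Qed.

Lemma alpha_hier_le d m : alpha_hier d m <= uphalf m.
Proof.
elim: d m => [|[|d] IH] m //.
exact: iterations_to_one_le IH.
Qed.

Lemma iterations_to_one_fuel f fuel1 fuel2 m :
  (forall k, f k <= uphalf k) -> m <= fuel1 -> m <= fuel2 ->
  iterations_to_one f fuel1 m = iterations_to_one f fuel2 m.
Proof.
move=> fle; elim: fuel1 fuel2 m => [|fuel1 IH] [|fuel2] m //=.
- by case: ifP => //; lia.
- by case: ifP => //; lia.
move=> le1 le2; case: ifP => // m_gt1; congr _.+1.
by apply: IH; have := fle m; lia.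
Qed.

Lemma alpha_hier_rec d m : 2 <= d -> 2 <= m ->
  alpha_hier d m = 1 + alpha_hier d (alpha_hier d.-1 m).
Proof.
case: d => [|[|d]] // _; case: m => [|[|m]] // _.
have fle := alpha_hier_le d.+1.
have hierE k : alpha_hier d.+2 k = iterations_to_one (alpha_hier d.+1) k k.
  by [].
rewrite -[d.+2.-1]/d.+1 !hierE.
move: (alpha_hier d.+1) fle {hierE} => f fle.
rewrite add1n -[LHS]/(iterations_to_one f m.+1 (f m.+2)).+1.
congr _.+1; apply: iterations_to_one_fuel => //.
by have := fle m.+2; lia.
Qed.

Lemma alpha_hier_ex m : exists k, (1 <= k) && (alpha_hier k m <= 3).
Proof.
have [m_le1|m_gt1] := leqP m 1.
  by exists 1; have := alpha_hier_le 1 m; lia.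
suff H k : alpha_hier k.+1 m <= maxn 3 (m - k).
  by exists m.+1; have := H m; lia.
elim: k => [|k IH]; first by have := alpha_hier_le 1 m; lia.
rewrite alpha_hier_rec // add1n -[k.+2.-1]/k.+1.
by have := alpha_hier_le k.+2 (alpha_hier k.+1 m); lia.
Qed.

Definition alpha (m : nat) : nat := ex_minn (alpha_hier_ex m).

(* Main.v *)
Require Import Defs.
From mathcomp Require Import all_boot all_order all_algebra zify.

(**
Upper bounds: if k+1 columns all have a one in each of k+1 consecutive row
intervals (a formation), then they contain all permutation matrices. Cut each
column into chunks of Q ones and bound the number of chunks: group the rows
into layers; a chunk inside one layer is handled by induction, a chunk with
many ones in its first, last or a middle layer has to avoid a shorter
formation there, and the remaining chunks meet many layers and survive the
contraction of each layer to one row. Balancing gives linearly many chunks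
when Q satisfies x_d = 2 y_d + z_d x_(d-1), where y and z are the quotas for
formations of orders s-1 and s-2 and d is about alpha(n).

Lower bounds: suppose k+1 columns contain all permutation matrices. Scanning
the rows and always removing the column that appears last leaves two columns
whose ones alternate k+2 times, so it suffices to construct matrices with many
ones in which the ones of any two columns alternate at most k+1 times. They
are built by a double induction: every block of an outer sequence is spread
over the blocks of a fresh copy of a sequence with shorter blocks, one symbol
per block. For even orders the blocks of the outer sequence are first replaced
by sequences whose order is smaller by 2, which multiplies the number of
occurrences, 2^C(k,t); for order 3 the first and the last occurrence of each
symbol are doubled instead, which adds 2 at each level.
*)

Set Implicit Arguments.
Unset Strict Implicit.
Unset Printing Implicit Defensive.

(** * The Ackermann hierarchy *)

(** In the upper bound the recursion loses a factor polynomial in the argument x of the d-th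
    Ackermann function. At the level d = [alpha n] the argument 3 is enough, so this factor is a
    constant and the whole dependence on n sits in the quota. The quota is needed because
    contracting a layer forgets how many ones a column has there: an allowance per layer has to be
    multiplied by the number of layers met.

    In the lower bound a matrix only records which symbols occur in a row, so the order inside a row
    is free and is chosen to keep words short. Two symbols that never share a block gain no run when
    blocks are replaced or doubled, since their letters are merely repeated. Pairs sharing a block
    are the obstacle. The invariants carried through grafting say that such a pair shares a single
    block and that the words around it are short enough for the new letters to merge with their
    neighbours. Lengths obey Ackermann recursions, so they exceed n only a bounded number of levels
    below [alpha n], and this shift affects error terms only. *)

Fixpoint ack d x := if d is d'.+1 then iter x (ack d') 1 else x.*2.

Lemma ack0 x : ack 0 x = x.*2. Proof. by []. Qed.
Lemma ackS0 d : ack d.+1 0 = 1. Proof. by []. Qed.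
Lemma ackSS d x : ack d.+1 x.+1 = ack d (ack d.+1 x). Proof. by []. Qed.

Lemma ack_1 d : ack d 1 = 2.
Proof. by elim: d. Qed.

Lemma ack_2 d : ack d 2 = 4.
Proof. by elim: d => // d IH; rewrite ackSS ack_1. Qed.

Lemma ack_3S d : ack d.+1 3 = ack d 4.
Proof. by rewrite ackSS ack_2. Qed.

Lemma ack_ltS d x : ack d x < ack d x.+1.
Proof.
elim: d x => [|d IH] x; first by rewrite !ack0; lia.
rewrite ackSS.
have mono y z : y <= z -> ack d y <= ack d z by apply: (homo_leq leqnn leq_trans) => i; apply: ltnW.
have gt y : 0 < y -> y < ack d y.
  elim: y => // -[_ _|y IHy _]; first by rewrite ack_1.
  exact: leq_ltn_trans (IHy isT) (IH _).
apply: (gt); elim: x => // x IHx; rewrite ackSS.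
exact: leq_trans IHx (ltnW (gt _ IHx)).
Qed.

Lemma leq_ack d x y : x <= y -> ack d x <= ack d y.
Proof. by apply: (homo_leq leqnn leq_trans) => i; apply: ltnW (ack_ltS d i). Qed.

Lemma ltn_ack_arg d x : 0 < x -> x < ack d x.
Proof.
elim: x => // -[_ _|x IHx _]; first by rewrite ack_1.
exact: leq_ltn_trans (IHx isT) (ack_ltS _ _).
Qed.

Lemma leq_ack_arg d x : x <= ack d x.
Proof. by case: x => // x; apply/ltnW/ltn_ack_arg. Qed.

Lemma ack_gt0 d x : 0 < x -> 0 < ack d x.
Proof. by move=> x0; apply: leq_trans (leq_ack_arg d x). Qed.

Lemma leq_ack_index d d' x : d <= d' -> ack d x <= ack d' x.
Proof.
have step e y : ack e y <= ack e.+1 y.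
  case: y => [|y]; first by case: e.
  rewrite ackSS; apply: leq_ack; elim: y => // y IH.
  by rewrite ackSS; apply: leq_ltn_trans (IH) (ltn_ack_arg _ _); apply: leq_trans IH.
by apply: (homo_leq (f := fun e => ack e x) leqnn leq_trans).
Qed.

Lemma ack1E x : ack 1 x = 2 ^ x.
Proof. by elim: x => // x IH; rewrite ackSS IH ack0 expnS mul2n. Qed.

(** Inverse relation through which all later statements speak of [ack] only. The index shifts
    because halving is level 1 of one hierarchy and doubling is level 0 of the other. The inner
    induction on m follows [alpha_hier_rec], which matches [ackSS]. *)
Lemma alpha_hier_leq d m x : (alpha_hier d.+1 m <= x) = (m <= ack d x).
Proof.
elim: d m x => [|d IH] m x; first by rewrite ack0 /=; lia.
elim/ltn_ind: m x => m IHm x.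
have [m1|m1] := leqP m 1.
  have -> : alpha_hier d.+2 m = 0 by case: m m1 {IHm} => [|[]].
  case: x => [|x]; first by rewrite ackS0; lia.
  rewrite leq0n; symmetry; apply: leq_trans m1 _.
  exact: ack_gt0.
rewrite alpha_hier_rec // -[d.+2.-1]/d.+1 add1n.
have lt : alpha_hier d.+1 m < m by have := alpha_hier_le d.+1 m; lia.
case: x => [|x]; first by rewrite ackS0; lia.
by rewrite ltnS IHm // IH ackSS.
Qed.

Lemma leq_ack_alpha n : n <= ack (alpha n).-1 3.
Proof.
rewrite -alpha_hier_leq /alpha; case: ex_minnP => -[|k] //.
Qed.

(** As [ack] increases with its index, [alpha n] is one more than the least d with
    [n <= ack d 3]. *)
Lemma ltn_alpha d n : (d.+1 < alpha n) = (ack d 3 < n).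
Proof.
rewrite [LHS]ltnNge [RHS]ltnNge; congr (~~ _).
apply/idP/idP => [le|le]; last first.
  by rewrite -alpha_hier_leq in le; rewrite /alpha; case: ex_minnP => k _; apply.
by apply: leq_trans (leq_ack_alpha n) (leq_ack_index _ _); lia.
Qed.

(** * Size estimates for the lower bound recursions *)

Lemma leq_mul_exp2 z : 6 <= z -> 6 * z ^ 2 + 5 <= 2 ^ z.+2.
Proof.
elim: z => // z IH; rewrite leq_eqVlt => /orP[/eqP <- //|lt].
by have := IH lt; rewrite (expnS 2 z.+2) -!mulnn; nia.
Qed.

(** One application of [ack j] absorbs both a product of two earlier sizes and the passage from a
    block length g to the argument 6 g + 5 at which the next sequence is bounded. *)
Lemma ack_square j z : 2 <= j -> 5 <= z -> 6 * z ^ 2 + 5 <= ack j z.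
Proof.
move=> j2 z5; apply: leq_trans (leq_ack_index z j2).
rewrite -(subnKC z5); move: (z - 5) => {z5} z.
rewrite addSn ackSS ack1E; set w := ack 2 _.
have wz : z.+2 + 6 <= w.
  rewrite /w; elim: z {w} => [|z IH]; last by apply: leq_ltn_trans IH (ack_ltS _ _).
  by rewrite addn0 ackSS ack1E -[ack 2 3]/16; apply: leq_trans (ltnW (ltn_expl 16 _)).
apply: (@leq_trans (2 ^ (5 + z).+3)); last by rewrite leq_exp2l //; lia.
have [->|z0] := posnP z; first by [].
by apply: leq_trans (leq_mul_exp2 _) _; [lia|rewrite leq_exp2l].
Qed.

Section Growth.
Variables (j m : nat) (j2 : 2 <= j).
Let A := ack j.
Let Y := ack j.+1 (6 * m + 5).

Let Y5 : 5 <= Y.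
Proof. by apply: leq_trans (leq_ack_arg _ _); rewrite leq_addl. Qed.

Let AY n : 5 <= iter n A Y.
Proof. by elim: n => // n IH; apply: leq_trans (leq_ack_arg _ _). Qed.

Let stepA n z : z <= 6 * (iter n A Y) ^ 2 + 5 -> z <= iter n.+1 A Y.
Proof. by move=> h; apply: leq_trans h (ack_square j2 (AY n)). Qed.

Let iterA n : iter n A Y <= iter n.+1 A Y.
Proof. exact: leq_ack_arg. Qed.

(** Raising m by one buys six applications of [ack j], which explains the factor 6 in the size
    bounds. They are spent two at a time: on the inserted sequence, on the outer sequence and on the
    product of all sizes. *)
Lemma iter_ack_recursion : iter 6 A Y = ack j.+1 (6 * m.+1 + 5).
Proof. by rewrite (_ : 6 * m.+1 + 5 = (6 * m + 5).+4.+2) //; lia. Qed.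

Lemma ack_growth1 g f : g <= Y -> f <= A (6 * g + 5) -> f <= iter 2 A Y.
Proof.
move=> gY fA; apply: leq_trans fA (leq_ack _ _).
by apply: (@stepA 0) => /=; have := Y5; rewrite -mulnn; nia.
Qed.

Lemma ack_growth2 g f n f' : g <= Y -> f <= iter 2 A Y -> n <= g * f ->
  f' <= A (6 * n + 5) -> f' * f * g <= ack j.+1 (6 * m.+1 + 5).
Proof.
move=> gY fU nN f'A; rewrite -iter_ack_recursion.
have YU : Y <= iter 2 A Y by apply: leq_trans (iterA 0) (iterA 1).
set U := iter 2 A Y in fU YU.
have f'V : f' <= iter 4 A Y.
  apply: leq_trans f'A (leq_ack _ _); apply: (@stepA 2); rewrite -/U leq_add2r leq_mul2l /=.
  by apply: leq_trans nN _; rewrite -mulnn leq_mul // (leq_trans gY).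
have UV : U <= iter 4 A Y by apply: leq_trans (iterA 2) (iterA 3).
set V := iter 4 A Y in f'V UV.
have h : V ^ 3 <= iter 6 A Y.
  have h5 : 6 * V ^ 2 + 5 <= iter 5 A Y by apply: stepA.
  apply: (@stepA 5); apply: (@leq_trans (6 * (6 * V ^ 2 + 5) ^ 2)).
    have := AY 4; rewrite -/V => V5; rewrite (expnS V 2) -!mulnn; nia.
  by apply: leq_trans (leq_addr _ _); rewrite leq_mul2l /= leq_sqr.
apply: leq_trans h; rewrite (expnS V 2) -mulnn -mulnA; apply: leq_mul => //.
by apply: leq_mul; [apply: leq_trans fU UV|apply: leq_trans gY (leq_trans YU UV)].
Qed.

Lemma ack_growth3 g f : g <= Y -> f <= A (6 * g + 5) -> f * g <= ack j.+1 (6 * m.+1 + 5).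
Proof.
move=> gY fA; apply: leq_trans (ack_growth2 (n := 0) (f' := 1) gY (ack_growth1 gY fA) _ _) => //.
  by rewrite mul1n.
by apply: ack_gt0.
Qed.
End Growth.

(** * Formations *)

Definition ones (T : Type) (e : T -> nat -> bool) x a b := count (e x) (index_iota a b).
Definition hits (T : Type) (e : T -> nat -> bool) x a b := has (e x) (index_iota a b).

Section Formations.
Variable T : finType.
Implicit Types (e : T -> nat -> bool) (X Y : {set T}).

(** Rows after the last interval may be left over, so enlarging the range on either side keeps a
    formation. *)
Fixpoint formation e s Y a b : Prop :=
  if s is s'.+1 then
    exists c, [/\ a <= c, c <= b, {in Y, forall x, hits e x a c}
                & formation e s' Y c b]
  else True.

Definition formation_free r s e X a b :=
  forall Y, Y \subset X -> formation e s Y a b -> #|Y| < r.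

Lemma hitsP e x a b : reflect (exists2 i, a <= i < b & e x i) (hits e x a b).
Proof.
apply: (iffP hasP) => [[i]|[i]]; rewrite ?mem_index_iota; exists i => //.
by rewrite mem_index_iota.
Qed.

Lemma hits_sub e x a b a' b' : a' <= a -> b <= b' -> hits e x a b -> hits e x a' b'.
Proof. by move=> ? ? /hitsP[i ? ?]; apply/hitsP; exists i => //; lia. Qed.

Lemma formation_sub e s Y a b a' b' : a' <= a -> b <= b' ->
  formation e s Y a b -> formation e s Y a' b'.
Proof.
elim: s a a' => //= s IH a a' lea leb [c [ac cb hc fc]].
exists c; split=> //; try lia; last exact: IH fc.
by move=> x xY; apply: hits_sub (hc x xY).
Qed.

Lemma formation_cons e s Y a b c : a <= c <= b ->
  {in Y, forall x, hits e x a c} -> formation e s Y c b -> formation e s.+1 Y a b.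
Proof. by case/andP=> ac cb h f; exists c. Qed.

Lemma formation_rcons e s Y a b c : a <= c <= b ->
  formation e s Y a c -> {in Y, forall x, hits e x c b} -> formation e s.+1 Y a b.
Proof.
case/andP; elim: s a => [|s IH] a ac cb /=.
  by move=> _ h; exists b; split=> //; [lia|move=> x /h; apply: hits_sub].
case=> d [ad dc hd fd] h; exists d; split=> //; first lia.
exact: IH fd h.
Qed.

Lemma ones_cat e x a b c : a <= b <= c -> ones e x a c = ones e x a b + ones e x b c.
Proof.
case/andP=> ab bc; rewrite /ones -count_cat; congr count.
by rewrite /index_iota -{2}(subnKC ab) -iotaD; congr iota; lia.
Qed.

Lemma ones_gt0 e x a b : (0 < ones e x a b) = hits e x a b.
Proof. by rewrite /ones /hits has_count. Qed.

Lemma onesS e x a m : ones e x a (a + m.+1) = e x a + ones e x a.+1 (a.+1 + m).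
Proof. by rewrite (@ones_cat _ _ a a.+1); [rewrite /ones /index_iota subSnn /= addn0 addSnnS|lia]. Qed.

Lemma formation_free_sub r s e X a b X' a' b' :
  X' \subset X -> a <= a' -> b' <= b ->
  formation_free r s e X a b -> formation_free r s e X' a' b'.
Proof.
move=> sX la lb fr Y sY f; apply: fr (subset_trans sY sX) _.
exact: formation_sub f.
Qed.

(** The common hits before c serve as a first interval. Hence ones with hits on one side of them
    avoid order s - 1, and ones with hits on both sides avoid order s - 2. *)
Lemma formation_freeL r s e X a b c : a <= c <= b ->
  {in X, forall x, hits e x a c} -> formation_free r s.+1 e X a b ->
  formation_free r s e X c b.
Proof.
move=> acb h fr Y sY f; apply: fr => //; apply: formation_cons f => //.
by move=> x xY; apply/h/(subsetP sY).
Qed.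

Lemma formation_freeR r s e X a b c : a <= c <= b ->
  {in X, forall x, hits e x c b} -> formation_free r s.+1 e X a b ->
  formation_free r s e X a c.
Proof.
move=> acb h fr Y sY f; apply: fr => //; apply: formation_rcons f _ => //.
by move=> x xY; apply/h/(subsetP sY).
Qed.

End Formations.

(** * Bounding the number of columns with many ones *)

Definition columns_bounded r s Q m F :=
  forall (T : finType) (e : T -> nat -> bool) (X : {set T}) a,
  formation_free r s e X a (a + m) -> {in X, forall x, Q < ones e x a (a + m)} -> #|X| <= F.

Lemma columns_bounded_leq r s Q m F Q' F' :
  Q <= Q' -> F <= F' -> columns_bounded r s Q m F -> columns_bounded r s Q' m F'.
Proof.
move=> leQ leF bd T e X a fr hX; apply: leq_trans (bd _ _ _ _ fr _) leF => x /hX.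
exact: leq_ltn_trans.
Qed.

Lemma card_cover_le (T : finType) (X : {set T}) m (C : nat -> {set T}) F :
  X \subset \bigcup_(j < m) C j -> (forall j, j < m -> #|C j| <= F j) ->
  #|X| <= \sum_(j < m) F j.
Proof.
move=> /subset_leq_card h hF; apply: leq_trans h _.
apply: (@leq_trans (\sum_(j < m) #|C j|)); last by apply: leq_sum => j _; apply: hF.
elim: m {hF} => [|m IH]; first by rewrite !big_ord0 cards0.
rewrite !big_ord_recr /=; apply: leq_trans (leq_card_setU _ _) _.
by rewrite leq_add2r.
Qed.

Lemma ones_le (T : finType) (e : T -> nat -> bool) x a m : ones e x a (a + m) <= m.
Proof. by rewrite /ones (leq_trans (count_size _ _)) // size_iota; lia. Qed.

Lemma formation_identical (T : finType) (e : T -> nat -> bool) s (Y : {set T}) x0 a m :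
  {in Y, forall x i, a <= i < a + m -> e x i = e x0 i} ->
  s <= ones e x0 a (a + m) -> formation e s Y a (a + m).
Proof.
elim: m s a => [|m IH] [|s] a eY hs //.
  by have := ones_le e x0 a 0; lia.
have eY' : {in Y, forall x i, a.+1 <= i < a.+1 + m -> e x i = e x0 i}.
  by move=> x xY i hi; apply: eY => //; lia.
rewrite onesS in hs; rewrite -addSnnS.
case ea : (e x0 a) hs => /= hs; last first.
  by apply: (@formation_sub _ _ s.+1 Y a.+1 (a.+1 + m)) => //; apply: IH.
apply: (@formation_cons _ _ _ _ _ _ a.+1); [lia| |by apply: IH].
by move=> x xY; apply/hitsP; exists a; rewrite ?eY //; lia.
Qed.

(** Columns with equal supports of at least s ones are a formation, and there are 2^m supports. The
    last factor m gives the bound the shape, constant times m, on which the recursion over layers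
    works. *)
Lemma columns_bounded_crude r s Q m : s <= Q.+1 -> columns_bounded r s Q m (r * 2 ^ m * m).
Proof.
move=> sQ T e X a fr hX.
have [->|[x xX]] := set_0Vmem X; first by rewrite cards0.
have m0 : 0 < m by have := hX x xX; have := ones_le e x a m; lia.
apply: leq_trans (leq_pmulr _ m0).
pose supp y : {ffun 'I_m -> bool} := [ffun i : 'I_m => e y (a + i)].
have -> : #|X| = \sum_(f : {ffun 'I_m -> bool}) #|[set y in X | supp y == f]|.
  rewrite -sum1_card (partition_big supp predT) //=; apply: eq_bigr => f _.
  by rewrite -sum1_card; apply: eq_bigl => y; rewrite !inE.
rewrite mulnC -[X in X ^ m]card_bool -[X in _ ^ X]card_ord -card_ffun -sum_nat_const.
apply: leq_sum => f _; set Y := [set y in X | supp y == f].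
have sY : Y \subset X by apply/subsetP => y; rewrite inE => /andP[].
have [Y0|[y0 y0Y]] := set_0Vmem Y; first by rewrite Y0 cards0.
apply/ltnW/(fr _ sY)/(formation_identical (x0 := y0)) => [y yY i hi|].
  move: yY y0Y; rewrite !inE => /andP[_ /eqP fy] /andP[_ /eqP fy0].
  have im : i - a < m by lia.
  have := congr1 (fun g : {ffun 'I_m -> bool} => g (Ordinal im)) (etrans fy (esym fy0)).
  by rewrite !ffunE /= subnKC //; lia.
by apply: leq_trans sQ _; apply/hX/(subsetP sY).
Qed.

Lemma ones_first (T : finType) (e : T -> nat -> bool) x a b : 0 < ones e x a b ->
  exists c, [/\ a <= c < b, e x c & ones e x c.+1 b = (ones e x a b).-1].
Proof.
rewrite ones_gt0 => /hitsP[i hi ei].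
have ex : exists i, (a <= i < b) && e x i by exists i; rewrite hi.
case: (ex_minnP ex) => c /andP[hc ec] hmin; exists c; split=> //.
rewrite (@ones_cat _ e x a c.+1 b) ?(@ones_cat _ e x a c c.+1); try lia.
have -> : ones e x a c = 0.
  apply/eqP; rewrite -leqn0 leqNgt ones_gt0; apply/hitsP => -[j hj ej].
  by have := hmin j; rewrite ej andbT; lia.
by rewrite {2}/ones /index_iota subSnn /= ec.
Qed.

(** Columns sharing the row of their first one have that row and the rows below it as a
    formation. *)
Lemma columns_bounded2 r m : columns_bounded r 2 1 m (r * m).
Proof.
move=> T e X a fr hX.
pose C j := [set x in X | e x (a + j) & hits e x (a + j).+1 (a + m)].
rewrite -[r * m]mulnC -[m in leqRHS]card_ord -sum_nat_const.
apply: (@card_cover_le _ _ _ C).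
  apply/subsetP => x xX; have h := hX _ xX.
  have [|c [hc ec oc]] := @ones_first _ e x a (a + m); first lia.
  have cm : c - a < m by lia.
  apply/bigcupP; exists (Ordinal cm) => //; rewrite inE xX /= subnKC; last lia.
  by rewrite ec -ones_gt0 oc; lia.
move=> j jm; apply/ltnW/fr; first by apply/subsetP => x; rewrite inE => /andP[].
apply: (@formation_cons _ _ _ _ _ _ (a + j).+1); first lia.
  move=> x; rewrite inE => /and3P[_ ex _]; apply/hitsP; exists (a + j) => //; lia.
apply: (@formation_cons _ _ _ _ _ _ (a + m)) => //; first lia.
by move=> x; rewrite inE => /and3P[].
Qed.

(** Classifying by the row of the second one gives three intervals: above it, the row itself, below
    it. *)
Lemma columns_bounded3 r m : columns_bounded r 3 2 m (r * m).
Proof.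
move=> T e X a fr hX.
pose C j := [set x in X | [&& hits e x a (a + j), e x (a + j) & hits e x (a + j).+1 (a + m)]].
rewrite -[r * m]mulnC -[m in leqRHS]card_ord -sum_nat_const.
apply: (@card_cover_le _ _ _ C).
  apply/subsetP => x xX; have h := hX _ xX.
  have [|c [hc ec oc]] := @ones_first _ e x a (a + m); first lia.
  have [|d [hd ed od]] := @ones_first _ e x c.+1 (a + m); first lia.
  have dm : d - a < m by lia.
  apply/bigcupP; exists (Ordinal dm) => //; rewrite inE xX /= subnKC; last lia.
  rewrite ed /=; apply/andP; split; last by rewrite -ones_gt0 od oc; lia.
  by apply/hitsP; exists c => //; lia.
move=> j jm; apply/ltnW/fr; first by apply/subsetP => x; rewrite inE => /andP[].
apply: (@formation_cons _ _ _ _ _ _ (a + j)); first lia.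
  by move=> x; rewrite inE => /and4P[].
apply: (@formation_cons _ _ _ _ _ _ (a + j).+1); first lia.
  move=> x; rewrite inE => /and4P[_ _ ex _]; apply/hitsP; exists (a + j) => //; lia.
apply: (@formation_cons _ _ _ _ _ _ (a + m)) => //; first lia.
by move=> x; rewrite inE => /and4P[].
Qed.

Section Contraction.
Variables (T : finType) (e : T -> nat -> bool) (lo : nat -> nat).
Hypothesis lo_mono : {homo lo : i j / i <= j}.

Definition contract (x : T) (j : nat) := hits e x (lo j) (lo j.+1).

Lemma hits_contract x i j : hits contract x i j -> hits e x (lo i) (lo j).
Proof.
case/hitsP=> l hl /hits_sub; apply; apply: lo_mono; lia.
Qed.

Lemma formation_contract s Y i j :
  formation contract s Y i j -> formation e s Y (lo i) (lo j).
Proof.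
elim: s i => //= s IH i [c [ic cj hc fc]].
exists (lo c); split; [exact: lo_mono|exact: lo_mono| |exact: IH].
by move=> x /hc; apply: hits_contract.
Qed.

Lemma ones_layers x b :
  ones e x (lo 0) (lo b) = \sum_(j < b) ones e x (lo j) (lo j.+1).
Proof.
elim: b => [|b IH]; first by rewrite big_ord0 /ones /index_iota subnn.
by rewrite big_ord_recr /= -IH; apply: ones_cat; rewrite !lo_mono.
Qed.

Lemma ones_contract x b : ones contract x 0 b = \sum_(j < b) contract x j.
Proof.
rewrite /ones -sum1_count big_mkcond /= big_mkord.
by apply: eq_bigr => j _; case: contract.
Qed.

Lemma sum_extreme_layers b (P : pred 'I_b) :
  (forall i j, P i -> P j -> i = j) -> \sum_(j < b) P j <= 1.
Proof.
move=> uP; case: (pickP P) => [i Pi|P0]; last by rewrite big1 // => j _; rewrite P0.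
rewrite (bigD1 i) //= big1 ?addn0 ?Pi // => j ji; case Pj: (P j) => //.
by rewrite (uP _ _ Pj Pi) eqxx in ji.
Qed.

(** A nonempty layer with nothing before it is the first, with nothing after it the last; there is
    at most one of each and each is charged Q1. All other nonempty layers are charged Q2, and at
    most Q3 layers are nonempty. The first hypothesis rules out a layer carrying all ones of x. *)
Lemma ones_extreme_layers x b Q1 Q2 Q3 :
  (forall j, j < b -> [\/ hits e x (lo 0) (lo j), hits e x (lo j.+1) (lo b)
     | ones e x (lo j) (lo j.+1) = 0]) ->
  (forall j, j < b -> hits e x (lo 0) (lo j) || hits e x (lo j.+1) (lo b) ->
     ones e x (lo j) (lo j.+1) <= Q1) ->
  (forall j, j < b -> hits e x (lo 0) (lo j) -> hits e x (lo j.+1) (lo b) ->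
     ones e x (lo j) (lo j.+1) <= Q2) ->
  ones contract x 0 b <= Q3 ->
  ones e x (lo 0) (lo b) <= 2 * Q1 + Q2 * Q3.
Proof.
move=> h0 h1 h2 h3; rewrite ones_layers.
pose f (j : 'I_b) := contract x j && ~~ hits e x (lo 0) (lo j).
pose l (j : 'I_b) := contract x j && ~~ hits e x (lo j.+1) (lo b).
have f1 : \sum_j f j <= 1.
  apply: sum_extreme_layers => i j /andP[ci fi] /andP[cj fj]; apply/val_inj => /=.
  case: (ltngtP i j) => // ij; [case/negP: fj|case/negP: fi];
    [apply: hits_sub ci|apply: hits_sub cj]; exact: lo_mono.
have l1 : \sum_j l j <= 1.
  apply: sum_extreme_layers => i j /andP[ci fi] /andP[cj fj]; apply/val_inj => /=.
  case: (ltngtP i j) => // ij; [case/negP: fi|case/negP: fj];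
    [apply: hits_sub cj|apply: hits_sub ci]; exact: lo_mono.
apply: (@leq_trans (\sum_(j < b) (Q1 * f j + Q1 * l j + Q2 * contract x j))).
  apply: leq_sum => j _; have jb := ltn_ord j.
  case cj : (contract x j); last first.
    by move: cj; rewrite /contract -ones_gt0; lia.
  have := h0 j jb; have := h1 j jb; have := h2 j jb.
  rewrite /f /l cj /=.
  case: (hits e x (lo 0) (lo j)); case: (hits e x (lo j.+1) (lo b)) => /= g2 g1 g0;
    try have := g1 isT; try have := g2 isT isT; try lia.
  by case: g0 => //; lia.
rewrite !big_split /= -!big_distrr /= -ones_contract.
apply: leq_trans (leq_add (leq_add (leq_mul (leqnn Q1) f1) (leq_mul (leqnn Q1) l1))
  (leq_mul (leqnn Q2) h3)) _; lia.
Qed.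
End Contraction.

(* The terms account for the columns concentrated in one layer, those with many
   ones in their first or last layer, those with many ones in a middle layer,
   and those meeting many layers. *)
Lemma columns_bounded_step r s Q Q1 Q2 Q3 m t b A A1 A2 B :
  m <= b * t -> 2 * Q1 + Q2 * Q3 <= Q ->
  (forall m', m' <= t -> columns_bounded r s.+2 Q m' (A * m')) ->
  (forall m', m' <= t -> columns_bounded r s.+1 Q1 m' (A1 * m')) ->
  (forall m', m' <= t -> columns_bounded r s Q2 m' (A2 * m')) ->
  columns_bounded r s.+2 Q3 b B ->
  columns_bounded r s.+2 Q m ((A + 2 * A1 + A2) * m + B).
Proof.
move=> mbt leQ bd bd1 bd2 bd3 T e X a fr hX.
(* The minimum truncates the last layers, so that layers of at most t rows tile exactly m rows even
   if b * t is larger; their true widths [w] sum to m. *)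
pose lo j := a + minn (j * t) m.
have lo_mono : {homo lo : i j / i <= j}.
  by move=> i j ij; rewrite /lo leq_add2l leq_min geq_minr andbT geq_min leq_mul2r ij orbT.
have lo0 : lo 0 = a by rewrite /lo mul0n min0n addn0.
have lob : lo b = a + m by rewrite /lo (minn_idPr mbt).
have [w hw wt] : exists2 w, (forall j, lo j.+1 = lo j + w j) & forall j, w j <= t.
  exists (fun j => lo j.+1 - lo j) => j; first by rewrite subnKC // lo_mono.
  by rewrite /lo mulSn; lia.
have sumw : \sum_(j < b) w j = m.
  apply/eqP; rewrite -(eqn_add2l a) -lob -{1}lo0; apply/eqP.
  elim: b {mbt bd3 lob} => [|c IH]; first by rewrite big_ord0 addn0.
  by rewrite big_ord_recr /= addnA IH hw.
pose X0 := [set x in X | Q3 < ones (contract e lo) x 0 b].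
pose bef x j := hits e x (lo 0) (lo j).
pose aft x j := hits e x (lo j.+1) (lo b).
pose C0 j := [set x in X | Q < ones e x (lo j) (lo j.+1)].
pose C1 j := [set x in X | (Q1 < ones e x (lo j) (lo j.+1)) && aft x j].
pose C2 j := [set x in X | (Q1 < ones e x (lo j) (lo j.+1)) && bef x j].
pose C3 j := [set x in X | [&& Q2 < ones e x (lo j) (lo j.+1), bef x j & aft x j]].
pose C j := C0 j :|: C1 j :|: C2 j :|: C3 j.
have subX (P : pred T) : [set x in X | P x] \subset X.
  by apply/subsetP => x; rewrite inE => /andP[].
(* By contraposition: a column in none of the classes has at most 2 Q1 + Q2 Q3 ones. *)
have cov : X \subset X0 :|: [set x in X | x \in \bigcup_(j < b) C j].
  apply/subsetP => x xX; rewrite !inE xX /= orbC; apply/orP.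
  case: (boolP (_ \in _)) => [|/bigcupP nC]; [by left|right].
  rewrite ltnNge; apply/negP => le3; have := hX _ xX; apply/negP; rewrite -leqNgt.
  have nCj j : j < b -> x \notin C j.
    by move=> jb; apply/negP => xC; case: nC; exists (Ordinal jb).
  apply: leq_trans leQ; rewrite -lob -lo0.
  apply: (@ones_extreme_layers _ e lo lo_mono x b Q1 Q2 Q3) => // j jb.
  - have := nCj j jb; rewrite !inE xX /= /bef /aft.
    case: (boolP (hits e x (lo 0) (lo j))) => [|nb]; first by constructor 1.
    case: (boolP (hits e x (lo j.+1) (lo b))) => [|na]; first by constructor 2.
    move=> _; case/negP: (nCj j jb); rewrite !inE xX /=; apply/orP; left; apply/orP; left; apply/orP; left.
    have := hX _ xX; rewrite -lob -{1}lo0.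
    rewrite (@ones_cat _ e x (lo 0) (lo j) (lo b)) ?(@ones_cat _ e x (lo j) (lo j.+1) (lo b)) ?lo_mono //; try lia.
    by move: nb na; rewrite -!ones_gt0; lia.
  - by have := nCj j jb; rewrite !inE xX /= /bef /aft; case: hits; case: hits => //=; lia.
  - by move=> hb ha; have := nCj j jb; rewrite !inE xX /= /bef /aft hb ha; lia.
have cX0 : #|X0| <= B.
  apply: (bd3 _ (contract e lo) _ 0) => [Y sY fY|x]; last by rewrite inE => /andP[].
  apply: fr; first exact: subset_trans sY (subX _).
  by rewrite -lob -lo0; apply: formation_contract.
have cX1 : #|[set x in X | x \in \bigcup_(j < b) C j]| <= (A + 2 * A1 + A2) * m.
  rewrite -sumw big_distrr /=.
  apply: (@card_cover_le _ _ _ C (fun j => (A + 2 * A1 + A2) * w j)) => [|j jb].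
    by apply/subsetP => x; rewrite inE => /andP[].
  have lj : a <= lo j <= a + m by rewrite -lob -{1}lo0 !lo_mono //; lia.
  have lj1 : lo j <= lo j.+1 <= a + m by rewrite -lob !lo_mono.
  have c0 : #|C0 j| <= A * w j.
    apply: (bd _ (wt j) _ e _ (lo j)); rewrite -?hw.
      by apply: formation_free_sub fr; [exact: subX|lia|lia].
    by move=> x; rewrite inE => /andP[].
  have c1 : #|C1 j| <= A1 * w j.
    apply: (bd1 _ (wt j) _ e _ (lo j)); rewrite -?hw.
      apply: (@formation_freeR _ _ _ _ _ _ (a + m)) => //.
        by move=> x; rewrite inE /aft -lob => /and3P[].
      by apply: formation_free_sub fr; [exact: subX|lia|lia].
    by move=> x; rewrite inE => /and3P[].
  have c2 : #|C2 j| <= A1 * w j.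
    apply: (bd1 _ (wt j) _ e _ (lo j)); rewrite -?hw.
      apply: (@formation_freeL _ _ _ _ _ a); first lia.
        by move=> x; rewrite inE /bef lo0 => /and3P[].
      by apply: formation_free_sub fr; [exact: subX|lia|lia].
    by move=> x; rewrite inE => /and3P[].
  have c3 : #|C3 j| <= A2 * w j.
    apply: (bd2 _ (wt j) _ e _ (lo j)); rewrite -?hw.
      apply: (@formation_freeR _ _ _ _ _ _ (a + m)) => //.
        by move=> x; rewrite inE /aft -lob => /and4P[].
      apply: (@formation_freeL _ _ _ _ _ a); first lia.
        by move=> x; rewrite inE /bef lo0 => /and4P[].
      by apply: formation_free_sub fr; [exact: subX|lia|lia].
    by move=> x; rewrite inE => /and4P[].
  apply: leq_trans (leq_card_setU _ _) _.
  apply: leq_trans (leq_add (leq_card_setU _ _) (leqnn _)) _.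
  apply: leq_trans (leq_add (leq_add (leq_card_setU _ _) (leqnn _)) (leqnn _)) _.
  by rewrite 2!mulnDl mul2n -addnn mulnDl; lia.
apply: leq_trans (subset_leq_card cov) _.
apply: leq_trans (leq_card_setU _ _) _.
by rewrite addnC leq_add.
Qed.

(** Up to order 3 the quota s - 1 is enough. Beyond, twice the quota of order s - 1 pays for the two
    extreme layers, and the quota of order s - 2 for each of the layers met, whose number the
    contracted matrix bounds by the quota of level d - 1. The value s at level 0 is what the crude
    bound can handle. *)
Fixpoint quota (s : nat) : nat -> nat :=
  if s is (s2.+1 as s1).+1 then
    if s2 is _.+2 then
      fix go d := if d is d'.+1 then 2 * quota s1 d + quota s2 d * go d' else s
    else fun=> s1
  else fun=> 0.

Lemma quotaS s d :
  quota s.+4 d.+1 = 2 * quota s.+3 d.+1 + quota s.+2 d.+1 * quota s.+4 d.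
Proof. by []. Qed.

Lemma leq_quota s d : s.-1 <= quota s d.
Proof.
elim: s d => [|s IH] [|d] //; first by case: s IH => [|[|[|s]]].
case: s IH => [|[|[|s]]] // IH; rewrite quotaS.
by have := IH d.+1; rewrite /=; lia.
Qed.

(* With layers of y ^ E rows, y = ack d x, the contracted matrix has about
   m / y ^ E rows, which absorbs the factor y ^ s. *)
Lemma columns_bounded_ack r E C s d x m :
  r * 2 ^ (2 ^ E) * 2 ^ E <= C -> 2 <= s <= E -> 0 < d -> 0 < x -> m <= ack d x ^ E ->
  columns_bounded r s (quota s d) m (C * 3 ^ s * x ^ s * m).
Proof.
move=> leC; elim/ltn_ind: s d x m => s IHs d x m /andP[s2 sE] d0 x0 lem.
have xs s' : 0 < x ^ s' by rewrite expn_gt0 x0.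
have ge_c s' : C <= C * 3 ^ s' by rewrite leq_pmulr // expn_gt0.
have rC : r <= C by apply: leq_trans leC; rewrite -mulnA leq_pmulr // muln_gt0 !expn_gt0.
case: s IHs s2 sE xs ge_c => [|[|[|[|s]]]] // IHs s2 sE xs ge_c.
- apply: columns_bounded_leq (leqnn _) _ (@columns_bounded2 r m).
  by rewrite leq_mul2r (leq_trans rC) ?orbT // (leq_trans (ge_c 2)) // leq_pmulr.
- apply: columns_bounded_leq (leqnn _) _ (@columns_bounded3 r m).
  by rewrite leq_mul2r (leq_trans rC) ?orbT // (leq_trans (ge_c 3)) // leq_pmulr.
have ge_c1 n : 0 < n -> C * n <= C * 3 ^ s.+4 * n by move=> _; rewrite leq_mul2r ge_c orbT.
elim: d d0 x x0 m lem xs => // d IHd _ x x0.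
elim: x x0 => // x IHx _ m lem xs.
(* For the argument 1 there are at most 2^E rows, and C dominates the crude bound there. *)
have [x1|x1] := posnP x.
  rewrite x1 ack_1 in lem *; rewrite exp1n muln1.
  have crude := @columns_bounded_crude r s.+4 (quota s.+4 d.+1) m (leq_quota s.+4 d.+1).
  apply: columns_bounded_leq (leqnn _) _ crude.
  rewrite leq_mul2r (leq_trans _ (ge_c s.+4)) ?orbT //; apply: leq_trans leC.
  by rewrite -mulnA leq_mul2l (leq_trans _ (leq_pmulr _ _)) ?orbT ?expn_gt0 // leq_exp2l.
rewrite ackSS in lem; set y := ack d.+1 x in lem.
have y0 : 0 < y by apply: ack_gt0.
have t0 : 0 < y ^ E by rewrite expn_gt0 y0.
have xx : x ^ s.+4 <= x.+1 ^ s.+4 by rewrite leq_exp2r.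
have xs' s' : 0 < x ^ s' by rewrite expn_gt0 x1.
have [le1|lt1] := leqP m (y ^ E).
  apply: columns_bounded_leq (leqnn _) _ (IHx x1 m le1 xs').
  by rewrite leq_mul2r leq_mul2l xx !orbT.
set t := y ^ E in lt1 t0 *.
have m0 : 0 < m by apply: leq_ltn_trans lt1.
pose b := (m.-1 %/ t).+1.
have mbt : m <= b * t by rewrite -(prednK m0) -ltn_divLR // /b.
have btm : b * t <= 2 * m by rewrite /b mulSn; have := leq_trunc_div m.-1 t; lia.
have bm : b <= m by rewrite -[in leqRHS](prednK m0) /b ltnS leq_div.
have bd m' : m' <= t -> columns_bounded r s.+4 (quota s.+4 d.+1) m' (C * 3 ^ s.+4 * x ^ s.+4 * m').
  by move=> lt; apply: IHx.
have bd1 m' : m' <= t -> columns_bounded r s.+3 (quota s.+3 d.+1) m' (C * 3 ^ s.+3 * x ^ s.+3 * m').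
  by move=> lt; apply: IHs => //; lia.
have bd2 m' : m' <= t -> columns_bounded r s.+2 (quota s.+2 d.+1) m' (C * 3 ^ s.+2 * x ^ s.+2 * m').
  by move=> lt; apply: IHs => //; lia.
(* The contracted matrix is handled one level lower. If that level is 0 it has at most 2^E rows.
   Otherwise the induction on the level applies with argument y, and its factor y^s is absorbed,
   since y^s b <= y^E b <= 2 m. *)
have bd3 : columns_bounded r s.+4 (quota s.+4 d) b (C * 3 ^ s.+4 * (2 * m)).
  move: lem; case: d IHd @y y0 @t t0 lt1 @b {bd bd1 bd2 IHx} mbt btm bm => [_|d IHd] y y0 t t0 lt1 b mbt btm bm lem.
    have bE : b <= 2 ^ E.
      by rewrite /b ltn_divLR // prednK // /t -expnMn mul2n.
    apply: columns_bounded_leq (leqnn _) _ (@columns_bounded_crude r s.+4 (quota s.+4 0) b (leq_quota s.+4 0)).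
    apply: (@leq_trans C); last by apply: leq_trans (ge_c s.+4) _; rewrite leq_pmulr // muln_gt0.
    by apply: leq_trans leC; rewrite !leq_mul // leq_exp2l.
  have bl : b <= ack d.+1 y ^ E by apply: leq_trans lem.
  have y0s s' : 0 < y ^ s' by rewrite expn_gt0 y0.
  apply: columns_bounded_leq (leqnn _) _ (IHd isT y y0 b bl y0s).
  rewrite -mulnA leq_mul2l; apply/orP; right; apply: leq_trans btm.
  by rewrite mulnC leq_mul2l leq_pexp2l ?orbT.
apply: columns_bounded_leq (leqnn _) _ (columns_bounded_step mbt _ bd bd1 bd2 bd3); last by rewrite quotaS.
(* In units of u the step from x to x + 1 has to cover the terms of three consecutive orders and the
   contribution 18 of the contracted matrix. The weights 3^s leave room for this: 9 (x + 1)^2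
   exceeds 9 x^2 + 6 x + 1. *)
set X := x ^ s.+2; set Y := x.+1 ^ s.+2; set u := C * 3 ^ s.+2.
have XY : X < Y by rewrite ltn_exp2r.
have -> : C * 3 ^ s.+4 * x ^ s.+4 = u * (9 * (X * x ^ 2)) by rewrite /u /X -(addn2 s.+2) !expnD; lia.
have -> : C * 3 ^ s.+3 * x ^ s.+3 = u * (3 * (X * x)) by rewrite /u /X !(expnS _ s.+2); lia.
have -> : C * 3 ^ s.+4 * x.+1 ^ s.+4 = u * (9 * (Y * x.+1 ^ 2)) by rewrite /u /Y -(addn2 s.+2) !expnD; lia.
have -> : C * 3 ^ s.+4 = u * 9 by rewrite /u -(addn2 s.+2) expnD; lia.
have le : 9 * (X * x ^ 2) + 6 * (X * x) + X + 18 <= 9 * (Y * x.+1 ^ 2).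
  apply: (@leq_trans (9 * (X.+1 * x.+1 ^ 2))); last by rewrite !leq_mul.
  move: X {XY} => X; rewrite -!mulnn; nia.
apply: leq_trans (leq_mul (leq_mul (leqnn u) le) (leqnn m)); lia.
Qed.

(* Two chunks of the same column lie in disjoint row ranges, so they never occur
   together in a formation of order at least 2. *)
Section Split.
Variables (T : finType) (e : T -> nat -> bool) (Q m : nat).

Definition chunk (z : T * 'I_m) i :=
  e z.1 i && (ones e z.1 0 i %/ Q.+1 == z.2).

Lemma ones_chunk x (j : 'I_m) n :
  ones chunk (x, j) 0 n = minn (j.+1 * Q.+1) (ones e x 0 n) - j * Q.+1.
Proof.
elim: n => [|n IH]; first by rewrite /ones /index_iota /= minn0.
have onesSr (U : finType) (f : U -> nat -> bool) z : ones f z 0 n.+1 = ones f z 0 n + f z n.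
  by rewrite (@ones_cat _ f z 0 n n.+1) ?leqnSn // {2}/ones /index_iota subSnn /= addn0.
rewrite !onesSr IH /chunk /=.
case: (e x n) => /=; last by rewrite !addn0.
have -> : (ones e x 0 n %/ Q.+1 == j) = (j * Q.+1 <= ones e x 0 n < j.+1 * Q.+1).
  by rewrite eqn_leq -[in LHS]ltnS ltn_divLR // leq_divRL // andbC.
set o := ones e x 0 n; rewrite mulSn.
by case: (boolP (_ && _)) => /=; lia.
Qed.

Lemma formation_free_chunk r s (X : {set T * 'I_m}) :
  formation_free r s.+2 e setT 0 m -> formation_free r s.+2 chunk X 0 m.
Proof.
move=> fr Y _ fY.
have inj : {in Y &, injective (fun z => z.1)}.
  have lt x i j a b : chunk (x, i) a -> chunk (x, j) b -> a <= b -> i <= j.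
    case/andP=> _ /eqP /= <- /andP[_ /eqP /= <-] ab; apply: leq_div2r.
    by rewrite (@ones_cat _ e x 0 a b) // leq_addr.
  case: fY => c [_ _ h1 [d [_ _ h2 _]]] [x i] [x' j] zi zj /= xx'; move: zj; rewrite -{}xx' => zj.
  congr (_, _); apply/val_inj/eqP => /=; rewrite eqn_leq.
  case/hitsP: (h1 _ zi) => i1 hi1 ei1; case/hitsP: (h2 _ zi) => i2 hi2 ei2.
  case/hitsP: (h1 _ zj) => j1 hj1 ej1; case/hitsP: (h2 _ zj) => j2 hj2 ej2.
  by rewrite (lt _ _ _ _ _ ei1 ej2) ?(lt _ _ _ _ _ ej1 ei2) //; lia.
rewrite -(card_in_imset inj); apply: fr; first exact: subsetT.
elim: s.+2 0 fY => //= n IH a [c [ac cm h f]]; exists c; split=> //; last exact: IH.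
move=> _ /imsetP[z zY ->]; case/hitsP: (h _ zY) => i hi /andP[ei _].
by apply/hitsP; exists i.
Qed.

(** Only complete chunks, with Q + 1 ones, are counted by F. Each column leaves at most one
    incomplete chunk, whence the term for the number of columns. *)
Lemma ones_sum_bound r s F :
  formation_free r s.+2 e setT 0 m -> columns_bounded r s.+2 Q m F ->
  \sum_x ones e x 0 m <= Q.+1 * (F + #|T|).
Proof.
move=> fr bd.
pose X := [set z : T * 'I_m | Q < ones chunk z 0 m].
have cX : #|X| <= F.
  apply: (bd _ chunk X 0); first exact: formation_free_chunk.
  by move=> z; rewrite inE.
have -> : #|T| = \sum_(x : T) 1 by rewrite sum1_card.
apply: leq_trans (leq_mul (leqnn _) (leq_add cX (leqnn _))).
have -> : #|X| = \sum_x \sum_(j < m) ((x, j) \in X).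
  rewrite pair_big /= -sum1_card big_mkcond /=; apply: eq_bigr => -[x j] _ /=.
  by case: (_ \in X).
rewrite -big_split big_distrr /=; apply: leq_sum => x _.
set o := ones e x 0 m; have om : o %/ Q.+1 <= m.
  by apply: leq_trans (leq_div _ _) _; have := ones_le e x 0 m; rewrite add0n.
have -> : \sum_(j < m) ((x, j) \in X) = o %/ Q.+1.
  rewrite -[RHS]card_ord -sum1_card (big_ord_widen _ (fun=> 1) om) /= [RHS]big_mkcond /=.
  apply: eq_bigr => j _; rewrite inE ones_chunk -/o leq_divRL // mulSn.
  by case: (leqP (Q.+1 + j * Q.+1) o) => h; case: leqP => h' //=; lia.
by rewrite addn1 mulnC ltnW // -ltn_divLR.
Qed.
End Split.

(** * From formations to permutation matrices *)

Lemma formation_chain (T : finType) (e : T -> nat -> bool) s (Y : {set T}) a b (c : nat -> T) :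
  formation e s Y a b -> (forall i, i < s -> c i \in Y) ->
  exists h : nat -> nat, [/\ forall i, i < s -> a <= h i < b, forall i, i < s -> e (c i) (h i)
    & forall i j, i < j -> j < s -> h i < h j].
Proof.
elim: s a c => [|s IH] a c /=; first by exists id.
case=> d [ad db hd fd] cY.
case/hitsP: (hd _ (cY 0 isT)) => i0 hi0 ei0.
have [|h [hb he hlt]] := IH d (fun i => c i.+1) fd; first by move=> i; apply: cY i.+1.
exists (fun i => if i is i'.+1 then h i' else i0); split.
- by case=> [|i] hi; [lia|have := hb i hi; lia].
- by case=> [|i] hi //; apply: he.
- case=> [|i] [|j] // hij hj; last exact: hlt.
  by have := hb j hj; lia.
Qed.

(** The i-th row of a permutation matrix names one of the k + 1 chosen columns; a row of the i-th
    interval in which this column has a one realizes it. The existential extends B by zeros to all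
    natural row numbers. *)
Lemma formation_free_columns m n k (B : 'M[bool]_(m, n)) :
  ~~ columns_contain_all k.+1 B ->
  formation_free k.+1 k.+1 (fun (x : 'I_n) i => [exists y : 'I_m, (val y == i) && B y x]) setT 0 m.
Proof.
move=> nB Y _ fY; rewrite ltnNge; apply/negP => leY; case/negP: nB.
have [y0 y0Y] : exists y, y \in Y by apply/set0Pn; rewrite -card_gt0; apply: leq_trans leY.
have sen : k.+1 <= size (enum Y) by rewrite -cardE.
have sorted_en : sorted (relpre val ltn) (enum Y).
  rewrite {1}/enum_mem -enumT; apply: sorted_filter; first by move=> a b c; apply: ltn_trans.
  by rewrite -sorted_map val_enum_ord iota_ltn_sorted.
pose g := [ffun i : 'I_k.+1 => nth y0 (enum Y) i].
apply/existsP; exists g; apply/andP; split.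
  apply/forallP => i; apply/forallP => j; apply/implyP => ij; rewrite !ffunE.
  apply: (sorted_ltn_nth _ _ sorted_en) => //; first by move=> a b c; apply: ltn_trans.
  - by rewrite inE; apply: leq_trans sen.
  - by rewrite inE; apply: leq_trans sen.
apply/forallP => S; apply/implyP => /andP[/forallP hrow /forallP hcol].
have [c hc] : exists c : 'I_k.+1 -> 'I_k.+1, forall i j, S i j -> j = c i.
  exists (fun i => odflt ord0 [pick j | S i j]) => i j Sij.
  case: pickP => [j' Sij'|/(_ j)]; last by rewrite Sij.
  have /cards1P[j0 E] := hrow i.
  have : j \in [set j | S i j] by rewrite inE.
  have : j' \in [set j | S i j] by rewrite inE.
  by rewrite E !inE => /eqP -> /eqP ->.
have [|h [hb he hlt]] := formation_chain (c := fun i => g (c (inord i))) fY.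
  by move=> i _; rewrite ffunE -mem_enum mem_nth //; apply: leq_trans sen.
have hm (i : 'I_k.+1) : h i < m by have := hb i (ltn_ord i); lia.
pose f := [ffun i : 'I_k.+1 => Ordinal (hm i)].
apply/existsP; exists f; apply/existsP; exists [ffun i => i].
apply/and3P; split.
- by apply/forallP => i; apply/forallP => j; apply/implyP => ij; rewrite !ffunE /=; apply: hlt.
- by apply/forallP => i; apply/forallP => j; apply/implyP => ij; rewrite !ffunE.
apply/forallP => i; apply/forallP => j; apply/implyP => Sij; rewrite !mxE !ffunE.
have /existsP[y /andP[/eqP vy Byx]] := he i (ltn_ord i).
rewrite (hc _ _ Sij); move: Byx; rewrite inord_val /g ffunE.
by have -> : y = Ordinal (hm i) by apply/val_inj.
Qed.

Lemma p_leq_columns_bounded k n F :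
  columns_bounded k.+2 k.+2 (quota k.+2 (alpha n)) n F ->
  p k.+1 n <= (quota k.+2 (alpha n)).+1 * (F + n).
Proof.
move=> bd; apply/bigmax_leqP => B nB.
have fr := formation_free_columns nB.
have := ones_sum_bound fr bd; rewrite card_ord; apply: leq_trans.
rewrite /weight -sum1_card (eq_bigl (fun ij => B ij.1 ij.2)); last by move=> ij; rewrite inE.
rewrite -(pair_big_dep predT (fun i j => B i j) (fun _ _ => 1)) /= (exchange_big_dep predT) //=.
apply: leq_sum => x _; rewrite /ones -sum1_count /= big_mkcond [leqRHS]big_mkcond.
rewrite big_mkord; apply: leq_sum => i _.
case Bix: (B i x) => //.
by have -> : [exists y : 'I_n, (val y == i) && B y x] by apply/existsP; exists i; rewrite eqxx.
Qed.

(** Since n <= [ack (alpha n) 3], the column bound applies with argument 3, and 3^s is a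
    constant. *)
Lemma p_upper k : exists C, forall n, 1 < alpha n -> p k.+1 n <= C * (n * (quota k.+2 (alpha n)).+1).
Proof.
pose E := k.+2; pose C := k.+2 * 2 ^ (2 ^ E) * 2 ^ E * 3 ^ E * 3 ^ E.
exists C.+1 => n a1.
have bd : columns_bounded k.+2 k.+2 (quota k.+2 (alpha n)) n (C * n).
  apply: columns_bounded_ack; rewrite ?leqnn //; first lia.
  apply: leq_trans (leq_ack_alpha n) _.
  apply: leq_trans (leq_ack_index _ (leq_pred _)) _.
  by rewrite -[X in X <= _]expn1 leq_pexp2l // ack_gt0.
apply: leq_trans (p_leq_columns_bounded bd) _.
by rewrite -mulSnr mulnA mulnC [C.+1 * _]mulnC; lia.
Qed.

(** * Alternations *)

(* w belongs to the language p_0^* p_1^* ... *)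
Inductive fits : seq bool -> seq bool -> Prop :=
| fits_nil : fits [::] [::]
| fits_take x p w : fits (x :: p) w -> fits (x :: p) (x :: w)
| fits_skip x p w : fits p w -> fits (x :: p) w.

(** A word fitting [alternation x n] has at most n maximal runs, and at most n - 1 if it starts with
    the other letter. Orders of sequences are measured this way. *)
Fixpoint alternation x n : seq bool :=
  if n is n'.+1 then x :: alternation (~~ x) n' else [::].

Lemma fits_nilr p : fits p [::].
Proof. by elim: p => [|x p IH]; constructor. Qed.

Lemma fits_cat p q u v : fits p u -> fits q v -> fits (p ++ q) (u ++ v).
Proof. by move=> fp fq; elim: fp => //= *; constructor. Qed.

Lemma fits_catr p q w : fits p w -> fits (p ++ q) w.
Proof. by move=> /fits_cat/(_ (fits_nilr q)); rewrite cats0. Qed.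

Lemma fits_behead p x w : fits p (x :: w) -> fits p w.
Proof.
move: {1 3}(x :: w) (erefl (x :: w)) => w' E f.
elim: f x w E => [//|y q u fu IH x w [_ <-] //|y q u fu IH x w E].
exact/fits_skip/(IH _ _ E).
Qed.

Lemma fits_suffix p u v : fits p (u ++ v) -> fits p v.
Proof. by elim: u => //= x u IH /fits_behead. Qed.

(** Two equal starred letters in a row describe one run; this saves runs at the seams of
    concatenated words. *)
Lemma fits_squash p q x w : fits (p ++ [:: x, x & q]) w -> fits (p ++ x :: q) w.
Proof.
move: {1 3}(p ++ _) (erefl (p ++ [:: x, x & q])) => p' E f.
elim: f p E => [|y q' w' fw IH|y q' w' fw IH] [|z p] //= E.
- by case: E => Ey E; subst; constructor; apply: (IH [::]).
- by case: E => Ey E; subst; constructor; apply: (IH (z :: p)).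
- by case: E => Ey E; subst.
- by case: E => Ey E; subst; apply: fits_skip; apply: IH.
Qed.

Lemma fits_skip_neg x p w : fits (x :: p) (~~ x :: w) -> fits p (~~ x :: w).
Proof. by case: x => f; inversion f. Qed.

(** Once the other letter has occurred, the first starred letter is used up. *)
Lemma fits_cons_neg x p u v : ~~ x \in u -> fits (x :: p) (u ++ v) -> fits p v.
Proof.
elim: u => //= y u IH xu f.
case: (eqVneq y x) => [E|ne].
  rewrite E in xu; apply: IH (fits_behead f).
  by move: xu; rewrite inE; case: (x).
have E : y = ~~ x by case: (x) (y) ne => -[].
by rewrite E in f; apply: fits_suffix (fits_behead (fits_skip_neg f)).
Qed.

Lemma fits_1 x w : fits [:: x] w -> ~~ x \notin w.
Proof.
elim: w => //= y w IH f; rewrite inE negb_or (IH (fits_behead f)) andbT.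
by case: x y f {IH} => -[] // f; inversion f as [|z q v fv|z q v fv]; inversion fv.
Qed.

Lemma fits_nseq x n : fits [:: x] (nseq n x).
Proof. by elim: n => [|n IH]; [exact: fits_nilr|constructor]. Qed.

Lemma fits_stutter p y n w w' : (forall q, fits q w -> fits q w') ->
  fits p (y :: w) -> fits p (nseq n y ++ w').
Proof.
move=> h; move: {1 3}(y :: w) (erefl (y :: w)) => u E f.
elim: f E => [//|x q v fv IH E|x q v fv IH E]; last by apply: fits_skip; apply: IH.
by case: E fv => -> -> fv; elim: (n) => [|n' IHn] /=; [exact: h fv|constructor].
Qed.

Lemma fits_map_neg p w : fits p w -> fits (map negb p) (map negb w).
Proof. by elim=> *; constructor. Qed.

Lemma alternation_neg x n : map negb (alternation x n) = alternation (~~ x) n.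
Proof. by elim: n x => //= n IH x; rewrite IH. Qed.

Lemma alternation_cat x m n : alternation x (m + n) = alternation x m ++ alternation (x (+) odd m) n.
Proof.
elim: m x => [|m IH] x /=; first by rewrite addbF.
by rewrite IH /=; congr (_ :: _ ++ alternation _ _); case: x; case: odd.
Qed.

Lemma fits_alternation_leq x m n w : m <= n -> fits (alternation x m) w -> fits (alternation x n) w.
Proof. by move=> /subnKC <-; rewrite alternation_cat; apply: fits_catr. Qed.

Section Words.
Variable T : eqType.
Implicit Types (a b : T) (l : seq T).

Definition word a b l := pmap (fun x => if x == a then Some true else if x == b then Some false else None) l.

Lemma word_cat a b l1 l2 : word a b (l1 ++ l2) = word a b l1 ++ word a b l2.
Proof. exact: pmap_cat. Qed.

Lemma word_swap a b l : a != b -> word b a l = map negb (word a b l).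
Proof.
move=> ab; elim: l => //= x l; rewrite /word /= => ->.
case: (eqVneq x a) => [->|_] /=; first by rewrite (negbTE ab).
by case: eqVneq.
Qed.

Lemma mem_word_true a b l : (true \in word a b l) = (a \in l).
Proof.
elim: l => //= x l; rewrite /word /= !inE => <-.
by rewrite eq_sym; case: eqVneq => //= _; case: eqVneq.
Qed.

Lemma mem_word_false a b l : a != b -> (false \in word a b l) = (b \in l).
Proof.
move=> ab; elim: l => //= x l; rewrite /word /= !inE => <-.
case: (eqVneq x a) => [->|_] /=; first by rewrite eq_sym (negbTE ab).
by rewrite (eq_sym b); case: eqVneq.
Qed.

Lemma wordNr a b l : b \notin l -> word a b l = nseq (count_mem a l) true.
Proof.
elim: l => //= x l IH; rewrite inE negb_or eq_sym /word /= => /andP[/negbTE -> /IH].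
by rewrite /word => ->; case: eqVneq.
Qed.

Lemma wordNl a b l : a \notin l -> word a b l = nseq (count_mem b l) false.
Proof.
elim: l => //= x l IH; rewrite inE negb_or eq_sym /word /= => /andP[/negbTE -> /IH].
by rewrite /word => ->; case: eqVneq.
Qed.

Lemma fits_wordNr a b l : b \notin l -> fits [:: true] (word a b l).
Proof. by move/wordNr ->; apply: fits_nseq. Qed.
Lemma fits_wordNl a b l : a \notin l -> fits [:: false] (word a b l).
Proof. by move/wordNl ->; apply: fits_nseq. Qed.

Lemma count_word a b l : a != b -> count_mem true (word a b l) = count_mem a l.
Proof.
move=> ab; elim: l => //= x l; rewrite /word /= => <-.
by case: (eqVneq x a) => //= _; case: eqVneq.
Qed.

Lemma fits_single_true w : count_mem true w <= 1 -> fits [:: false; true; false] w.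
Proof.
elim: w => [|[] w IH] /=; first by move=> _; apply: fits_nilr.
  move=> c; apply/fits_skip/fits_take/fits_skip.
  elim: w c {IH} => [|[] w IH] //= c; first exact: fits_nilr.
  by apply/fits_take/IH.
by move=> c; apply/fits_take/IH.
Qed.

(* Z lists the sets of columns having a one in the successive rows. *)
Fixpoint chain (s : seq T) (Z : seq (seq T)) : bool :=
  if Z is r :: Z' then
    if s is x :: s' then (x \in r) && chain s' Z' || chain s Z' else true
  else nilp s.

Lemma chain_behead s r Z : chain s Z -> chain s (r :: Z).
Proof. by case: s => //= x s ->; rewrite orbT. Qed.

Lemma chain_behead2 x s Z : chain (x :: s) Z -> chain s Z.
Proof.
elim: Z x s => //= r Z IH x s /orP[/andP[_ c]|/IH c]; exact: chain_behead.
Qed.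

(** Greedy choice: the first row containing x leaves the most rows for the rest. *)
Lemma chain_cons x s Z : chain (x :: s) Z ->
  (find (fun r : seq T => x \in r) Z < size Z) && chain s (drop (find (fun r : seq T => x \in r) Z).+1 Z).
Proof.
elim: Z => //= r Z IH /orP[/andP[xr c]|c]; first by rewrite xr /= drop0.
have /andP[lt c'] := IH c; case: ifP => xr; last by rewrite ltnS lt c'.
by rewrite /= drop0 (chain_behead2 c).
Qed.

Lemma chain2 a b Z : chain [:: a; b] Z ->
  exists Z1 Z2, [/\ Z = Z1 ++ Z2, a \in flatten Z1 & b \in flatten Z2].
Proof.
move/chain_cons => /andP[lt /chain_cons/andP[lt2 _]]; set f := find _ _ in lt lt2 *.
exists (take f.+1 Z), (drop f.+1 Z); rewrite cat_take_drop; split=> //.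
  apply/flattenP; exists (nth [::] Z f); last by apply: (@nth_find _ [::] (fun r : seq T => a \in r)); rewrite has_find.
  by rewrite -(nth_take [::] (ltnSn f)) mem_nth // size_takel.
move: lt2; rewrite -has_find => /hasP[r rin br]; by apply/flattenP; exists r.
Qed.

(** The orders beginning with the latest column y show that all orders of the other columns occur
    below its first one. Up to that row every column has appeared, so any surviving pair has used up
    one run. For the last two columns, the orders ab and ba exclude a word of two runs. *)
Lemma unavoidable_alternation (c : seq T) Z : uniq c -> 1 < size c ->
  (forall s, perm_eq s c -> chain s Z) ->
  exists a b, [/\ a \in c, b \in c, a != b
    & forall x, ~ fits (alternation x (size c)) (word a b (flatten Z))].
Proof.
move En: (size c) => n; elim: n c Z En => // n IH c Z En uc n1 h.
have [n2|] := ltnP 1 n; last first.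
  case: n {IH} En n1 => [|[|n]] // En _ _.
  case: c En uc h => [|a [|b [|]]] //= _; rewrite inE andbT => ab h.
  exists a, b; rewrite !inE !eqxx orbT; split=> // x.
  have [Z1 [Z2 [E aZ1 bZ2]]] := chain2 (h [:: a; b] (perm_refl _)).
  have [|Z3 [Z4 [E' bZ3 aZ4]]] := @chain2 b a Z; first by apply: h; apply: (permEl (perm_catC [:: b] [:: a])).
  case: x => /= f.
    rewrite E' flatten_cat word_cat in f.
    have /fits_1 : fits [:: false] (word a b (flatten Z4)).
      by apply: fits_cons_neg f; rewrite mem_word_false.
    by rewrite mem_word_true aZ4.
  rewrite E flatten_cat word_cat in f.
  have /fits_1 : fits [:: true] (word a b (flatten Z2)).
    by apply: fits_cons_neg f; rewrite mem_word_true.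
  by rewrite mem_word_false // bZ2.
pose F x := find (fun r : seq T => x \in r) Z.
have perm_front x : x \in c -> perm_eq (x :: rem x c) c by rewrite perm_sym => /perm_to_rem.
have lF x : x \in c -> F x < size Z.
  by move=> xc; have /andP[] := chain_cons (h _ (perm_front x xc)).
have [y yc ymax] : exists2 y, y \in c & forall x, x \in c -> F x <= F y.
  have c0 : c != [::] by case: c En n1 {uc h perm_front lF} => //= <-.
  elim: c c0 {En uc h perm_front lF n1} => //= z c IHc _.
  have [->|/IHc[y yc ym]] := eqVneq c [::].
    by exists z; rewrite ?inE // => x; rewrite inE => /eqP ->.
  have [le|/ltnW le] := leqP (F z) (F y).
    by exists y; rewrite ?inE ?yc ?orbT // => x; rewrite inE => /orP[/eqP ->|/ym].
  exists z; rewrite ?inE ?eqxx // => x; rewrite inE => /orP[/eqP ->|/ym] //.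
  by move/leq_trans; apply.
have [||||a [b [ac bc ab nf]]] := IH (rem y c) (drop (F y).+1 Z).
- by rewrite size_rem // En.
- exact: rem_uniq.
- by [].
- move=> s ps; have /andP[] // : (F y < size Z) && chain s (drop (F y).+1 Z).
  apply/chain_cons/h; apply: perm_trans (perm_front y yc); by rewrite perm_cons.
have {}ac := mem_rem ac; have {}bc := mem_rem bc.
exists a, b; split=> // x f; apply: (nf (~~ x)).
rewrite -(cat_take_drop (F y).+1 Z) flatten_cat word_cat in f.
apply: fits_cons_neg f.
have inT z : z \in c -> z \in flatten (take (F y).+1 Z).
  move=> zc; have lz := lF z zc; apply/flattenP; exists (nth [::] Z (F z)); last first.
    by apply: (@nth_find _ [::] (fun r : seq T => z \in r)); rewrite has_find.
  rewrite -(@nth_take (F y).+1 _ [::]) ?ltnS ?ymax // mem_nth // size_takel ?lF //.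
  exact: ymax.
by case: x; rewrite ?mem_word_true ?mem_word_false // inT.
Qed.
End Words.

(** * From sequences of rows to matrices *)

Lemma chain_of_rows (T : eqType) (x0 : T) s Z (h : nat -> nat) :
  (forall i, i < size s -> nth x0 s i \in nth [::] Z (h i)) ->
  (forall i j, i < j -> j < size s -> h i < h j) -> chain s Z.
Proof.
elim: Z s h => [|r Z IH] s h hin hlt.
  by case: s hin {hlt} => // x s /(_ 0 isT); rewrite nth_nil.
case: s hin hlt => // x s hin hlt; rewrite [chain _ _]/=.
case E: (h 0) => [|m].
  have := hin 0 isT; rewrite E /= => ->; apply/orP; left.
  apply: (IH _ (fun i => (h i.+1).-1)) => [i hi|i j ij hj].
    by have := hin i.+1 hi; have := hlt 0 i.+1 isT hi; case: (h i.+1).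
  by have := hlt i.+1 j.+1 ij hj; have := hlt 0 i.+1 isT (ltn_trans ij hj); lia.
apply/orP; right; apply: (IH _ (fun i => (h i).-1)) => [i hi|i j ij hj].
  have := hin i hi; have : 0 < h i; last by case: (h i).
  by case: i hi => [|i] hi; [rewrite E|have := hlt 0 i.+1 isT hi; lia].
have := hlt i j ij hj; have : 0 < h i; last by lia.
have hi : i < size (x :: s) by apply: ltn_trans hj.
by case: i ij hi => [|i] ij hi; [rewrite E|have := hlt 0 i.+1 isT hi; lia].
Qed.

(** A pattern with as many columns as the tuple must use each of them in its place. *)
Lemma increasing_id k (f : {ffun 'I_k -> 'I_k}) : increasing f -> f =1 id.
Proof.
move=> /forallP inc i.
have lt (a b : 'I_k) : a < b -> f a < f b by apply/implyP/(forallP (inc a) b).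
have key d (a b : 'I_k) : a + d = b -> f a + d <= f b.
  elim: d b => [|d IH] b; first by rewrite addn0 => /val_inj ->; rewrite addn0.
  move=> E; have hc : a + d < k by rewrite (leq_ltn_trans _ (ltn_ord b)) // -E leq_add2l.
  have := IH (Ordinal hc) erefl; have := lt (Ordinal hc) b; rewrite /= -E; lia.
have k0 : 0 < k by apply: leq_ltn_trans (ltn_ord i).
have k1 : k.-1 < k by rewrite ltn_predL.
have := key i (Ordinal k0) i erefl.
have : i + (k.-1 - i) = Ordinal k1 by rewrite /= subnKC //; have := ltn_ord i; lia.
move/key; have := ltn_ord (f (Ordinal k1)); have := ltn_ord i => ? ? ? ?.
apply/val_inj => /=; lia.
Qed.

Lemma permutation_matrix1 k : permutation_matrix (\matrix_(i < k, j < k) (i == j))%R.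
Proof.
apply/andP; split; apply/forallP => i; apply/cards1P; exists i;
  by apply/setP => j; rewrite !inE mxE // eq_sym.
Qed.

(** If k + 1 columns contained all permutation matrices, every listing of the rows would give some
    pair more than k + 1 runs. So it is enough that one order of the entries inside the rows keeps
    all pairs short. *)
Lemma leq_p_of_words (T : eqType) (syms : seq T) (Z : seq (seq T)) k n :
  0 < k -> uniq syms -> size syms <= n -> size Z <= n ->
  all uniq Z -> {subset flatten Z <= syms} ->
  (forall a b, a != b -> exists x, fits (alternation x k.+1) (word a b (flatten Z))) ->
  size (flatten Z) <= p k n.
Proof.
move=> k0 us sn Zn uZ sub hw.
have [->|Z0] := eqVneq (flatten Z) [::]; first by [].
have {Z0} [x0 x0Z] : exists x, x \in flatten Z by case: (flatten Z) Z0 => // x ? _; exists x; rewrite mem_head.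
pose B : 'M[bool]_n := (\matrix_(i < n, j < n) ((j < size syms)%N && (nth x0 syms j \in nth [::] Z i)))%R.
have wB : weight B = size (flatten Z).
  rewrite /weight -sum1_card (eq_bigl (fun ij => B ij.1 ij.2)); last by move=> ij; rewrite inE.
  rewrite -(pair_big_dep predT (fun i j => B i j) (fun _ _ => 1)) /=.
  rewrite size_flatten sumnE /shape big_map (big_nth [::]) big_mkord.
  rewrite (big_ord_widen _ (fun i => size (nth [::] Z i)) Zn) [RHS]big_mkcond /=.
  apply: eq_bigr => i _; case: ltnP => iZ; last first.
    by rewrite big1 // => j; rewrite mxE (nth_default [::] iZ) in_nil andbF.
  set r := nth _ _ _; have rZ : r \in Z by apply: mem_nth.
  have ur : uniq r by apply: (allP uZ).
  transitivity (\sum_(j < n | j < size syms) (nth x0 syms j \in r)).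
    rewrite [RHS]big_mkcond [LHS]big_mkcond /=; apply: eq_bigr => j _.
    by rewrite mxE; case: (_ < _) => //=; case: (_ \in _).
  rewrite -(big_ord_widen _ (fun j => nat_of_bool (nth x0 syms j \in r)) sn).
  rewrite -(big_mkord predT (fun j => nat_of_bool (nth x0 syms j \in r))).
  rewrite -(big_nth x0 predT (fun x => nat_of_bool (x \in r))).
  have -> : \sum_(x <- syms) nat_of_bool (x \in r) = size [seq x <- syms | x \in r].
    by rewrite size_filter -sum1_count [RHS]big_mkcond /=; apply: eq_bigr => x _; case: (x \in r).
  apply/perm_size/uniq_perm; rewrite ?filter_uniq // => x.
  rewrite mem_filter; case xr: (x \in r) => //=.
  by apply: sub; apply/flattenP; exists r.
rewrite -wB; apply: leq_bigmax_cond; apply/negP => /existsP[g /andP[/forallP incg /forallP hS]].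
pose c := [seq nth x0 syms (g i) | i <- enum 'I_k.+1].
have sc : size c = k.+1 by rewrite size_map size_enum_ord.
have nc (i : 'I_k.+1) : nth x0 c i = nth x0 syms (g i).
  by rewrite (nth_map ord0) ?size_enum_ord // nth_ord_enum.
have chainS s : perm_eq s c -> uniq c -> chain s Z.
  move=> ps uc; have us' : uniq s by rewrite (perm_uniq ps).
  have ss : size s = k.+1 by rewrite (perm_size ps).
  pose S : 'M[bool]_k.+1 := (\matrix_(i, j) (nth x0 s i == nth x0 c j))%R.
  have ic (i : nat) : i < k.+1 -> index (nth x0 s i) c < k.+1.
    by move=> ik; rewrite -sc index_mem -(perm_mem ps) mem_nth // ss.
  have is' (i : nat) : i < k.+1 -> index (nth x0 c i) s < k.+1.
    by move=> ik; rewrite -ss index_mem (perm_mem ps) mem_nth // sc.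
  have pS : permutation_matrix S.
    apply/andP; split; apply/forallP => i; apply/cards1P.
      have lt := ic _ (ltn_ord i).
      exists (Ordinal lt); apply/setP => j; rewrite !inE mxE -val_eqE /=.
      apply/eqP/eqP => [->|->]; first by rewrite index_uniq // sc.
      by rewrite nth_index // -(perm_mem ps) mem_nth // ss.
    have lt := is' _ (ltn_ord i).
    exists (Ordinal lt); apply/setP => j; rewrite !inE mxE -val_eqE /=.
    apply/eqP/eqP => [<-|->]; first by rewrite index_uniq // ss.
    by rewrite nth_index // (perm_mem ps) mem_nth // sc.
  have /existsP[f /existsP[g' /and3P[/forallP incf /increasing_id g'id /forallP hB]]] := implyP (hS S) pS.
  pose h i := if i < k.+1 then val (f (inord i)) else 0.
  apply: (@chain_of_rows _ x0 s Z h) => [i|i j ij]; rewrite ss => hi.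
    rewrite /h hi; pose i' : 'I_k.+1 := inord i.
    have E : i = i' by rewrite inordK.
    have lt := ic _ hi.
    have := implyP (forallP (hB i') (Ordinal lt)).
    rewrite !mxE g'id -E /= nth_index; last by rewrite -(perm_mem ps) mem_nth // ss.
    move=> /(_ (eqxx _)) /andP[_].
    rewrite -nc /= nth_index //; by rewrite -(perm_mem ps) mem_nth // ss.
  have hi' : i < k.+1 by lia.
  rewrite /h hi hi'; have := implyP (forallP (incf (inord i)) (inord j)).
  by rewrite !inordK //; apply.
(* Columns without a symbol are zero, and the identity pattern asks for a one in every chosen
   column. *)
have gsz (i : 'I_k.+1) : g i < size syms.
  have /existsP[f /existsP[g' /and3P[_ /increasing_id g'id /forallP hB]]] :=
    implyP (hS (\matrix_(i, j) (i == j))%R) (permutation_matrix1 _).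
  have := implyP (forallP (hB i) i); rewrite !mxE g'id eqxx => /(_ isT).
  by case/andP.
have uc : uniq c.
  rewrite map_inj_in_uniq ?enum_uniq // => i j _ _ /eqP.
  rewrite nth_uniq // => /eqP /val_inj E; apply/eqP.
  have lt (a b : 'I_k.+1) : a < b -> g a < g b by apply/implyP/(forallP (incg a) b).
  by have := lt i j; have := lt j i; rewrite E -val_eqE /=; lia.
have [|a [b [_ _ ab nf]]] := unavoidable_alternation uc _ (fun s ps => chainS s ps uc); first by rewrite sc.
by have [x] := hw a b ab; rewrite sc in nf; apply: nf.
Qed.

(** * Grafting block sequences *)

(* The first component marks special rows; entries are tagged symbols. *)
Definition line (T : Type) := (bool * seq (T * bool))%type.

Definition symbols (T : Type) (r : line T) : seq T := unzip1 r.2.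
Definition flat (T : Type) (Z : seq (line T)) : seq T := flatten (map (@symbols T) Z).
Definition special (T : Type) (Z : seq (line T)) := filter fst Z.

Definition relabel (T U : Type) (f : T -> U) (r : line T) : line U :=
  (r.1, [seq (f x.1, x.2) | x <- r.2]).

(** The side is chosen for the sake of pairs meeting in the row: with tag [false] the outer entry
    follows the entries of the copy, with tag [true] it precedes them, as [nested] and [meets] will
    require. *)
Definition put (T : Type) (e : T * bool) (l : seq (T * bool)) :=
  if e.2 then e :: l else rcons l e.

Fixpoint insert (T : Type) (es : seq (T * bool)) (Z : seq (line T)) : seq (line T) :=
  if Z is r :: Z' then
    if r.1 then
      if es is e :: es' then (true, put e r.2) :: insert es' Z' else r :: insert es Z'
    else r :: insert es Z'
  else [::].

Section Basic.
Variable T : Type.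
Implicit Types Z : seq (line T).

Lemma flat_cat Z1 Z2 : flat (Z1 ++ Z2) = flat Z1 ++ flat Z2.
Proof. by rewrite /flat map_cat flatten_cat. Qed.

Lemma flat_cons (r : line T) Z : flat (r :: Z) = symbols r ++ flat Z. Proof. by []. Qed.

Lemma special_cat Z1 Z2 : special (Z1 ++ Z2) = special Z1 ++ special Z2.
Proof. exact: filter_cat. Qed.

Lemma insert_split es Z Y1 l Y2 : size es = size (special Z) ->
  insert es Z = Y1 ++ (true, l) :: Y2 ->
  exists es1 e es2 Z1 l' Z2, [/\ es = es1 ++ e :: es2, Z = Z1 ++ (true, l') :: Z2,
    size es1 = size (special Z1), l = put e l' & Y1 = insert es1 Z1 /\ Y2 = insert es2 Z2].
Proof.
elim: Z es Y1 => [|[[] l0] Z IH] es Y1 /=; first by case: Y1.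
  case: es => //= e es [sz]; case: Y1 => [[<- <-]|y Y1 [<- E]].
    by exists [::], e, es, [::], l0, Z.
  have [es1 [e' [es2 [Z1 [l' [Z2 [E1 E2 s1 Ep [E3 E4]]]]]]]] := IH _ _ sz E.
  exists (e :: es1), e', es2, ((true, l0) :: Z1), l', Z2.
  by rewrite /= s1 E1 E2 E3 E4.
move=> sz; case: Y1 => [//|y Y1 [<- E]].
have [es1 [e' [es2 [Z1 [l' [Z2 [E1 E2 s1 Ep [E3 E4]]]]]]]] := IH _ _ sz E.
exists es1, e', es2, ((false, l0) :: Z1), l', Z2.
by rewrite /= s1 E1 E2 E3 E4.
Qed.

Lemma size_insert es Z : size (insert es Z) = size Z.
Proof. by elim: Z es => [|[[] l] Z IH] [|e es] //=; rewrite IH. Qed.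

Lemma size_special_insert es Z : size (special (insert es Z)) = size (special Z).
Proof. by elim: Z es => [|[[] l] Z IH] [|e es] //=; rewrite IH. Qed.
End Basic.

Section Merge.
Variables U V : eqType.
Notation W := (U + nat * V)%type.

Definition lift_line (r : line U) : line W := relabel inl r.
Definition tag_copy (i : nat) (r : line V) : line W := relabel (fun x => inr (i, x)) r.

Definition block (l : seq (U * bool)) i (I : seq (line V)) : seq (line W) :=
  insert [seq (inl x.1, x.2) | x <- l] (map (tag_copy i) I).

(* The i-th special row of O is replaced by a fresh copy of I, in whose j-th
   special row the j-th entry of the replaced row is inserted. *)
Fixpoint graft n (O : seq (line U)) (I : seq (line V)) : seq (line W) :=
  if O is r :: O' then
    if r.1 then block r.2 n I ++ graft n.+1 O' I else lift_line r :: graft n O' I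
  else [::].

Definition outer_part (l : seq W) := pmap (fun x => if x is inl u then Some u else None) l.
Definition copy_part i (l : seq W) :=
  pmap (fun x => if x is inr (j, v) then if j == i then Some v else None else None) l.

Lemma outer_part_cat l1 l2 : outer_part (l1 ++ l2) = outer_part l1 ++ outer_part l2.
Proof. exact: pmap_cat. Qed.
Lemma copy_part_cat i l1 l2 : copy_part i (l1 ++ l2) = copy_part i l1 ++ copy_part i l2.
Proof. exact: pmap_cat. Qed.

Lemma word_outer a b l : word (inl a : W) (inl b) l = word a b (outer_part l).
Proof.
elim: l => //= -[x|y] l; rewrite /word /= => -> //.
Qed.

Lemma word_copy i a b l : word (inr (i, a) : W) (inr (i, b)) l = word a b (copy_part i l).
Proof.
elim: l => //= -[x|[j y]] l; rewrite /word /= => -> //.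
have E (z : V) : (inr (j, y) == inr (i, z) :> W) = (j == i) && (y == z) by [].
by rewrite !E; case: (j == i).
Qed.

Lemma mem_outer a l : (inl a \in l) = (a \in outer_part l).
Proof. by elim: l => //= -[x|y] l; rewrite !inE => -> //=. Qed.

Lemma mem_copy i a l : (inr (i, a) \in l) = (a \in copy_part i l).
Proof.
elim: l => //= -[x|[j y]] l; rewrite !inE => -> //=.
have -> : (inr (i, a) == inr (j, y) :> W) = (i == j) && (a == y) by [].
by rewrite (eq_sym i); case: (j == i).
Qed.

Lemma count_outer a l : count_mem (inl a) l = count_mem a (outer_part l).
Proof. by elim: l => //= -[x|y] l -> //=. Qed.

Lemma count_copy i a l : count_mem (inr (i, a)) l = count_mem a (copy_part i l).
Proof.
elim: l => //= -[x|[j y]] l -> //=.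
have -> : (inr (j, y) == inr (i, a) :> W) = (j == i) && (y == a) by [].
by case: (j == i).
Qed.

Lemma outer_part_put (e : U * bool) i (r : line V) :
  outer_part (unzip1 (put (inl e.1, e.2) (tag_copy i r).2)) = [:: e.1].
Proof.
have E (l : seq (V * bool)) : outer_part (unzip1 [seq (inr (i, x.1), x.2) | x <- l]) = [::] by elim: l.
by rewrite /put /=; case: e.2; rewrite /= -?cats1 /unzip1 ?map_cat ?outer_part_cat [outer_part _]E.
Qed.

Lemma copy_part_tag i j (r : line V) :
  copy_part i (symbols (tag_copy j r)) = if j == i then symbols r else [::].
Proof.
case: r => s l; rewrite /symbols /=.
elim: l => [|x l IH] //=; first by case: eqP.
by rewrite IH; case: eqP.
Qed.

Lemma copy_part_put (e : U * bool) i j (r : line V) :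
  copy_part i (unzip1 (put (inl e.1, e.2) (tag_copy j r).2)) = if j == i then symbols r else [::].
Proof.
rewrite -copy_part_tag /put /=; case: e.2 => //.
by rewrite /unzip1 -cats1 map_cat copy_part_cat cats0.
Qed.

Lemma outer_part_tag j (r : line V) : outer_part (symbols (tag_copy j r)) = [::].
Proof. by case: r => s l; rewrite /symbols /=; elim: l. Qed.

Lemma outer_part_lift (r : line U) : outer_part (symbols (lift_line r)) = symbols r.
Proof. by case: r => s l; rewrite /symbols /=; elim: l => //= x l ->. Qed.

Lemma copy_part_lift i (r : line U) : copy_part i (symbols (lift_line r)) = [::].
Proof. by case: r => s l; rewrite /symbols /=; elim: l. Qed.

Lemma special_tag i I : special (map (tag_copy i) I) = map (tag_copy i) (special I).
Proof. by rewrite /special filter_map. Qed.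

Lemma outer_part_block l i I : size l = size (special I) ->
  outer_part (flat (block l i I)) = unzip1 l.
Proof.
rewrite /block; elim: I l => [|[[] r] I IH] l /=; first by case: l.
  by case: l => //= e l [/IH E]; rewrite flat_cons outer_part_cat E [symbols _]/= (outer_part_put _ _ (true, r)).
move=> /IH E; case: l E => [|e l] E; rewrite [insert _ _]/= flat_cons outer_part_cat E;
  by rewrite (outer_part_tag _ (false, r)).
Qed.

Lemma copy_part_block l i j I :
  copy_part i (flat (block l j I)) = if j == i then flat I else [::].
Proof.
rewrite /block; elim: I l => [|[s r] I IH] l; first by case: eqP.
case: s => /=; last first.
  by rewrite flat_cons copy_part_cat (copy_part_tag _ _ (false, r)) IH; case: eqP.
case: l => [|e l] /=; rewrite flat_cons copy_part_cat.
  by rewrite (copy_part_tag _ _ (true, r)) (IH [::]); case: eqP.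
by rewrite [symbols _]/= (copy_part_put _ _ _ (true, r)) IH; case: eqP.
Qed.

(** [insert] drops entries for which no special row is left; with equal numbers nothing is lost and
    every special row receives one entry. *)
Definition fit_rows f (O : seq (line U)) := all (fun r => r.1 ==> (size r.2 == f)) O.

Lemma outer_part_graft n O I : fit_rows (size (special I)) O ->
  outer_part (flat (graft n O I)) = flat O.
Proof.
elim: O n => [|[[] r] O IH] n //=.
  case/andP=> sz fO; rewrite flat_cat flat_cons outer_part_cat IH //.
  by rewrite outer_part_block //; apply/eqP.
by move=> fO; rewrite !flat_cons outer_part_cat IH // outer_part_lift.
Qed.

Lemma copy_part_graft i n O I :
  copy_part i (flat (graft n O I)) = if n <= i < n + size (special O) then flat I else [::].
Proof.
elim: O n => [|[[] r] O IH] n /=; first by case: ifP => //; lia.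
  rewrite flat_cat copy_part_cat IH copy_part_block.
  case: eqP => [->|ne].
    by rewrite ltnn /= cats0; case: ifP => //; lia.
  by rewrite cat0s; congr (if _ then _ else _); lia.
by rewrite flat_cons copy_part_cat IH copy_part_lift.
Qed.

Lemma graft_cat n O1 O2 I :
  graft n (O1 ++ O2) I = graft n O1 I ++ graft (n + size (special O1)) O2 I.
Proof.
elim: O1 n => [|[[] r] O1 IH] n /=; first by rewrite addn0.
  by rewrite IH catA addSnnS.
by rewrite IH.
Qed.

Lemma graft_split n O I Z1 l Z2 : graft n O I = Z1 ++ (true, l) :: Z2 ->
  exists O1 lo O2 Y1 Y2, [/\ O = O1 ++ (true, lo) :: O2,
    block lo (n + size (special O1)) I = Y1 ++ (true, l) :: Y2,
    Z1 = graft n O1 I ++ Y1 & Z2 = Y2 ++ graft (n + size (special O1)).+1 O2 I].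
Proof.
elim: O n Z1 => [|[[] r] O IH] n Z1 /=; first by case: Z1.
  move=> E; have [lt|ge] := ltnP (size Z1) (size (block r n I)).
    exists [::], r, O, Z1, (behead (drop (size Z1) (block r n I))).
    have Ed : drop (size Z1) (block r n I) ++ graft n.+1 O I = (true, l) :: Z2.
      by have := congr1 (drop (size Z1)) E; rewrite drop_cat lt drop_size_cat.
    have Et : take (size Z1) (block r n I) = Z1.
      by have := congr1 (take (size Z1)) E; rewrite take_cat lt take_size_cat.
    move: Ed; case Eb: (drop (size Z1) (block r n I)) => [|x b] /=.
      by move: lt; rewrite -subn_gt0 -size_drop Eb.
    case=> Ex Eb'; rewrite addn0; split=> //.
    by rewrite -Ex -Eb -[X in X ++ _]Et cat_take_drop.
  have Et : Z1 = block r n I ++ drop (size (block r n I)) Z1.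
    have := congr1 (take (size (block r n I))) E; rewrite take_size_cat // take_cat.
    case: ltnP => [_ {1}->|ge']; first by rewrite cat_take_drop.
    have eqs : size (block r n I) = size Z1 by apply/eqP; rewrite eqn_leq ge' ge.
    by rewrite eqs subnn take0 cats0 drop_size cats0.
  rewrite Et -catA in E; have := congr1 (drop (size (block r n I))) E.
  rewrite !drop_size_cat // => /IH[O1 [lo [O2 [Y1 [Y2 [E1 E2 E3 E4]]]]]].
  exists ((true, r) :: O1), lo, O2, Y1, Y2; rewrite /= addnS -addSn E2; split=> //; first by rewrite E1.
  by rewrite -catA -E3.
case: Z1 => [//|z Z1 [<- /IH[O1 [lo [O2 [Y1 [Y2 [E1 E2 E3 E4]]]]]]]].
exists ((false, r) :: O1), lo, O2, Y1, Y2; rewrite /= E2; split=> //; [by rewrite E1|by rewrite E3].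
Qed.

Lemma size_graft n O I :
  size (graft n O I) + size (special O) = size O + size (special O) * size I.
Proof.
elim: O n => [|[[] r] O IH] n //=; last by have := IH n; lia.
by have := IH n.+1; rewrite size_cat size_insert size_map mulSn; lia.
Qed.

Lemma size_special_graft n O I :
  size (special (graft n O I)) = size (special O) * size (special I).
Proof.
elim: O n => [|[[] r] O IH] n //=; rewrite special_cat size_cat IH.
by rewrite size_special_insert special_tag size_map mulSn.
Qed.
End Merge.

(** Double counting the special occurrences yields the number of symbols; the total count yields the
    number of ones. *)
Definition uniform (T : eqType) (Z : seq (line T)) m cs ct :=
  [/\ forall r : line T, r \in Z -> uniq (symbols r),
      forall r : line T, r \in Z -> r.1 -> size r.2 = m
    & forall x, x \in flat Z -> count_mem x (flat Z) = ct /\ count_mem x (flat (special Z)) = cs].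

Definition alternates (T : eqType) (Z : seq (line T)) L :=
  forall a b, a != b -> exists x, fits (alternation x L) (word a b (flat Z)).

Definition apart (T : eqType) (a b : T) (Z : seq (line T)) :=
  all (fun r => ~~ [&& r.1, a \in symbols r & b \in symbols r]) Z.

Section Facts.
Variable T : eqType.
Implicit Types (Z : seq (line T)) (l : seq (T * bool)).

Lemma mem_flat r Z x : r \in Z -> x \in symbols r -> x \in flat Z.
Proof. by move=> rZ xr; apply/flattenP; exists (symbols r); rewrite ?map_f. Qed.

Lemma apart_cat a b Z1 Z2 : apart a b (Z1 ++ Z2) = apart a b Z1 && apart a b Z2.
Proof. exact: all_cat. Qed.

Lemma apartC a b Z : apart a b Z = apart b a Z.
Proof. by apply: eq_all => r /=; rewrite andbCA andbC -andbA andbC -andbA andbCA. Qed.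

Lemma apart_notinl a b Z : a \notin flat Z -> apart a b Z.
Proof.
move=> aZ; apply/allP => r rZ; apply: contra aZ => /and3P[_ ar _].
exact: mem_flat rZ ar.
Qed.

Lemma apart_notinr a b Z : b \notin flat Z -> apart a b Z.
Proof. by rewrite apartC; apply: apart_notinl. Qed.

Lemma mem_put e l : put e l =i e :: l.
Proof. by move=> x; rewrite /put; case: e.2; rewrite ?mem_rcons. Qed.

Lemma perm_put e l : perm_eq (put e l) (e :: l).
Proof. by rewrite /put; case: e.2; rewrite // perm_rcons. Qed.

Lemma uniq_put e l : uniq (unzip1 (put e l)) = (e.1 \notin unzip1 l) && uniq (unzip1 l).
Proof. by rewrite (perm_uniq (perm_map fst (perm_put e l))). Qed.

Lemma size_put e l : size (put e l) = (size l).+1.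
Proof. by rewrite /put; case: e.2; rewrite ?size_rcons. Qed.

Lemma mem_unzip1 l x f : (x, f) \in l -> x \in unzip1 l.
Proof. exact: (map_f fst). Qed.

Lemma unzip1P l x : reflect (exists f, (x, f) \in l) (x \in unzip1 l).
Proof.
apply: (iffP mapP) => [[[y f] yl ->]|[f xl]]; first by exists f.
by exists (x, f).
Qed.

Lemma special_split Z i : i < size (special Z) ->
  exists Z1 l Z2, Z = Z1 ++ (true, l) :: Z2 /\ size (special Z1) = i.
Proof.
elim: Z i => [|[[] l] Z IH] i //=.
  case: i => [_|i /IH[Z1 [l' [Z2 [-> <-]]]]]; first by exists [::], l, Z.
  by exists ((true, l) :: Z1), l', Z2.
by move=> /IH[Z1 [l' [Z2 [-> <-]]]]; exists ((false, l) :: Z1), l', Z2.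
Qed.

Lemma all_insert (P : pred (line T)) es Z : size es = size (special Z) ->
  (forall l, (false, l) \in Z -> P (false, l)) ->
  (forall e l, e \in es -> (true, l) \in Z -> P (true, put e l)) -> all P (insert es Z).
Proof.
elim: Z es => [|[[] l] Z IH] es //=.
  case: es => //= e es [sz] h0 h1; rewrite h1 ?mem_head //=.
  by apply: IH => // e' l' ee lZ; apply: h1; rewrite inE ?ee ?lZ orbT.
move=> sz h0 h1; rewrite h0 ?mem_head //=; apply: IH => //.
by move=> l' lZ; apply: h0; rewrite inE lZ orbT.
Qed.

End Facts.

Section MergeFacts.
Variables U V : eqType.
Implicit Types (O : seq (line U)) (I : seq (line V)).

Lemma special_block (l : seq (U * bool)) i I : special (block l i I) = block l i (special I).
Proof.
rewrite /block; move: (map _ l) => es; elim: I es => [|[[] r] I IH] [|e es] //=; by rewrite ?IH.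
Qed.

Lemma special_graft n O I : special (graft n O I) = graft n (special O) (special I).
Proof.
elim: O n => [|[[] r] O IH] n //=.
by rewrite special_cat special_block IH.
Qed.

Lemma special_id (T : eqType) (Z : seq (line T)) : special (special Z) = special Z.
Proof. by rewrite /special filter_id. Qed.

Lemma uniform_fit O m cs ct : uniform O m cs ct -> fit_rows m O.
Proof. by case=> _ h _; apply/allP => r rO; apply/implyP => /(h _ rO) ->. Qed.

Lemma fit_special m O : fit_rows m O -> fit_rows m (special O).
Proof. by move=> /allP h; apply/allP => r; rewrite mem_filter => /andP[_ /h]. Qed.

Lemma all_graft (P : pred (line (U + nat * V)%type)) n O I : fit_rows (size (special I)) O ->
  (forall l, (false, l) \in O -> P (lift_line V (false, l))) ->
  (forall i l, (false, l) \in I -> P (tag_copy U i (false, l))) ->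
  (forall i e lo l, (true, lo) \in O -> e \in lo -> (true, l) \in I ->
     P (true, put (inl e.1, e.2) (tag_copy U i (true, l)).2)) ->
  all P (graft n O I).
Proof.
elim: O n => [|[[] r] O IH] n //= fO h0 h1 h2; last first.
  rewrite h0 ?mem_head //=; apply: IH => // l lO.
  by apply: h0; rewrite inE lO orbT.
case/andP: fO => /eqP sz fO; rewrite all_cat; apply/andP; split; last first.
  apply: IH => // i e lo l loO elo lI.
  by apply: h2 elo lI; rewrite inE loO orbT.
apply: all_insert; first by rewrite special_tag !size_map.
  by move=> l /mapP[[[] l0] //= l0I [->]]; apply: h1.
move=> _ l /mapP[e er ->] /mapP[[[] l0] //= l0I [->]]; by apply: (h2 n e r l0); rewrite ?mem_head.
Qed.

Lemma symbols_tag i (r : line V) : symbols (tag_copy U i r) = [seq inr (i, x) | x <- symbols r].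
Proof. by rewrite /symbols /= /unzip1 -!map_comp. Qed.

Lemma symbols_lift (r : line U) : symbols (lift_line V r) = [seq inl x | x <- symbols r].
Proof. by rewrite /symbols /= /unzip1 -!map_comp. Qed.

Lemma inl_notin_tag b i (r : line V) : inl b \notin symbols (tag_copy U i r).
Proof. by rewrite symbols_tag; apply/mapP => -[]. Qed.

Lemma uniq_tag i (r : line V) : uniq (symbols (tag_copy U i r)) = uniq (symbols r).
Proof. by rewrite symbols_tag map_inj_uniq // => x y []. Qed.

Lemma uniform_graft O I m f cs ct : size (special I) = f ->
  uniform O f cs ct -> uniform I m cs ct -> uniform (graft 0 O I) m.+1 cs ct.
Proof.
move=> sf uO uI; have fO := uniform_fit uO; case: uO uI => hO1 hO2 hO3 [hI1 hI2 hI3]; split.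
- apply/allP/all_graft => [|l lO|i l lI|i e lo l loO elo lI]; first by rewrite sf.
  + by rewrite symbols_lift map_inj_uniq ?hO1 // => x y [].
  + by rewrite uniq_tag hI1.
  + rewrite /symbols /= uniq_put /=; apply/andP; split; first exact: (inl_notin_tag _ _ (true, l)).
    by apply: etrans (uniq_tag i (true, l)) _; apply: hI1.
- suff /allP h : all (fun r => r.1 ==> (size r.2 == m.+1)) (graft 0 O I).
    by move=> r /h/implyP h' /h'/eqP.
  apply: all_graft => //; first by rewrite sf.
  move=> i e lo l loO elo lI.
  by rewrite /= size_put size_map (hI2 _ lI).
- case=> [u|[i v]]; rewrite special_graft.
    rewrite mem_outer !count_outer !outer_part_graft ?special_id ?sf //; last exact: fit_special.
    by move/hO3.
  rewrite mem_copy !count_copy !copy_part_graft special_id.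
  by case: ifP => // _ /hI3.
Qed.

(** * The surroundings of a special row of a graft *)

Section AtSpecial.
Variables (O1 O2 : seq (line U)) (lo1 lo2 : seq (U * bool)) (e : U * bool).
Variables (I1 I2 : seq (line V)) (li : seq (V * bool)).
Let lo := lo1 ++ e :: lo2.
Let O := O1 ++ (true, lo) :: O2.
Let I := I1 ++ (true, li) :: I2.
Let i := size (special O1).
Definition above := graft 0 O1 I ++ block lo1 i I1.
Definition below := block lo2 i I2 ++ graft i.+1 O2 I.
Definition middle := put (inl e.1, e.2) (tag_copy U i (true, li)).2.
Hypotheses (s1 : size lo1 = size (special I1)) (s2 : size lo2 = size (special I2)).
Hypothesis fO : fit_rows (size (special I)) O.

Lemma copy_part_above : copy_part i (flat above) = flat I1.
Proof. by rewrite flat_cat copy_part_cat copy_part_graft copy_part_block eqxx add0n ltnn. Qed.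
Lemma copy_part_below : copy_part i (flat below) = flat I2.
Proof. by rewrite flat_cat copy_part_cat copy_part_graft copy_part_block eqxx ltnn cats0. Qed.

Let fO12 : fit_rows (size (special I)) O1 /\ fit_rows (size (special I)) O2.
Proof. by move: fO; rewrite /O /fit_rows all_cat /= => /and3P[]. Qed.

Lemma outer_part_above : outer_part (flat above) = flat O1 ++ unzip1 lo1.
Proof. by rewrite flat_cat outer_part_cat outer_part_graft ?outer_part_block //; case: fO12. Qed.
Lemma outer_part_below : outer_part (flat below) = unzip1 lo2 ++ flat O2.
Proof. by rewrite flat_cat outer_part_cat outer_part_graft ?outer_part_block //; case: fO12. Qed.

(** Earlier copies do not contain a, and the part of copy i above the row has received no b, so all
    b precede all a. *)
Lemma fits_word_above a b : b \notin unzip1 lo1 ->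
  fits [:: false; true] (word (inr (i, a)) (inl b) (flat above)).
Proof.
move=> bn; rewrite flat_cat word_cat; apply: (@fits_cat [:: _]).
  by apply: fits_wordNl; rewrite mem_copy copy_part_graft add0n ltnn.
by apply: fits_wordNr; rewrite mem_outer outer_part_block.
Qed.

Lemma fits_word_below a b : b \notin unzip1 lo2 ->
  fits [:: true; false] (word (inr (i, a)) (inl b) (flat below)).
Proof.
move=> bn; rewrite flat_cat word_cat; apply: (@fits_cat [:: _]).
  by apply: fits_wordNr; rewrite mem_outer outer_part_block.
by apply: fits_wordNl; rewrite mem_copy copy_part_graft ltnn.
Qed.

Lemma apart_above a b : b \notin unzip1 lo1 -> apart (inr (i, a)) (inl b) above.
Proof.
move=> bn; rewrite apart_cat apart_notinl ?apart_notinr //.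
  by rewrite mem_outer outer_part_block.
by rewrite mem_copy copy_part_graft add0n ltnn.
Qed.

Lemma apart_below a b : b \notin unzip1 lo2 -> apart (inr (i, a)) (inl b) below.
Proof.
move=> bn; rewrite apart_cat apart_notinr ?apart_notinl //.
  by rewrite mem_copy copy_part_graft ltnn.
by rewrite mem_outer outer_part_block.
Qed.

Lemma apart_copy_block (a b : V) (l : seq (U * bool)) J : apart a b J -> apart (inr (i, a)) (inr (i, b)) (block l i J).
Proof.
have mt (c : V) (r : line V) : (inr (i, c) \in symbols (tag_copy U i r)) = (c \in symbols r).
  by rewrite mem_copy copy_part_tag eqxx.
have mp (c : V) (e' : U * bool) (r : line V) :
    (inr (i, c) \in unzip1 (put (inl e'.1, e'.2) (tag_copy U i r).2)) = (c \in symbols r).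
  by rewrite mem_copy copy_part_put eqxx.
rewrite /block; elim: J l => [|[[] r] J IH] l; [by []| |exact: IH].
rewrite /= => /andP[h aJ].
case: l => [|x l] /=; first by rewrite !(mt _ (true, r)) h; apply: (IH [::]).
by rewrite /symbols /= !(mp _ _ (true, r)) h; apply: IH.
Qed.

Lemma apart_copy_above a b : apart a b I1 -> apart (inr (i, a)) (inr (i, b)) above.
Proof.
move=> h; rewrite apart_cat apart_copy_block // andbT apart_notinl //.
by rewrite mem_copy copy_part_graft add0n ltnn.
Qed.

Lemma apart_copy_below a b : apart a b I2 -> apart (inr (i, a)) (inr (i, b)) below.
Proof.
move=> h; rewrite apart_cat apart_copy_block // apart_notinl //.
by rewrite mem_copy copy_part_graft ltnn.
Qed.

Lemma word_copy_middle a b : word (inr (i, a)) (inr (i, b)) (unzip1 middle) = word a b (unzip1 li).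
Proof. by rewrite word_copy (copy_part_put _ _ _ (true, li)) eqxx. Qed.

Lemma word_cross_middle a : uniq (unzip1 li) -> a \in unzip1 li ->
  word (inr (i, a)) (inl e.1) (unzip1 middle) = if e.2 then [:: false; true] else [:: true; false].
Proof.
move=> ul al; have w0 : word (inr (i, a)) (inl e.1) (symbols (tag_copy U i (true, li))) = [:: true].
  rewrite wordNr ?inl_notin_tag // count_copy copy_part_tag eqxx count_uniq_mem //.
  by rewrite /symbols /= al.
rewrite /middle /put /=; case: e.2.
  rewrite (_ : unzip1 _ = [:: inl e.1] ++ symbols (tag_copy U i (true, li))) //.
  by rewrite word_cat w0 /word /= eqxx.
rewrite /unzip1 map_rcons -cats1 word_cat -/(symbols (tag_copy U i (true, li))) w0.
by rewrite /word /= eqxx.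
Qed.

Lemma mem_copy_middle a f : ((inr (i, a), f) \in middle) = ((a, f) \in li).
Proof.
rewrite mem_put inE xpair_eqE /=; apply/mapP/idP => [[[x g] xg [-> ->]] //|al].
by exists (a, f).
Qed.

Lemma mem_outer_middle b f : ((inl b, f) \in middle) = ((b, f) == e).
Proof.
rewrite mem_put inE [in RHS](surjective_pairing e) !xpair_eqE /= orbC.
by case: mapP => // -[[x g] _ []].
Qed.

Lemma mem_middleP x : x \in unzip1 middle -> x = inl e.1 \/ exists2 a, x = inr (i, a) & a \in unzip1 li.
Proof.
case: x => [u|[j a]].
  rewrite mem_outer (outer_part_put _ _ (true, li)) inE => /eqP ->; by left.
rewrite mem_copy (copy_part_put _ _ _ (true, li)) eq_sym; case: eqP => // <- al.
by right; exists a.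
Qed.
End AtSpecial.

Lemma graft_special O I Z1 l Z2 : fit_rows (size (special I)) O ->
  graft 0 O I = Z1 ++ (true, l) :: Z2 ->
  exists O1 O2 lo1 lo2 e, exists I1 I2 li,
   [/\ O = O1 ++ (true, lo1 ++ e :: lo2) :: O2, I = I1 ++ (true, li) :: I2,
       size lo1 = size (special I1) /\ size lo2 = size (special I2),
       l = middle O1 e li
     & Z1 = above O1 lo1 I1 I2 li /\ Z2 = below O1 O2 lo2 I1 I2 li].
Proof.
move=> fO /graft_split[O1 [lo [O2 [Y1 [Y2 [EO Eb -> ->]]]]]].
have slo : size lo = size (special I).
  by move: fO; rewrite EO /fit_rows all_cat /= => /and3P[_ /eqP].
have [|es1 [e' [es2 [J1 [l' [J2 [Ees EJ sz El [E1 E2]]]]]]]] := insert_split _ Eb.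
  by rewrite special_tag !size_map.
have EI : I = take (size J1) I ++ drop (size J1) I by rewrite cat_take_drop.
have := congr1 (take (size J1)) EJ; rewrite -map_take take_size_cat // => EJ1.
have := congr1 (drop (size J1)) EJ; rewrite -map_drop drop_size_cat // => EJ2.
have := congr1 (take (size es1)) Ees; rewrite -map_take take_size_cat // => Ees1.
have := congr1 (drop (size es1)) Ees; rewrite -map_drop drop_size_cat // => Ees2.
case EdI: (drop (size J1) I) EJ2 => [|[sp li] I2] //= [Esp El' EI2].
case Edl: (drop (size es1) lo) Ees2 => [|e lo2] //= [Ee Ees2'].
rewrite Esp in EdI; exists O1, O2, (take (size es1) lo), lo2, e, (take (size J1) I), I2, li.
have slo1 : size (take (size es1) lo) = size es1 by rewrite -[RHS](congr1 size Ees1) size_map.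
have sI1 : size (special (take (size J1) I)) = size es1 by rewrite sz -[in RHS]EJ1 special_tag size_map.
split.
- by rewrite -Edl cat_take_drop.
- by rewrite -EdI cat_take_drop.
- rewrite slo1 sI1; split=> //.
  move: slo; rewrite -(cat_take_drop (size es1) lo) -(cat_take_drop (size J1) I) EdI Edl.
  by rewrite special_cat !size_cat sI1 slo1 /=; lia.
- by rewrite El -Ee -El'.
- have -> : Y1 = block (take (size es1) lo) (size (special O1)) (take (size J1) I).
    by rewrite E1 -[in LHS]EJ1 -[in LHS]Ees1 /block add0n.
  have -> : Y2 = block lo2 (size (special O1)) I2 by rewrite E2 -EI2 -Ees2' /block add0n.
  by rewrite /above /below -EdI !cat_take_drop add0n.
Qed.
End MergeFacts.

(** * Sequences of even order *)

Section MergeWords.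
Variables U V : eqType.
Implicit Types (O : seq (line U)) (I : seq (line V)).

Lemma fits_word_copies O I i j (a b : V) : i < j ->
  fits [:: true; false] (word (inr (i, a) : U + nat * V) (inr (j, b)) (flat (graft 0 O I))).
Proof.
move=> ij; have [lt|ge] := ltnP i (size (special O)); last first.
  apply/fits_skip/fits_wordNl; rewrite mem_copy copy_part_graft add0n; case: ifP => //; lia.
have [O1 [lo [O2 [-> s1]]]] := special_split lt.
rewrite graft_cat add0n s1 /= !flat_cat !word_cat catA; apply: (@fits_cat [:: _]).
  rewrite -word_cat; apply: fits_wordNr.
  rewrite mem_cat !mem_copy copy_part_graft copy_part_block add0n s1.
  by case: ifP; [lia|case: eqP => //; lia].
by apply: fits_wordNl; rewrite mem_copy copy_part_graft; case: ifP => //; lia.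
Qed.

(** The symbol a lives inside copy i, where b occurs at most once: outside the copy only b is seen,
    inside at most one b among occurrences of a. The final clause serves order 3, where b is known
    to be absent on one side. *)
Lemma fits_word_cross O I i (a : V) (b : U) :
  (forall r : line U, r \in O -> uniq (symbols r)) -> fit_rows (size (special I)) O ->
  let w := word (inl b : U + nat * V) (inr (i, a)) (flat (graft 0 O I)) in
  fits [:: true; false; true] w \/
  exists O1 lo O2 f w1 w2 w3, [/\ O = O1 ++ (true, lo) :: O2, (b, f) \in lo, w = w1 ++ w2 ++ w3,
    [/\ fits [:: true] w1, fits [:: false; true; false] w2 & fits [:: true] w3]
    & (b \notin flat O1 -> w1 = [::]) /\ (b \notin flat O2 -> w3 = [::])].
Proof.
move=> uO fO w; rewrite {}/w; have [lt|ge] := ltnP i (size (special O)); last first.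
  left; apply: (@fits_catr [:: true] [:: false; true]); apply: fits_wordNr.
  by rewrite mem_copy copy_part_graft add0n; case: ifP => //; lia.
have [O1 [lo [O2 [EO s1]]]] := special_split lt.
have := fO; rewrite EO /fit_rows all_cat /= => /and3P[fO1 /eqP slo fO2].
rewrite graft_cat add0n s1 /= !flat_cat !word_cat.
set w1 := word _ _ _; set w2 := word _ _ _; set w3 := word _ _ _.
have n1 : inr (i, a) \notin flat (graft 0 O1 I).
  by rewrite mem_copy copy_part_graft; case: ifP => //; lia.
have n3 : inr (i, a) \notin flat (graft i.+1 O2 I).
  by rewrite mem_copy copy_part_graft; case: ifP => //; lia.
have f1 : fits [:: true] w1 by apply: fits_wordNr.
have f3 : fits [:: true] w3 by apply: fits_wordNr.
have out : outer_part (flat (block lo i I)) = unzip1 lo by rewrite outer_part_block.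
case: (boolP (b \in unzip1 lo)) => [/unzip1P[f bf]|bn]; last first.
  left; apply: (@fits_cat [:: _] [:: _; _]) => //; apply: (@fits_cat [:: _]) => //.
  by apply: fits_wordNl; rewrite mem_outer out.
right; exists O1, lo, O2, f, w1, w2, w3; split=> //; first split=> //.
  apply: fits_single_true; rewrite count_word // count_outer out count_uniq_mem ?leq_b1 //.
  by apply: (uO (true, lo)); rewrite EO mem_cat inE eqxx orbT.
split=> bn.
  by rewrite /w1 wordNl ?mem_outer ?outer_part_graft // (count_memPn n1).
by rewrite /w3 wordNl ?mem_outer ?outer_part_graft // (count_memPn n3).
Qed.

(** Outer pairs and pairs within one copy inherit their words, and different copies occupy disjoint
    ranges. Mixed pairs are the ones that depend on the order considered. *)
Lemma alternates_graft O I L : 1 < L -> fit_rows (size (special I)) O ->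
  alternates O L -> alternates I L ->
  (forall i a b, exists x, fits (alternation x L)
     (word (inl b : U + nat * V) (inr (i, a)) (flat (graft 0 O I)))) ->
  alternates (graft 0 O I) L.
Proof.
move=> L1 fO aO aI cross [b|[i a]] [b'|[j a']] ne.
- have [//|x f] := aO b b'.
  by exists x; rewrite word_outer outer_part_graft.
- exact: cross.
- have [x f] := cross i a b'; exists (~~ x).
  by rewrite -alternation_neg (word_swap _ (_ : inl b' != inr (i, a))) //; apply: fits_map_neg.
case: (ltngtP i j) ne => [ij|ij|<-] ne.
- by exists true; apply: (@fits_alternation_leq true 2) => //; apply: fits_word_copies.
- exists false; apply: (@fits_alternation_leq false 2) => //.
  rewrite word_swap 1?eq_sym // -[alternation _ _]/(map negb [:: true; false]).
  exact/fits_map_neg/fits_word_copies.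
have [//|x f] := aI a a'; first by apply: contraNN ne => /eqP ->.
exists x; rewrite word_copy copy_part_graft; case: ifP => // _; exact: fits_nilr.
Qed.
End MergeWords.

(** In even order all rows are blocks, and the common tag [false] makes the outer symbol the last of
    its row. *)
Definition plain (T : eqType) (Z : seq (line T)) := all (fun r => r.1 && all (fun x => ~~ x.2) r.2) Z.

Lemma plain_graft (U V : eqType) (O : seq (line U)) (I : seq (line V)) :
  fit_rows (size (special I)) O -> plain O -> plain I -> plain (graft 0 O I).
Proof.
move=> fO /allP pO /allP pI; apply: all_graft => // [l /pO //|i l /pI //|i e lo l /pO /= /allP h el /pI /= hl].
rewrite (eq_all_r (mem_put _ _)) /= h //= all_map; exact: sub_all hl.
Qed.

Lemma plain_special (T : eqType) (Z : seq (line T)) : plain Z -> special Z = Z.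
Proof. by move/allP => h; apply/all_filterP/allP => r /h /andP[]. Qed.

(* a is the younger symbol: all its occurrences lie between two consecutive
   occurrences of b, except for the shared row l. *)
Definition nested (T : eqType) (a b : T) (Z1 : seq (line T)) (l : seq (T * bool)) Z2 :=
  [/\ apart a b Z1, apart a b Z2, fits [:: false; true] (word a b (flat Z1)),
      word a b (unzip1 l) = [:: true; false] & fits [:: true; false] (word a b (flat Z2))].

Definition all_nested (T : eqType) (Z : seq (line T)) :=
  forall Z1 l Z2 a b, Z = Z1 ++ (true, l) :: Z2 -> a != b ->
    a \in unzip1 l -> b \in unzip1 l -> nested a b Z1 l Z2 \/ nested b a Z1 l Z2.

(** An outer symbol enters a given copy in a single row, and a copy symbol never leaves its copy. So
    a mixed pair is nested with the copy symbol as the younger one; pairs within a copy inherit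
    nestedness. *)
Lemma all_nested_graft (U V : eqType) (O : seq (line U)) (I : seq (line V)) :
  (forall r : line U, r \in O -> uniq (symbols r)) -> (forall r : line V, r \in I -> uniq (symbols r)) ->
  fit_rows (size (special I)) O -> plain O -> all_nested I -> all_nested (graft 0 O I).
Proof.
move=> uO uI fO pO nI Z1 l Z2 a b E ab al bl.
have [O1 [O2 [lo1 [lo2 [e [I1 [I2 [li [EO EI [s1 s2] El [EZ1 EZ2]]]]]]]]]] := graft_special fO E.
subst O I l Z1 Z2.
have ue : e.1 \notin unzip1 lo1 /\ e.1 \notin unzip1 lo2.
  have := uO (true, lo1 ++ e :: lo2); rewrite mem_cat inE eqxx orbT => /(_ isT).
  rewrite /symbols /= /unzip1 map_cat cat_uniq /= => /and3P[_ + /andP[? _]].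
  by rewrite negb_or => /andP[? _].
have ul : uniq (unzip1 li) by apply: (uI (true, li)); rewrite mem_cat inE eqxx orbT.
have e2 : e.2 = false.
  move/allP: pO => /(_ (true, lo1 ++ e :: lo2)); rewrite mem_cat inE eqxx orbT => /(_ isT) /= /allP.
  by move/(_ e); rewrite mem_cat inE eqxx orbT => /(_ isT) /negbTE.
have cross c : c \in unzip1 li -> nested (inr (size (special O1), c)) (inl e.1)
    (above O1 lo1 I1 I2 li) (middle O1 e li) (below O1 O2 lo2 I1 I2 li).
  move=> cl; case: ue => ? ?; split; [exact: apart_above|exact: apart_below| | |].
  - exact: fits_word_above.
  - by rewrite word_cross_middle // e2.
  - exact: fits_word_below.
case: (mem_middleP al) (mem_middleP bl) => [Ea|[a' Ea a'l]] [Eb|[b' Eb b'l]]; rewrite {}Ea {}Eb in ab al bl *.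
- by rewrite eqxx in ab.
- by right; apply: cross.
- by left; apply: cross.
have ab' : a' != b' by apply: contraNN ab => /eqP ->.
have same c d : nested c d I1 li I2 -> nested (inr (size (special O1), c)) (inr (size (special O1), d))
    (above O1 lo1 I1 I2 li) (middle O1 e li) (below O1 O2 lo2 I1 I2 li).
  case=> h1 h2 h3 h4 h5; split; [exact: apart_copy_above|exact: apart_copy_below| | |].
  - by rewrite word_copy copy_part_above.
  - by rewrite word_copy_middle.
  - by rewrite word_copy copy_part_below.
by case: (nI I1 li I2 a' b' erefl ab' a'l b'l) => h; [left|right]; apply: same.
Qed.

Lemma fits_alternation_swap (T : eqType) x n (a b : T) l : a != b ->
  fits (alternation x n) (word b a l) -> fits (alternation (~~ x) n) (word a b l).
Proof.
by move=> ab f; rewrite -alternation_neg (word_swap l (_ : b != a)) 1?eq_sym //; apply: fits_map_neg.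
Qed.

Lemma word_head (T : eqType) (a b : T) (l : seq T) : a \in l -> index a l < index b l ->
  exists w, word a b l = true :: w.
Proof.
elim: l => //= x l IH; rewrite inE eq_sym /word /=.
case: (eqVneq x a) => [->|_] /=; first by eexists.
by case: (eqVneq x b) => //= _ al; rewrite ltnS; apply: IH.
Qed.

(* s lists the symbols by first occurrence. *)
Lemma alternates_order (T : eqType) (Z : seq (line T)) L : alternates Z L ->
  exists s, [/\ uniq s, s =i flat Z & forall a b, a \in s -> b \in s -> index a s < index b s ->
    fits (alternation true L) (word a b (flat Z))].
Proof.
move=> alt; pose F := flat Z.
pose s := sort (fun x y => index x F <= index y F) (undup F).
have ms : s =i F by move=> x; rewrite mem_sort mem_undup.
exists s; split=> //; first by rewrite sort_uniq undup_uniq.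
move=> a b ha hb lt.
have ab : a != b by apply: contraTneq lt => ->; rewrite ltnn.
have srt : sorted (fun x y => index x F <= index y F) s.
  by apply: sort_sorted => x y; apply: leq_total.
have le : index a F <= index b F.
  by apply: (sorted_ltn_index _ srt) => // x y z; apply: leq_trans.
have {}lt : index a F < index b F.
  rewrite ltn_neqAle le andbT; apply: contraNneq ab => E.
  by rewrite -(nth_index a (_ : a \in F)) -?ms // E nth_index -?ms.
have aF : a \in F by rewrite -ms.
have [w Ew] := word_head aF lt; have [x] := alt a b ab.
rewrite -/F Ew; case: x => // f.
case: L f {alt} => [|L'] f; first by inversion f.
rewrite -[L'.+1]addn1 alternation_cat; apply: fits_catr.
exact: (@fits_skip_neg false).
Qed.

Lemma mem_split (T : eqType) (x : T) s : x \in s -> exists s1 s2, s = s1 ++ x :: s2.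
Proof. by case/splitPr => s1 s2; exists s1, s2. Qed.

(** * Replacing the blocks by sequences of smaller order *)

Section Substitute.
Variables (U V : eqType) (u0 : U) (s : seq V) (W : seq (line V)) (L g mu : nat).
Hypotheses (us : uniq s) (sW : s =i flat W).
Hypothesis altW : forall a b, a \in s -> b \in s -> index a s < index b s ->
  fits (alternation true L) (word a b (flat W)).
Hypotheses (uW : uniform W g mu mu) (pW : plain W).
Implicit Types (O : seq (line U)).

(** The i-th symbol of W by first occurrence becomes the i-th entry of the row, so that of two
    entries the left one starts the inserted word. *)
Definition rename (l : seq U) (v : V) := nth u0 l (index v s).

Definition substitute O := flatten [seq [seq relabel (rename (symbols r)) w | w <- W] | r <- O].

Lemma flat_relabel (X Y : Type) (f : X -> Y) Z : flat [seq relabel f w | w <- Z] = map f (flat Z).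
Proof.
rewrite /flat map_flatten -!map_comp; congr flatten; apply: eq_map => r /=.
by rewrite /symbols /= /unzip1 -!map_comp.
Qed.

Lemma substitute_cat O1 O2 : substitute (O1 ++ O2) = substitute O1 ++ substitute O2.
Proof. by rewrite /substitute map_cat flatten_cat. Qed.

Lemma substitute_cons r O :
  substitute (r :: O) = [seq relabel (rename (symbols r)) w | w <- W] ++ substitute O.
Proof. by []. Qed.

Lemma size_substitute O : size (substitute O) = size O * size W.
Proof. by elim: O => //= r O IH; rewrite substitute_cons size_cat size_map IH mulSn. Qed.

Section OneRow.
Variable l : seq U.
Hypotheses (ul : uniq l) (sl : size l = size s).

Lemma rename_in v : v \in s -> rename l v \in l.
Proof. by move=> vs; rewrite mem_nth // sl index_mem. Qed.

Lemma rename_inj : {in s &, injective (rename l)}.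
Proof.
move=> v w vs ws /eqP; rewrite nth_uniq ?sl ?index_mem // => /eqP E.
by rewrite -(nth_index v vs) E nth_index.
Qed.

Lemma renameP a : a \in l -> exists2 v, v \in s & rename l v = a /\ index v s = index a l.
Proof.
move=> al; have := al; rewrite -index_mem sl; case Es: s => [|v0 s']; first by [].
rewrite -Es => lt; exists (nth v0 s (index a l)); first exact: mem_nth.
by rewrite /rename index_uniq // nth_index.
Qed.

Lemma rename_eq v w : v \in s -> w \in s -> (rename l v == rename l w) = (v == w).
Proof. by move=> vs ws; apply/eqP/eqP => [/rename_inj->|->]. Qed.

Lemma count_rename v : v \in s ->
  count_mem (rename l v) (map (rename l) (flat W)) = mu.
Proof.
move=> vs; rewrite count_map; case: uW => _ _ /(_ v); rewrite -sW => /(_ vs)[<- _].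
by apply: eq_in_count => w; rewrite -sW => ws /=; rewrite rename_eq.
Qed.

Lemma word_rename v w : v \in s -> w \in s ->
  word (rename l v) (rename l w) (map (rename l) (flat W)) = word v w (flat W).
Proof.
move=> vs ws; have : {subset flat W <= s} by move=> x; rewrite sW.
elim: (flat W) => //= x F IH sF; have xs : x \in s by rewrite sF ?mem_head.
have {}IH := IH (fun y yF => sF y (mem_behead (s := x :: F) yF)).
by move: IH; rewrite /word /= !rename_eq // => ->.
Qed.

Lemma rename_notin a : a \notin l -> a \notin map (rename l) (flat W).
Proof.
by apply: contra => /mapP[v]; rewrite -sW => vs ->; apply: rename_in.
Qed.

Lemma uniq_rename r : r \in W -> uniq (symbols (relabel (rename l) r)).
Proof.
move=> rW; have E : symbols (relabel (rename l) r) = map (rename l) (symbols r).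
  by rewrite /symbols /= /unzip1 -!map_comp.
rewrite E map_inj_in_uniq; first by case: uW => + _ _; apply.
by move=> x y xr yr; apply: rename_inj; rewrite sW; apply: mem_flat rW _.
Qed.
End OneRow.

Lemma plain_substitute O : plain (substitute O).
Proof.
apply/allP => r /flattenP[_ /mapP[r0 _ ->]] /mapP[w wW ->] /=.
by have /= /andP[-> h] := allP pW w wW; rewrite all_map; apply: sub_all h.
Qed.

Variables (O : seq (line U)) (nu : nat).
Hypotheses (uO : uniform O (size s) nu nu) (pO : plain O).

Let rowO r : r \in O -> uniq (symbols r) /\ size (symbols r) = size s.
Proof.
move=> rO; case: uO => h1 h2 _; split; first exact: h1.
by rewrite size_map h2 //; have /andP[] := allP pO r rO.
Qed.

Lemma count_substitute a O' : {subset O' <= O} ->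
  count_mem a (flat (substitute O')) = mu * count_mem a (flat O').
Proof.
elim: O' => [|r O' IH] sO; first by rewrite muln0.
have [ur sr] := rowO (sO r (mem_head _ _)).
rewrite substitute_cons flat_cat flat_cons !count_cat mulnDr flat_relabel.
rewrite IH; last by move=> x xO; apply: sO; rewrite inE xO orbT.
congr (_ + _); rewrite (count_uniq_mem a ur); case: (boolP (a \in symbols r)) => ar.
  have [v vs [E _]] := renameP sr ar.
  by rewrite -[in LHS]E count_rename // muln1.
by rewrite muln0; apply/count_memPn/rename_notin.
Qed.

Lemma uniform_substitute : uniform (substitute O) g (nu * mu) (nu * mu).
Proof.
case: (uW) => hW1 hW2 _; case: (uO) => hO1 _ hO3; split.
- move=> r /flattenP[_ /mapP[r0 r0O ->]] /mapP[w wW ->].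
  by have [? ?] := rowO r0O; apply: uniq_rename.
- move=> r /flattenP[_ /mapP[r0 r0O ->]] /mapP[w wW ->] /= w1.
  by rewrite size_map hW2.
move=> x; rewrite (plain_special (plain_substitute O)) -has_pred1 has_count count_substitute //.
move=> c0; have /hO3 [-> _] : x \in flat O by rewrite -has_pred1 has_count; lia.
by rewrite mulnC.
Qed.

(** A row containing at most one of the two symbols contributes at most one letter, which the
    inserted copy only repeats. *)
Lemma fits_substitute_apart a b p O' : a != b -> {subset O' <= O} -> apart a b O' ->
  fits p (word a b (flat O')) -> fits p (word a b (flat (substitute O'))).
Proof.
move=> ab; elim: O' p => [|r O' IH] p sO //= /andP[ar apO].
have rO : r \in O by apply: sO; apply: mem_head.
have [ur sr] := rowO rO; have /andP[r1 _] := allP pO r rO; rewrite r1 /= in ar.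
have {}IH q := IH q (fun x xO => sO x (mem_behead (s := r :: O') xO)) apO.
rewrite substitute_cons flat_cat flat_cons !word_cat flat_relabel.
case: (boolP (a \in symbols r)) ar => [al bl|al _].
  rewrite (wordNr a bl) (wordNr a (rename_notin sr bl)) count_uniq_mem // al.
  exact: fits_stutter.
rewrite (wordNl b al) (wordNl b (rename_notin sr al)) count_uniq_mem //.
case: (boolP (b \in symbols r)) => bl; first exact: fits_stutter.
by rewrite (count_memPn (rename_notin sr bl)); apply: IH.
Qed.

(** A nested pair shares one row. Its word has the shape [false], [true] above that row and [true],
    [false] below it. The inserted word of shape [alternation true] of length 2 n + 1 begins and
    ends with [true], so both seams merge and 2 + (2 n + 1) + 2 - 2 = 2 n + 3 runs remain. *)
Lemma alternates_substitute n : L = n.*2.+1 -> all_nested O -> alternates O n.*2.+3 ->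
  alternates (substitute O) n.*2.+3.
Proof.
move=> EL nO alt a b ab.
case: (boolP (apart a b O)) => [ap|].
  by have [x f] := alt a b ab; exists x; apply: fits_substitute_apart.
rewrite -has_predC => /hasP[r rO] /=; rewrite negbK => /and3P[r1 ar br].
have [O1 [O2 E]] := mem_split rO; case: r r1 ar br rO E => [[] l] //= _ al bl rO E.
have [ul sl] := rowO rO.
suff key c d : c != d -> c \in unzip1 l -> d \in unzip1 l -> nested c d O1 l O2 ->
    fits (alternation false n.*2.+3) (word c d (flat (substitute O))).
  case: (nO _ _ _ _ _ E ab al bl) => h; first by exists false; apply: key.
  exists true; apply: (@fits_alternation_swap _ false n.*2.+3 a b _ ab).
  by apply: key; rewrite // eq_sym.
move=> cd cl dl [ap1 ap2 f1 wl f2].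
rewrite E substitute_cat substitute_cons !flat_cat flat_relabel !word_cat.
have sO1 : {subset O1 <= O} by move=> x xO; rewrite E mem_cat xO.
have sO2 : {subset O2 <= O} by move=> x xO; rewrite E mem_cat inE xO !orbT.
have {}f1 := fits_substitute_apart cd sO1 ap1 f1.
have {}f2 := fits_substitute_apart cd sO2 ap2 f2.
have lt : index c (unzip1 l) < index d (unzip1 l).
  elim: (unzip1 l) wl cl {al bl ul sl dl ap1 ap2} => //= x l' IH.
  rewrite inE [in c == x]eq_sym /word /=; case: (eqVneq x c) => [->|_] /=; first by rewrite (negbTE cd).
  by case: (eqVneq x d) => //= _ wl cl; rewrite ltnS IH.
have fl : fits (alternation true L) (word c d (map (rename (unzip1 l)) (flat W))).
  have [v vs [Ev iv]] := renameP sl cl; have [w ws [Ew iw]] := renameP sl dl.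
  rewrite -{1}Ev -{1}Ew (word_rename ul sl vs ws); apply: altW => //.
  by rewrite iv iw.
have := fits_cat f1 (fits_cat fl f2).
rewrite EL -(addn1 n.*2) alternation_cat odd_double /= -catA => f.
have {}f := @fits_squash (false :: true :: alternation true n.*2) [:: false] true _ f.
have E2 : alternation true n.*2 ++ [:: true; false] = true :: alternation false n.*2.+1.
  by rewrite -[RHS]/(alternation true n.*2.+2) -(addn2 n.*2) alternation_cat odd_double.
rewrite /= E2 in f.
rewrite addn1; exact: (@fits_squash [:: false] (alternation false n.*2.+1) true _ f).
Qed.
End Substitute.

(** * Existence of sequences of even order *)

Lemma word_pair (T : eqType) (a b : T) l : uniq l -> a \in l -> b \in l ->
  index a l < index b l -> word a b l = [:: true; false].
Proof.
elim: l => //= x l IH /andP[xl ul]; rewrite !inE ![_ == x]eq_sym /word /=.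
case: (eqVneq x a) => [<-|_] /=.
  case: (eqVneq x b) => //= _ _ bl _; congr (_ :: _).
  by apply: etrans (wordNl b xl) _; rewrite count_uniq_mem // bl.
by case: (eqVneq x b) => //= _ al bl; rewrite ltnS; apply: IH.
Qed.

Lemma word_rev (T : eqType) (a b : T) l : word a b (rev l) = rev (word a b l).
Proof.
elim: l => //= x l IH; rewrite rev_cons -cats1 word_cat IH /word /=.
by case: ifP => _; [|case: ifP => _]; rewrite ?rev_cons ?cats1 ?cats0.
Qed.

Lemma index_total (T : eqType) (a b : T) l : a != b -> a \in l -> b \in l ->
  (index a l < index b l) || (index b l < index a l).
Proof.
move=> ab al bl; rewrite -neq_ltn; apply: contraNneq ab => E.
by rewrite -(nth_index a al) E nth_index.
Qed.

Definition plain_row (T : Type) (l : seq T) : line T := (true, [seq (x, false) | x <- l]).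

Lemma symbols_plain_row (T : Type) (l : seq T) : symbols (plain_row l) = l.
Proof. by rewrite /symbols /= /unzip1 -map_comp map_id. Qed.

(** The order is 2 t + 2. In order 2 a row and its reverse share all pairs, so nestedness is asked
    for positive t, the only case in which the sequence serves as an outer one. *)
Definition block_sequence t k m F := exists (T : eqType) (x0 : T) (Z : seq (line T)),
  [/\ uniform Z m (2 ^ 'C(k, t)) (2 ^ 'C(k, t)), plain Z, alternates Z t.*2.+3,
      0 < t -> all_nested Z & 0 < size Z <= F].

Lemma plain_plain_row (T : eqType) (l : seq T) : all (fun x => ~~ x.2) (plain_row l).2.
Proof. by rewrite all_map; apply/allP. Qed.

Lemma block_sequence_order2 k m F : 2 <= F -> block_sequence 0 k m F.
Proof.
move=> F2; pose l := iota 0 m; exists nat, 0, [:: plain_row l; plain_row (rev l)].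
have E : flat [:: plain_row l; plain_row (rev l)] = l ++ rev l.
  by rewrite !flat_cons !symbols_plain_row cats0.
split=> //=; rewrite ?plain_plain_row //.
  split.
  - by move=> r; rewrite !inE => /orP[] /eqP ->; rewrite symbols_plain_row ?rev_uniq iota_uniq.
  - by move=> r; rewrite !inE => /orP[] /eqP -> _; rewrite size_map ?size_rev size_iota.
  move=> x; rewrite [special _]/= E mem_cat mem_rev orbb => xl.
  by rewrite count_cat count_rev count_uniq_mem ?iota_uniq // xl bin0.
move=> a b ab; rewrite E word_cat word_rev.
case: (boolP (a \in l)) => al; last first.
  by exists false; rewrite -word_rev -word_cat; apply: (@fits_alternation_leq false 1) => //;
    apply: fits_wordNl; rewrite mem_cat mem_rev orbb.
case: (boolP (b \in l)) => bl; last first.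
  by exists true; rewrite -word_rev -word_cat; apply: (@fits_alternation_leq true 1) => //;
    apply: fits_wordNr; rewrite mem_cat mem_rev orbb.
case/orP: (index_total ab al bl) => lt.
  by exists true; rewrite (word_pair (iota_uniq _ _) al bl lt); do 8 constructor.
exists false; rewrite -word_rev -word_cat; apply: (@fits_alternation_swap _ true 3 a b _ ab).
rewrite word_cat word_rev (word_pair (iota_uniq _ _) bl al lt) /=.
by do 8 constructor.
Qed.

Lemma block_sequence_base t m F : 0 < F -> block_sequence t.+1 0 m F.
Proof.
move=> F0; pose l := iota 0 m; exists nat, 0, [:: plain_row l].
have E : flat [:: plain_row l] = l by rewrite flat_cons symbols_plain_row cats0.
have ul : uniq l by apply: iota_uniq.
split=> //=; rewrite ?plain_plain_row //.
- split.
  + by move=> r; rewrite inE => /eqP ->; rewrite symbols_plain_row.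
  + by move=> r; rewrite inE => /eqP -> _; rewrite size_map size_iota.
  by move=> x; rewrite [special _]/= E => xl; rewrite count_uniq_mem // xl.
- move=> a b ab; rewrite E.
  case: (boolP (a \in l)) => al; last first.
    exists false; apply: (@fits_alternation_leq false 1) => //; exact: fits_wordNl.
  case: (boolP (b \in l)) => bl; last first.
    exists true; apply: (@fits_alternation_leq true 1) => //; exact: fits_wordNr.
  case/orP: (index_total ab al bl) => lt.
    exists true; rewrite word_pair //; apply: (@fits_alternation_leq true 2) => //.
    by do 5 constructor.
  exists false; apply: (@fits_alternation_swap _ true _ a b _ ab).
  rewrite word_pair //; apply: (@fits_alternation_leq true 2) => //; by do 5 constructor.
move=> _ [|z Z1] l' Z2 a b //; last by case: Z1.
case=> <- <- ab; rewrite -/(symbols (plain_row l)) symbols_plain_row => al bl.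
have nest c d : c \in l -> d \in l -> index c l < index d l -> nested c d [::] (plain_row l).2 [::].
  move=> cl dl lt; split=> //; [exact: fits_nilr| |exact: fits_nilr].
  by rewrite -/(symbols (plain_row l)) symbols_plain_row word_pair.
by case/orP: (index_total ab al bl) => lt; [left|right]; apply: nest.
Qed.

Lemma block_sequence_empty t k F : 0 < F -> block_sequence t k 0 F.
Proof.
move=> F0; exists nat, 0, [:: plain_row [::]]; split=> //=.
- by split=> // r; rewrite inE => /eqP ->.
- by move=> a b _; exists true; apply: fits_nilr.
- move=> _ [|z Z1] l' Z2 a b //; last by case: Z1.
  by case=> <-.
Qed.

Lemma uniform_special_size (T : eqType) (Z : seq (line T)) m cs ct :
  plain Z -> uniform Z m cs ct -> size (flat Z) = size Z * m.
Proof.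
move=> pZ [_ h _]; rewrite /flat size_flatten /shape -map_comp sumnE big_map.
rewrite (eq_big_seq (fun=> m)) ?big_const_seq ?count_predT ?iter_addn_0 1?mulnC //.
by move=> r rZ /=; rewrite size_map h //; have /andP[] := allP pZ r rZ.
Qed.

(** Pascal's rule gives the exponent: W contributes 2^C(k,t) occurrences per symbol and O
    contributes 2^C(k,t+1). Lengths are fixed from the inside out: blocks of W have one entry for
    each row of I, blocks of O one for each symbol of W. *)
Lemma block_sequence_exists t k m : block_sequence t k m (ack k.+2 (6 * m + 5)).
Proof.
have pos k' m' : 2 <= ack k'.+2 (6 * m' + 5).
  by apply: leq_trans (leq_ack_arg _ _); rewrite addnC.
elim: k t m => [|k IH] [|t] m; try exact: block_sequence_order2.
  by apply: block_sequence_base; apply: leq_trans (pos 0 m).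
elim: m => [|m [V [v0 [I [uI pI aI /(_ isT) nI /andP[I0 sI]]]]]].
  by apply: block_sequence_empty; apply: leq_trans (pos k.+1 0).
have [V' [_ [W [uW pW aW _ /andP[W0 sW]]]]] := IH t (size I).
have [s [us ms os]] := alternates_order aW.
have [U [u0 [O [uO pO aO /(_ isT) nO /andP[O0 sO]]]]] := IH t.+1 (size s).
have ss : size s <= size I * size W.
  rewrite mulnC -(uniform_special_size pW uW); apply: uniq_leq_size => // x.
  by rewrite ms.
pose S := substitute u0 s W O.
have pS : plain S by apply: plain_substitute.
have uS : uniform S (size I) (2 ^ 'C(k.+1, t.+1)) (2 ^ 'C(k.+1, t.+1)).
  by rewrite binS expnD; apply: uniform_substitute.
have aS : alternates S t.+1.*2.+3.
  exact: (alternates_substitute (n := t.+1) u0 us ms os uO pO erefl nO aO).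
have sp : size (special I) = size I by rewrite plain_special.
have fS : fit_rows (size (special I)) S by rewrite sp; apply: uniform_fit uS.
have uniqS (r : line U) : r \in S -> uniq (symbols r) by case: uS => h _ _; apply: h.
have uniqI (r : line V) : r \in I -> uniq (symbols r) by case: uI => h _ _; apply: h.
exists _, (inl u0), (graft 0 S I); split.
- exact: uniform_graft sp uS uI.
- exact: plain_graft.
- apply: alternates_graft => // i a b.
  have [f|[O1 [lo [O2 [f [w1 [w2 [w3 [_ _ -> [f1 f2 f3] _]]]]]]]]] := fits_word_cross i a b uniqS fS.
    by exists true; apply: (@fits_alternation_leq true 3).
  (* Mixed pairs need five runs, which any positive parameter t + 1 allows. *)
  exists true; apply: (@fits_alternation_leq true 5) => //.
  exact: (fits_cat f1 (fits_cat f2 f3)).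
- by move=> _; apply: all_nested_graft.
have -> : size (graft 0 S I) = size O * size W * size I.
  have := size_graft 0 S I; rewrite (plain_special pS) size_substitute; lia.
rewrite !muln_gt0 I0 W0 O0 /=.
have g1 : size W <= iter 2 (ack k.+2) (ack k.+3 (6 * m + 5)) by apply: ack_growth1 sI sW.
exact: ack_growth2 sI g1 ss sO.
Qed.

(** * Sequences of order 3 *)

(* Entries of special rows are first (false) or last (true) occurrences. *)
Definition tags_correct (T : eqType) (Z : seq (line T)) :=
  forall Z1 l Z2 x f, Z = Z1 ++ (true, l) :: Z2 -> (x, f) \in l ->
  x \notin flat (if f then Z2 else Z1).

(** The word conditions leave room for doubling: two first occurrences ab are followed by their
    doubles ba, so the part below may add no more than ab, and symmetrically for two last
    occurrences. For a first and a last occurrence the tags alone bound the word. *)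
Definition meets (T : eqType) (a b : T) (Z1 : seq (line T)) (l : seq (T * bool)) Z2 :=
  [/\ apart a b Z1, apart a b Z2 &
   [\/ [/\ (a, false) \in l, (b, false) \in l, word a b (unzip1 l) = [:: true; false]
          & fits [:: true; false] (word a b (flat Z2))],
       [/\ (a, true) \in l, (b, true) \in l, word a b (unzip1 l) = [:: false; true]
          & fits [:: false; true] (word a b (flat Z1))]
     | (a, false) \in l /\ (b, true) \in l]].

Definition all_meet (T : eqType) (Z : seq (line T)) :=
  forall Z1 l Z2 a b, Z = Z1 ++ (true, l) :: Z2 -> a != b ->
    a \in unzip1 l -> b \in unzip1 l -> meets a b Z1 l Z2 \/ meets b a Z1 l Z2.

Section MergeTags.
Variables (U V : eqType) (O : seq (line U)) (I : seq (line V)).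
Hypotheses (uO : forall r : line U, r \in O -> uniq (symbols r))
  (uI : forall r : line V, r \in I -> uniq (symbols r)) (fO : fit_rows (size (special I)) O)
  (tO : tags_correct O) (tI : tags_correct I).

Lemma uniq_split O1 lo1 (e : U * bool) lo2 O2 : O = O1 ++ (true, lo1 ++ e :: lo2) :: O2 ->
  e.1 \notin unzip1 lo1 /\ e.1 \notin unzip1 lo2.
Proof.
move=> EO; have := uO (r := (true, lo1 ++ e :: lo2)); rewrite EO mem_cat inE eqxx orbT => /(_ isT).
rewrite /symbols /= /unzip1 map_cat cat_uniq /= => /and3P[_ + /andP[? _]].
by rewrite negb_or => /andP[? _].
Qed.

Lemma tags_correct_graft : tags_correct (graft 0 O I).
Proof.
move=> Z1 l Z2 x f E xl.
have [O1 [O2 [lo1 [lo2 [e [I1 [I2 [li [EO EI [s1 s2] El [EZ1 EZ2]]]]]]]]]] := graft_special fO E.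
have [ue1 ue2] := uniq_split EO.
have fO' : fit_rows (size (special (I1 ++ (true, li) :: I2))) (O1 ++ (true, lo1 ++ e :: lo2) :: O2).
  by rewrite -EO -EI.
subst l Z1 Z2; case: (mem_middleP (mem_unzip1 xl)) => [Ex|[a Ex _]]; subst x.
  have Ee : e = (e.1, f) by move: xl; rewrite mem_outer_middle => /eqP <-.
  have elo : (e.1, f) \in lo1 ++ e :: lo2 by rewrite -Ee mem_cat mem_head orbT.
  have := tO EO elo; case: (f) => nf; rewrite mem_outer.
    by rewrite (outer_part_below (lo1 := lo1) (e := e)) // mem_cat negb_or ue2 nf.
  by rewrite (outer_part_above (O2 := O2) (lo2 := lo2) (e := e)) // mem_cat negb_or ue1 nf.
rewrite mem_copy_middle in xl.
have := tI EI xl; case: (f) => nf; rewrite mem_copy ?copy_part_below ?copy_part_above //.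
Qed.

Lemma all_meet_graft : all_meet I -> all_meet (graft 0 O I).
Proof.
move=> nI Z1 l Z2 a b E ab al bl.
have [O1 [O2 [lo1 [lo2 [e [I1 [I2 [li [EO EI [s1 s2] El [EZ1 EZ2]]]]]]]]]] := graft_special fO E.
have [ue1 ue2] := uniq_split EO.
have ul : uniq (unzip1 li) by apply: (uI (r := (true, li))); rewrite EI mem_cat inE eqxx orbT.
subst l Z1 Z2.
have em : (inl e.1, e.2) \in middle O1 e li by rewrite mem_outer_middle -surjective_pairing.
have cross c : c \in unzip1 li ->
    meets (inr (size (special O1), c)) (inl e.1)
      (above O1 lo1 I1 I2 li) (middle O1 e li) (below O1 O2 lo2 I1 I2 li) \/
    meets (inl e.1) (inr (size (special O1), c))
      (above O1 lo1 I1 I2 li) (middle O1 e li) (below O1 O2 lo2 I1 I2 li).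
  move=> /[dup] /unzip1P[f cf] cl.
  have cm : (inr (size (special O1), c), f) \in middle O1 e li by rewrite mem_copy_middle.
  have ap1 := apart_above O1 I2 li s1 c ue1.
  have ap2 := apart_below O1 O2 I1 li s2 c ue2.
  have wm := word_cross_middle O1 e ul cl.
  (* Equal tags lead to the first two cases because [put] places e on the matching side; different
     tags lead to the third. *)
  case Ee: e.2 em wm => em wm; case Ef: f cm {cf} => cm.
  - left; split=> //; constructor 2; split=> //; exact: fits_word_above.
  - left; split=> //; by constructor 3.
  - right; split; [by rewrite apartC|by rewrite apartC|by constructor 3].
  - left; split=> //; constructor 1; split=> //; exact: fits_word_below.
case: (mem_middleP al) (mem_middleP bl) => [Ea|[a' Ea a'l]] [Eb|[b' Eb b'l]]; rewrite {}Ea {}Eb in ab al bl *.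
- by rewrite eqxx in ab.
- by case: (cross b' b'l) => h; [right|left].
- exact: cross.
have ab' : a' != b' by apply: contraNN ab => /eqP ->.
have same c d : meets c d I1 li I2 -> meets (inr (size (special O1), c)) (inr (size (special O1), d))
    (above O1 lo1 I1 I2 li) (middle O1 e li) (below O1 O2 lo2 I1 I2 li).
  case=> h1 h2 h3; split; [exact: apart_copy_above|exact: apart_copy_below|].
  rewrite word_copy_middle !mem_copy_middle !word_copy copy_part_above copy_part_below.
  by case: h3 => h; [constructor 1|constructor 2|constructor 3].
by case: (nI I1 li I2 a' b' EI ab' a'l b'l) => h; [left|right]; apply: same.
Qed.

(** A mixed pair could have five runs, but the occurrence of b in the copy is its first or its last,
    so nothing of b lies on one side of the copy. *)
Lemma alternates_graft4 : alternates O 4 -> alternates I 4 -> alternates (graft 0 O I) 4.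
Proof.
move=> aO aI; apply: alternates_graft => // i a b.
have [f|] := fits_word_cross i a b uO fO.
  by exists true; apply: (@fits_alternation_leq true 3).
case=> O1 [lo [O2 [f [w1 [w2 [w3 [EO bf -> [f1 f2 f3] [n1 n3]]]]]]]].
have := tO EO bf; case: f bf => _ => [/n3 ->|/n1 ->].
  by exists true; rewrite cats0; apply: (fits_cat f1 f2).
by exists false; apply: (fits_cat f2 f3).
Qed.
End MergeTags.

Arguments word : simpl never.

Lemma word_cons (T : eqType) (a b x : T) l : word a b (x :: l) =
  (if x == a then [:: true] else if x == b then [:: false] else [::]) ++ word a b l.
Proof. by rewrite /word /=; case: eqP => //; case: eqP. Qed.

(** * Doubling the first and last occurrences *)

Section Expand.
Variable T : eqType.
Implicit Types (Z : seq (line T)) (l : seq (T * bool)).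

Definition select f l : line T := (false, rev [seq x <- l | x.2 == f]).

(** Doubles of first occurrences go below the row and those of last occurrences above it, so the
    special entry keeps its role. The reversal in [select] makes the adjacent letters of row and
    double equal. *)
Definition expand_row (r : line T) :=
  if r.1 then [:: select true r.2; r; select false r.2] else [:: r].

Definition expand Z := flatten (map expand_row Z).

Lemma expand_cat Z1 Z2 : expand (Z1 ++ Z2) = expand Z1 ++ expand Z2.
Proof. by rewrite /expand map_cat flatten_cat. Qed.

Lemma expand_cons r Z : expand (r :: Z) = expand_row r ++ expand Z. Proof. by []. Qed.

Lemma special_expand Z : special (expand Z) = special Z.
Proof. by elim: Z => //= -[[] l] Z IH; rewrite expand_cons special_cat IH. Qed.

Lemma size_expand Z : size (expand Z) = size Z + (size (special Z)).*2.
Proof.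
elim: Z => //= -[[] l] Z IH; rewrite expand_cons size_cat IH /=; lia.
Qed.

Lemma symbols_select f l : symbols (select f l) = rev (unzip1 [seq x <- l | x.2 == f]).
Proof. by rewrite /symbols /= /unzip1 map_rev. Qed.

Lemma mem_select f l x : (x \in symbols (select f l)) = ((x, f) \in l).
Proof.
rewrite symbols_select mem_rev; apply/unzip1P/idP => [[g]|xl].
  by rewrite mem_filter /= => /andP[/eqP <-].
by exists f; rewrite mem_filter eqxx.
Qed.

Lemma count_select x l :
  count_mem x (symbols (select true l)) + count_mem x (symbols (select false l)) = count_mem x (unzip1 l).
Proof.
rewrite !symbols_select !count_rev; elim: l => //= -[y []] l /=; rewrite /= => <-; lia.
Qed.

Lemma flat_expand_row (r : line T) : flat (expand_row r) =
  if r.1 then symbols (select true r.2) ++ symbols r ++ symbols (select false r.2) else symbols r.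
Proof. by rewrite /expand_row; case: r.1; rewrite /flat /= cats0. Qed.

Lemma mem_flat_expand Z : flat (expand Z) =i flat Z.
Proof.
move=> x; elim: Z => // r Z IH; rewrite expand_cons flat_cat flat_cons !mem_cat IH flat_expand_row.
congr (_ || _); case: r => -[] l //=; rewrite !mem_cat !mem_select.
rewrite /symbols /=; case: (boolP (x \in unzip1 l)) => [|nx]; first by rewrite orbT.
by apply/negbTE; rewrite !negb_or andTb; apply/andP; split; apply: contra nx => /mem_unzip1.
Qed.

Lemma count_expand x Z :
  count_mem x (flat (expand Z)) = count_mem x (flat Z) + count_mem x (flat (special Z)).
Proof.
elim: Z => // r Z IH; rewrite expand_cons flat_cat flat_cons !count_cat IH flat_expand_row.
case: r => -[] l //=; last by rewrite addnA.
by rewrite flat_cons !count_cat -(count_select x l) /symbols /=; lia.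
Qed.

Lemma uniform_expand Z m cs ct : uniform Z m cs ct -> uniform (expand Z) m cs (ct + cs).
Proof.
case=> h1 h2 h3; split.
- move=> r /flattenP[_ /mapP[r0 r0Z ->]]; rewrite /expand_row; case: ifP => r01; last first.
    by rewrite inE => /eqP ->; apply: h1.
  have u f : uniq (symbols (select f r0.2)).
    rewrite symbols_select rev_uniq; apply: subseq_uniq (h1 _ r0Z).
    exact/map_subseq/filter_subseq.
  by rewrite !inE => /or3P[] /eqP -> //; apply: h1.
- move=> r /flattenP[_ /mapP[r0 r0Z ->]]; rewrite /expand_row; case: ifP => r01; last first.
    by rewrite inE => /eqP ->; apply: h2.
  by rewrite !inE => /or3P[] /eqP -> //; apply: h2.
by move=> x; rewrite special_expand count_expand mem_flat_expand => /h3[-> ->].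
Qed.

Lemma expand_split Z Y1 l Y2 : expand Z = Y1 ++ (true, l) :: Y2 ->
  exists Z1 Z2, [/\ Z = Z1 ++ (true, l) :: Z2, Y1 = expand Z1 ++ [:: select true l]
    & Y2 = select false l :: expand Z2].
Proof.
elim: Z Y1 => [|[[] l0] Z IH] Y1; first by case: Y1.
  rewrite expand_cons /=; case: Y1 => [|y1 [|y2 [|y3 Y1]]] //=.
    by case=> <- <- <-; exists [::], Z.
  by case=> <- <- <- /IH[Z1 [Z2 [-> -> ->]]]; exists ((true, l0) :: Z1), Z2.
rewrite expand_cons /=; case: Y1 => [//|y Y1] /= [<- /IH[Z1 [Z2 [-> -> ->]]]].
by exists ((false, l0) :: Z1), Z2.
Qed.

Lemma tag_unique l x f : uniq (unzip1 l) -> (x, f) \in l -> (x, ~~ f) \notin l.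
Proof.
elim: l => //= -[y g] l IH /andP[yl ul]; rewrite !inE !xpair_eqE.
case/orP => [/andP[/eqP -> /eqP ->]|xl].
  rewrite eqxx /= negb_or; apply/andP; split; first by case: (g).
  by apply: contra yl => /mem_unzip1.
rewrite negb_or IH // andbT; apply: contraNN yl => /andP[/eqP <- _].
exact: mem_unzip1 xl.
Qed.

Lemma tags_correct_expand Z : {in Z, forall r : line T, uniq (symbols r)} ->
  tags_correct Z -> tags_correct (expand Z).
Proof.
move=> uZ tZ Y1 l Y2 x f /expand_split[Z1 [Z2 [E -> ->]]] xl.
have ul : uniq (unzip1 l) by apply: (uZ (true, l)); rewrite E mem_cat inE eqxx orbT.
have := tZ _ _ _ _ _ E xl; have := tag_unique ul xl; case: f {xl} => /= n1 n2.
  by rewrite flat_cons mem_cat mem_select negb_or n1 mem_flat_expand.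
by rewrite flat_cat mem_cat mem_flat_expand flat_cons mem_cat mem_select !negb_or n1 n2.
Qed.

Lemma word_select a b l : a != b -> uniq (unzip1 l) -> forall f, (a, f) \in l -> (b, f) \in l ->
  word a b (symbols (select f l)) = rev (word a b (unzip1 l)) /\
  word a b (symbols (select (~~ f) l)) = [::].
Proof.
move=> ab ul f al bl; have ta := tag_unique ul al; have tb := tag_unique ul bl; split; last first.
  rewrite wordNl; last by rewrite mem_select.
  by rewrite (count_memPn _) // mem_select.
rewrite symbols_select word_rev; congr rev; elim: l {ul al bl} ta tb => //= -[x g] l IH.
rewrite !inE !xpair_eqE !negb_or => /andP[xa /IH {}IH] /andP[xb /IH {}IH].
rewrite word_cons -IH; case: (boolP (g == f)) => gf /=; first by rewrite word_cons.
have Eg : ~~ f == g by case: (f) (g) gf => -[].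
by move: xa xb; rewrite Eg !andbT ![_ == x]eq_sym => /negbTE -> /negbTE ->.
Qed.

Lemma fits_expand_apart a b p Z : apart a b Z ->
  fits p (word a b (flat Z)) -> fits p (word a b (flat (expand Z))).
Proof.
elim: Z p => // r Z IH p /= /andP[ar /IH {}IH].
rewrite expand_cons flat_cat flat_cons flat_expand_row; case: r ar => -[] l /=; last first.
  move=> _; rewrite !word_cat; elim: (word a b (symbols _)) p => [|x w IHw] p; first exact: IH.
  by move=> f; apply: (@fits_stutter _ x 1) f => q; apply: IHw.
set F := _ ++ _ ++ _; set l' := symbols (true, l).
have memF x : (x \in F) = (x \in l').
  by have := mem_flat_expand [:: (true, l)] x; rewrite /flat /= !cats0.
have countF x : (count_mem x F == 0) = (count_mem x l' == 0).
  by rewrite !eqn0Ngt -!has_count !has_pred1 memF.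
have grow x n k (u v : seq bool) q : (forall q, fits q u -> fits q v) -> (k == 0) = (n == 0) ->
    fits q (nseq n x ++ u) -> fits q (nseq k x ++ v).
  move=> h; case: n => [|n]; first by case: k => // _; apply: h.
  rewrite -[n.+1]addn1 nseqD -catA => _ /fits_suffix f; exact: fits_stutter f.
move: F memF countF => F memF countF.
rewrite !word_cat => nab; case: (boolP (a \in l')) nab => [al /= bl|al _].
  by rewrite (wordNr a bl) (@wordNr _ a b F) ?memF //; apply: grow; rewrite // countF.
by rewrite (wordNl b al) (@wordNl _ a b F) ?memF //; apply: grow; rewrite // countF.
Qed.

(** In the first case of [meets] the word is ab, ba and then a's before b's: four runs. The second
    case is its mirror image. In the third, only b occurs above the row and only a below it, so b's,
    ab or ba, and a's remain. *)
Lemma alternates_expand Z : {in Z, forall r : line T, uniq (symbols r)} ->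
  tags_correct Z -> all_meet Z -> alternates Z 4 -> alternates (expand Z) 4.
Proof.
move=> uZ tZ mZ alt a b ab.
case: (boolP (apart a b Z)) => [ap|].
  by have [x f] := alt a b ab; exists x; apply: fits_expand_apart.
rewrite -has_predC => /hasP[r rZ] /=; rewrite negbK => /and3P[r1 ar br].
have [Z1 [Z2 E]] := mem_split rZ; case: r r1 ar br rZ E => [[] l] //= _ al bl rZ E.
have ul : uniq (unzip1 l) by apply: (uZ (true, l)).
suff key c d : c != d -> c \in unzip1 l -> d \in unzip1 l -> meets c d Z1 l Z2 ->
    exists x, fits (alternation x 4) (word c d (flat (expand Z))).
  case: (mZ _ _ _ _ _ E ab al bl) => h; first exact: key.
  have [|//|//|//|x f] := key b a; first by rewrite eq_sym.
  by exists (~~ x); apply: (@fits_alternation_swap _ x 4 a b _ ab).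
move=> cd cl dl [ap1 ap2 h].
have nE x f : (x, f) \in l -> x \notin flat (expand (if f then Z2 else Z1)).
  by rewrite mem_flat_expand; apply: tZ E.
rewrite E expand_cat expand_cons flat_cat flat_cat flat_expand_row /= !word_cat -/(symbols (true, l)).
case: h => [[cf df wl f2]|[cf df wl f1]|[cf df]].
- have [ws ws'] := word_select cd ul cf df; exists true.
  rewrite ws ws' [symbols _]/= wl (wordNl d (nE c false cf)) (count_memPn (nE d false df)) /=.
  apply/fits_take/fits_skip/fits_take/fits_take/fits_skip/fits_take.
  exact: fits_expand_apart f2.
- have [ws ws'] := word_select cd ul cf df; exists false.
  rewrite ws ws' [symbols _]/= wl (wordNl d (nE c true cf)) (count_memPn (nE d true df)) /=.
  apply: (@fits_squash [:: false] [:: false; true] true); apply: (@fits_cat [:: false; true]).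
    exact: fits_expand_apart f1.
  by apply/fits_take/fits_skip/fits_take/fits_take/fits_skip/fits_take/fits_nilr.
exists false.
have w1 : fits [:: false] (word c d (flat (expand Z1) ++ symbols (select true l))).
  apply: fits_wordNl; rewrite mem_cat negb_or mem_select (tag_unique ul cf) andbT.
  exact: (nE c false).
have w3 : fits [:: true] (word c d (symbols (select false l) ++ flat (expand Z2))).
  apply: fits_wordNr; rewrite mem_cat negb_or mem_select (tag_unique ul df).
  exact: (nE d true).
rewrite word_cat in w1; rewrite word_cat in w3; rewrite -!catA catA.
case/orP: (index_total cd cl dl) => lt.
  rewrite (_ : word c d (symbols (true, l)) = [:: true; false]); last exact: word_pair.
  apply: (fits_cat w1 (fits_cat (_ : fits [:: true; false] [:: true; false]) w3)).
  by do 5 constructor.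
have -> : word c d (symbols (true, l)) = [:: false; true].
  by rewrite (word_swap (a := d)) 1?eq_sym // [symbols _]/= word_pair.
apply: (@fits_alternation_leq false 2 4 _ isT).
apply: (@fits_squash [::] [:: true] false); apply: (@fits_squash [:: false; false] [::] true).
apply: (fits_cat w1 (fits_cat (_ : fits [:: false; true] [:: false; true]) w3)).
by do 5 constructor.
Qed.
End Expand.

Definition tagged_sequence (T : eqType) (Z : seq (line T)) m ct :=
  [/\ uniform Z m 2 ct, tags_correct Z & alternates Z 4].

(** The ratio of all rows to special rows is recorded because doubling adds rows without blocks; it
    has to stay bounded at each level for the matrices to be made square. *)
Definition tagged_outer j K ct := forall f, 0 < f ->
  exists (T : eqType) (O : seq (line T)), [/\ tagged_sequence O f ct,
    1 < size (special O), size (special O) <= ack j (6 * f + 5) & size O <= K.+2 * size (special O)].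

(** The term 2 (K + 1) strengthens the induction. If O has g special rows, the graft has size O + g
    (size I - 1) rows; the bound for I then leaves a surplus of g (K + 1), and g >= 2 restores the
    term. *)
Lemma tagged_graft j K ct m : 2 <= j -> tagged_outer j K ct ->
  exists (T : eqType) (Z : seq (line T)), [/\ tagged_sequence Z m ct, all_meet Z,
    size Z + 2 * K.+1 <= (2 * K).+3 * size (special Z),
    0 < size (special Z) <= ack j.+1 (6 * m + 5) & 0 < m -> 1 < size (special Z)].
Proof.
move=> j2 outer; elim: m => [|m [V [I [[uI tI aI] mI rI /andP[I0 sI] _]]]].
  exists nat, [:: plain_row [::]]; split=> //=.
  - split.
    + by split=> // r; rewrite inE => /eqP ->.
    + by move=> [|z Z1] l Z2 x f; [case=> <-|case: Z1].
    + by move=> a b _; exists true; apply: fits_nilr.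
  - by move=> [|z Z1] l' Z2 a b; [case=> <-|case: Z1].
  - by rewrite /size /=; lia.
  - by do 5 apply: ack_gt0.
have [U [O [[uO tO aO] O1 sO rO]]] := outer _ I0.
have fO : fit_rows (size (special I)) O by apply: uniform_fit uO.
have uniqO (r : line U) : r \in O -> uniq (symbols r) by case: uO => h _ _; apply: h.
have uniqI (r : line V) : r \in I -> uniq (symbols r) by case: uI => h _ _; apply: h.
exists _, (graft 0 O I); split.
- split; [exact: uniform_graft uO uI|exact: tags_correct_graft|exact: alternates_graft4].
- exact: all_meet_graft.
- have := size_graft 0 O I; rewrite size_special_graft.
  have := leq_mul (leqnn (size (special O))) rI; have := leq_mul (leqnn K.+1) O1.
  move: rO; clear; move: (size (special O)) (size (special I)) (size (graft 0 O I)) (size O) (size I).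
  by move=> g f x y z; rewrite mulnDr [g * (_ * f)]mulnCA; move: (g * f) => gf; nia.
- rewrite size_special_graft muln_gt0 I0 (ltnW O1) /=.
  by apply: ack_growth3 sI sO.
by rewrite size_special_graft => _; apply: leq_trans O1 _; rewrite leq_pmulr.
Qed.

Lemma two_row_outer : tagged_outer 2 1 2.
Proof.
move=> f f0; pose l := iota 0 f; pose r b := (true, [seq (x, b) | x <- l]) : line nat.
have sr b : symbols (r b) = l by rewrite /symbols /= /unzip1 -map_comp map_id.
have ul : uniq l := iota_uniq _ _.
have E : flat [:: r false; r true] = l ++ l by rewrite !flat_cons !sr cats0.
exists nat, [:: r false; r true]; split; [split| by []| |by []].
- split.
  + by move=> x; rewrite !inE => /orP[] /eqP ->; rewrite sr.
  + by move=> x; rewrite !inE => /orP[] /eqP -> _; rewrite size_map size_iota.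
  by move=> x; rewrite [special _]/= E mem_cat orbb => xl; rewrite count_cat count_uniq_mem ?xl.
- move=> [|z1 [|z2 Z1]] l' Z2 x b; last by case: Z1.
    by case=> <- _ /mapP[y _ [_ ->]].
  by case=> _ <- <- /mapP[y _ [_ ->]].
- move=> a b ab; rewrite E.
  case: (boolP (a \in l)) => al; last first.
    exists false; apply: (@fits_alternation_leq false 1) => //; apply: fits_wordNl.
    by rewrite mem_cat orbb.
  case: (boolP (b \in l)) => bl; last first.
    exists true; apply: (@fits_alternation_leq true 1) => //; apply: fits_wordNr.
    by rewrite mem_cat orbb.
  case/orP: (index_total ab al bl) => lt.
    by exists true; rewrite word_cat (word_pair ul al bl lt); do 9 constructor.
  exists false; apply: (@fits_alternation_swap _ true 4 a b _ ab).
  by rewrite word_cat (word_pair ul bl al lt); do 9 constructor.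
apply: leq_trans (leq_ack_arg _ _); rewrite /=; lia.
Qed.

(** Each of the two special occurrences of a symbol is doubled once, and each special row brings two
    new rows, turning the ratio 2 K + 3 into 2 K + 5. *)
Lemma expand_outer j K ct : 2 <= j -> tagged_outer j K ct ->
  tagged_outer j.+1 (2 * K).+3 ct.+2.
Proof.
move=> j2 outer f f0; have [T [Z [[uZ tZ aZ] mZ rZ /andP[_ sZ] Z1]]] := tagged_graft f j2 outer.
have uniqZ (r : line T) : r \in Z -> uniq (symbols r) by case: uZ => h _ _; apply: h.
exists T, (expand Z); rewrite special_expand size_expand; split=> //; last by lia.
- split; [|exact: tags_correct_expand|exact: alternates_expand].
  by have := uniform_expand uZ; rewrite addn2.
- exact: Z1.
Qed.

(** Solution of the recursion from K to 2 K + 3 with initial value 1. *)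
Definition row_ratio d := 2 ^ d.+2 - 3.

Lemma tagged_outer_exists d : tagged_outer d.+2 (row_ratio d) (2 * d).+2.
Proof.
elim: d => [|d IH]; first exact: two_row_outer.
rewrite mulnS (_ : row_ratio d.+1 = (2 * row_ratio d).+3); first exact: expand_outer.
have : 4 <= 2 ^ d.+2 by rewrite (@leq_exp2l 2 2).
by rewrite /row_ratio (expnS _ d.+2); lia.
Qed.

(** * Lower bounds *)

(** Sequences are kept instead of matrices so that disjoint unions can be formed before passing to
    [p]. *)
Definition realizable k n w := exists (T : eqType) (syms : seq T) (Z : seq (seq T)),
  [/\ uniq syms /\ size syms <= n, size Z <= n /\ size (flatten Z) = w, all uniq Z,
      {subset flatten Z <= syms}
    & forall a b, a != b -> exists x, fits (alternation x k.+1) (word a b (flatten Z))].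

Lemma realizable_leq_p k n w : 0 < k -> realizable k n w -> w <= p k n.
Proof.
by move=> k0 [T [syms [Z [[us sn] [Zn <-] uZ sub alt]]]]; apply: leq_p_of_words sub alt.
Qed.

Lemma realizable_leq k k' n n' w : k <= k' -> n <= n' -> realizable k n w -> realizable k' n' w.
Proof.
move=> kk nn [T [syms [Z [[us sn] [Zn Ew] uZ sub alt]]]]; exists T, syms, Z; split=> //.
- by rewrite (leq_trans sn).
- by rewrite (leq_trans Zn).
by move=> a b /alt[x f]; exists x; apply: fits_alternation_leq f.
Qed.

Lemma word_map (T U : eqType) (f : T -> U) a b l : injective f ->
  word (f a) (f b) (map f l) = word a b l.
Proof. by move=> fi; elim: l => //= x l IH; rewrite !word_cons IH !(inj_eq fi). Qed.

Lemma realizable_add k n1 n2 w1 w2 : 0 < k ->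
  realizable k n1 w1 -> realizable k n2 w2 -> realizable k (n1 + n2) (w1 + w2).
Proof.
move=> k0 [T1 [s1 [Z1 [[u1 sn1] [Zn1 <-] uZ1 sub1 alt1]]]] [T2 [s2 [Z2 [[u2 sn2] [Zn2 <-] uZ2 sub2 alt2]]]].
have i1 : injective (@inl T1 T2) by move=> ? ? [].
have i2 : injective (@inr T1 T2) by move=> ? ? [].
exists (T1 + T2)%type, (map inl s1 ++ map inr s2), (map (map inl) Z1 ++ map (map inr) Z2).
have E : flatten (map (map inl) Z1 ++ map (map inr) Z2) = map inl (flatten Z1) ++ map inr (flatten Z2).
  by rewrite flatten_cat -!map_flatten.
have n1' (b : T2) : inr b \notin map (@inl T1 T2) (flatten Z1) by apply/mapP => -[].
have n2' (b : T1) : inl b \notin map (@inr T1 T2) (flatten Z2) by apply/mapP => -[].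
split.
- rewrite cat_uniq !map_inj_uniq // u1 u2 andbT size_cat !size_map leq_add //; split=> //.
  by apply/hasPn => _ /mapP[x _ ->]; apply/mapP => -[].
- by rewrite E !size_cat !size_map leq_add.
- rewrite all_cat !all_map; apply/andP; split.
    by apply: sub_all uZ1 => r /= ur; rewrite map_inj_uniq.
  by apply: sub_all uZ2 => r /= ur; rewrite map_inj_uniq.
- move=> x; rewrite E !mem_cat => /orP[] /mapP[y yZ ->]; rewrite map_f ?orbT //.
    exact: sub1.
  exact: sub2.
rewrite E => -[a|a] [b|b] ab; rewrite word_cat.
- have [//|x f] := alt1 a b; exists x.
  by rewrite word_map // (wordNl (inl b) (n2' a)) (count_memPn (n2' b)) cats0.
- exists true; apply: (@fits_alternation_leq true 2) => //.
  by apply: (@fits_cat [:: true]); [apply: fits_wordNr|apply: fits_wordNl].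
- exists false; apply: (@fits_alternation_leq false 2) => //.
  by apply: (@fits_cat [:: false]); [apply: fits_wordNl|apply: fits_wordNr].
have [//|x f] := alt2 a b; exists x.
by rewrite (wordNl (inr b) (n1' a)) (count_memPn (n1' b)) word_map.
Qed.

Lemma realizable_mul k n w q : 0 < k -> realizable k n w -> realizable k (q * n) (q * w).
Proof.
move=> k0 h; elim: q => [|q IH]; last by rewrite !mulSn; apply: realizable_add.
exists nat, [::], [::]; split=> // a b _; exists true; exact: fits_nilr.
Qed.

Lemma p_scale k n m w : 0 < k -> realizable k m w -> (n %/ m) * w <= p k n.
Proof.
move=> k0 /(realizable_mul (n %/ m) k0) h; apply: realizable_leq_p => //.
by apply: realizable_leq h => //; apply: leq_trunc_div.
Qed.

Lemma size_count_mem (T : eqType) (u s : seq T) : uniq u -> {subset s <= u} ->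
  size s = \sum_(x <- u) count_mem x s.
Proof.
move=> uu; elim: s => [|y s IH] sub /=; first by rewrite big1.
rewrite big_split /= -IH; last by move=> x xs; apply: sub; rewrite inE xs orbT.
have yu : y \in u by rewrite sub ?mem_head.
suff -> : \sum_(x <- u) nat_of_bool (y == x) = count_mem y u by rewrite count_uniq_mem // yu.
by rewrite -sum1_count [RHS]big_mkcond /=; apply: eq_bigr => x _; rewrite eq_sym; case: eqP.
Qed.

Lemma uniform_realizable (T : eqType) (Z : seq (line T)) m cs ct k n N :
  uniform Z m cs ct -> alternates Z k.+1 -> size (special Z) * m = N * cs -> 0 < cs ->
  size Z <= n -> N <= n -> realizable k n (N * ct).
Proof.
move=> [h1 h2 h3] alt E cs0 Zn Nn; pose u := undup (flat Z).
have uu : uniq u := undup_uniq _.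
have sz : size u = N.
  apply/eqP; rewrite -(eqn_pmul2r cs0) -E; apply/eqP.
  have -> : size (special Z) * m = size (flat (special Z)).
    rewrite /flat size_flatten /shape -map_comp sumnE big_map.
    rewrite (eq_big_seq (fun=> m)) ?big_const_seq ?count_predT ?iter_addn_0 1?mulnC //.
    by move=> r; rewrite mem_filter => /andP[r1 rZ] /=; rewrite size_map h2.
  rewrite (size_count_mem (s := flat (special Z)) uu); last first.
    move=> x /flattenP[_ /mapP[r rS ->] xr]; rewrite mem_undup; apply: mem_flat xr.
    by move: rS; rewrite mem_filter => /andP[].
  rewrite (eq_big_seq (fun=> cs)) ?big_const_seq ?count_predT ?iter_addn_0 1?mulnC //.
  by move=> x; rewrite mem_undup => /h3[].
exists T, u, (map (@symbols T) Z); split.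
- by rewrite sz.
- rewrite size_map; split=> //; rewrite -/(flat Z) (size_count_mem (s := flat Z) uu); last first.
    by move=> x; rewrite mem_undup.
  rewrite (eq_big_seq (fun=> ct)) ?big_const_seq ?count_predT ?iter_addn_0 ?sz 1?mulnC //.
  by move=> x; rewrite mem_undup => /h3[].
- by rewrite all_map; apply/allP => r rZ; apply: h1.
- by move=> x; rewrite mem_undup.
exact: alt.
Qed.

Lemma leq_bin_exp2 n k : 'C(n, k) <= 2 ^ n.
Proof.
elim: n k => [|n IH] [|k] //; first by rewrite bin0 expn_gt0.
by rewrite binS expnS mul2n -addnn leq_add.
Qed.

(** Doubly exponential because the block length 2^C(k,t) used below can be as large as about
    2^(2^k). *)
Lemma ack_3_exp k : 6 * 2 ^ (2 ^ k) + 5 <= ack k.+3 3.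
Proof.
elim: k => [|k IH].
  by rewrite ack_3S ackSS ack1E -[ack 2 3]/16; apply: (@leq_trans (2 ^ 5)) => //.
rewrite ack_3S ackSS; apply: leq_trans (leq_ack_index (d := 1) _ _) => //.
rewrite ack1E; apply: leq_trans (leq_pexp2l _ IH) => //.
have -> : 2 ^ 2 ^ k.+1 = (2 ^ 2 ^ k) ^ 2 by rewrite expnS mulnC expnM.
set w := 2 ^ 2 ^ k; have ww : w <= 2 ^ w by apply/ltnW/ltn_expl.
apply: (@leq_trans (2 ^ (2 * w + 5))); last by rewrite leq_exp2l //; lia.
have w0 : 0 < w by rewrite expn_gt0.
rewrite expnD mulnC expnM mulnC -[2 ^ 5]/32.
have : w ^ 2 <= (2 ^ w) ^ 2 by rewrite leq_sqr.
rewrite -expnM mulnC expnM.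
by have : 0 < w ^ 2; [rewrite expn_gt0 w0|move: (w ^ 2) ((2 ^ 2) ^ w); lia].
Qed.

(** Blocks of length mu give as many symbols as rows. Filling side n with copies loses at most a
    factor 2 by rounding, which is harmless in the exponent. *)
Lemma p_lower_even t K k n : t.*2.+2 <= K -> ack k.+4 3 <= n -> n * 2 ^ 'C(k, t) <= 2 * p K n.
Proof.
move=> tK lek; set mu := 2 ^ 'C(k, t).
have [T [x0 [Z [uZ pZ aZ _ /andP[Z0 sZ]]]]] := block_sequence_exists t k mu.
have mu0 : 0 < mu by rewrite expn_gt0.
have rZ : realizable K (size Z) (size Z * mu).
  apply: (@realizable_leq t.*2.+2 _ (size Z)) => //.
  by apply: uniform_realizable uZ aZ _ _ _ _ => //; rewrite plain_special.
have K0 : 0 < K by apply: leq_trans tK.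
have Zn : size Z <= n.
  apply: leq_trans lek; apply: leq_trans sZ _; rewrite ack_3S ackSS.
  apply: leq_ack; apply: leq_trans (ack_3_exp k).
  by rewrite leq_add2r leq_mul2l /= leq_exp2l // leq_bin_exp2.
apply: leq_trans (leq_mul (leqnn 2) (p_scale n K0 rZ)).
rewrite !mulnA leq_mul2r; apply/orP; right.
have := ltn_ceil n Z0; have : 0 < n %/ size Z by rewrite divn_gt0.
by move: (n %/ size Z) => q; rewrite mulSn; nia.
Qed.

(** Here the coefficient 2 has to survive, so a factor cannot be given away. The side N times the 2
    d + 2 ones per symbol is at most n, hence rounding loses at most n ones. *)
Lemma p_lower3 d n : ack (d + 6) 3 <= n -> n * (2 * d).+1 <= p 3 n.
Proof.
move=> led; set M := (2 * row_ratio d).+3.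
(* As each symbol has two special occurrences, blocks of length 2 M yield M symbols per special row,
   matching the bound on the rows. *)
have [T [Z [[uZ _ aZ] _ rZ /andP[Z0 sZ] _]]] := tagged_graft (2 * M) (isT : 1 < d.+2) (tagged_outer_exists d).
rewrite -/M in rZ; set N := size (special Z) * M.
have sN : size Z <= N by rewrite /N mulnC; apply: leq_trans rZ; apply: leq_addr.
have N0 : 0 < N by rewrite muln_gt0 Z0.
have r3 : realizable 3 N (N * (2 * d).+2).
  by apply: uniform_realizable uZ aZ _ _ sN _ => //; rewrite /N; lia.
have Nn : N * (2 * d).+2 <= n.
  apply: leq_trans led.
  have dM : (2 * d).+2 <= M.
    rewrite /M /row_ratio; have : d < 2 ^ d by apply: ltn_expl.
    by rewrite !(expnS 2); lia.
  set v := 6 * (2 * M) + 5; set A := ack d.+3.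
  have v5 : 5 <= v by rewrite leq_addl.
  have sA : size (special Z) <= A v by apply: leq_trans sZ (leq_ack_index _ _).
  have vA : v <= A v := leq_ack_arg _ _.
  have h : N * (2 * d).+2 <= A (A (A v)).
    have h1 : 6 * A v ^ 2 + 5 <= A (A v) by apply: ack_square => //; apply: leq_trans vA.
    have h2 : 6 * A (A v) ^ 2 + 5 <= A (A (A v)).
      by apply: ack_square => //; apply: leq_trans (leq_ack_arg _ _); apply: leq_trans vA.
    apply: leq_trans h2; apply: (@leq_trans (A v * A v * A v)).
      have MA : M <= A v by apply: leq_trans vA; rewrite /v; lia.
      by rewrite /N; apply: leq_mul; [apply: leq_mul|apply: leq_trans MA].
    rewrite -mulnn; move: h1 v5 vA; rewrite -mulnn; move: (A (A v)) (A v) => B a; nia.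
  apply: leq_trans h _.
  apply: (@leq_trans (ack d.+4 v.+3)).
    by rewrite -[leqRHS]/(A (A (A (ack d.+4 v)))); do 3 apply: leq_ack; apply: leq_ack_arg.
  rewrite (_ : d + 6 = d.+4.+2); last by rewrite !addnS addn0.
  rewrite ack_3S [leqRHS]ackSS; apply: leq_ack; apply: leq_trans (ack_3_exp d.+2).
  have : 2 ^ d.+4 <= 2 ^ 2 ^ d.+2.
    rewrite leq_exp2l // (expnS _ d.+1) (expnS _ d).
    by have := ltn_expl d (isT : 1 < 2); lia.
  have : 2 ^ 2 <= 2 ^ d.+2 by rewrite leq_exp2l.
  rewrite (expnS _ d.+3) (expnS _ d.+2) /v /M /row_ratio.
  by move: (2 ^ 2 ^ _) => x; move: (2 ^ d.+2) => y; lia.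
apply: (leq_trans _ (p_scale n (isT : 0 < 3) r3)).
have := ltn_ceil n N0; move: (n %/ N) => q; rewrite mulSn => ltq.
rewrite mulnA; move: (q * N) ltq => x ltq.
have : n * (2 * d).+2 <= (N + x) * (2 * d).+2 by rewrite leq_mul2r ltnW ?orbT.
by rewrite mulnDl [n * (2 * d).+2]mulnS; lia.
Qed.

(** * Asymptotics *)

From mathcomp Require Import ring lra.
From mathcomp Require Import all_classical all_reals all_analysis.
Import Order.TTheory GRing.Theory Num.Theory numFieldNormedType.Exports.
Local Open Scope classical_set_scope.
Local Open Scope ring_scope.

Section Reals.
Variable R : realType.
Implicit Types (x y C D : R) (d t n : nat).

(** * Inequalities for powers and logarithms *)

Lemma pred_expr_ge t x c : 0 <= c <= x ->
  x ^+ t.+1 - c * t.+1%:R * x ^+ t <= (x - c) ^+ t.+1.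
Proof.
case/andP=> c0 cx; elim: t => [|t IH]; first by rewrite !expr1 expr0; lra.
have x0 : 0 <= x by lra.
have xt : 0 <= x ^+ t by rewrite exprn_ge0.
rewrite (exprS (x - c)); apply: le_trans (ler_wpM2l _ IH); last lra.
rewrite !exprS -[t.+2]addn1 natrD -subr_ge0.
rewrite (_ : _ - _ = c * c * t.+1%:R * x ^+ t); last by ring.
by rewrite !mulr_ge0.
Qed.

(** r is the second-order remainder of the binomial expansion. Multiplying it by x avoids the
    exponent t - 1 at t = 0. *)
Lemma pred_expr_le t : exists2 B : R, 0 <= B & forall x, 1 <= x ->
  let r := (x - 1) ^+ t.+1 - x ^+ t.+1 + t.+1%:R * x ^+ t in 0 <= r /\ x * r <= B * x ^+ t.
Proof.
elim: t => [|t [B B0 IH]].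
  by exists 0 => // x x1 r; rewrite /r !expr1 expr0; split; lra.
exists (B + t.+1%:R) => [|x x1 r]; first by rewrite addr_ge0.
have [r0 rB] := IH x x1; set q := _ + _ in r0 rB.
have xt : 0 <= x ^+ t by rewrite exprn_ge0 //; lra.
have -> : r = (x - 1) * q + t.+1%:R * x ^+ t.
  by rewrite /r /q !exprS -[t.+2]addn1 natrD; ring.
split; first by rewrite addr_ge0 ?mulr_ge0 //; lra.
have -> : x * ((x - 1) * q + t.+1%:R * x ^+ t) = (x - 1) * (x * q) + t.+1%:R * x ^+ t.+1.
  by rewrite exprS; ring.
rewrite [leRHS]mulrDl lerD2r exprS [leRHS]mulrCA; apply: ler_pM => //; try lra.
by rewrite mulr_ge0 //; lra.
Qed.

Lemma expr_pred_diff t x : 1 <= x -> x ^+ t <= x ^+ t.+1 - (x - 1) ^+ t.+1.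
Proof.
move=> x1; rewrite lerBrDr -lerBrDl !exprS -[X in _ <= _ - X]mul1r -mulrBl.
apply: ler_wpM2l; first lra.
by apply: lerXn2r; rewrite ?nnegrE; lra.
Qed.

Definition log2 x := ln x / ln 2.

Lemma ln2_gt0 : 0 < ln 2 :> R. Proof. by rewrite ln_gt0 // ltr1n. Qed.

Lemma powR_log2 x : 0 < x -> 2 `^ (log2 x) = x.
Proof.
move=> x0; rewrite /powR pnatr_eq0 /= /log2 divfK ?lnK ?posrE //.
exact: lt0r_neq0 (ln2_gt0).
Qed.

Lemma log2_ge0 x : 1 <= x -> 0 <= log2 x.
Proof. by move=> x1; apply: divr_ge0; [exact: ln_ge0|exact/ltW/ln2_gt0]. Qed.

Lemma ler_log2 x y : 0 < x -> x <= y -> log2 x <= log2 y.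
Proof.
move=> x0 xy; rewrite ler_pM2r ?invr_gt0 ?ln2_gt0 // ler_ln ?posrE //.
exact: lt_le_trans xy.
Qed.

Lemma log2_le_linear (e : R) : 0 < e -> exists2 B : R, 0 <= B & forall x, 1 <= x -> log2 x <= e * x + B.
Proof.
move=> e0; have l2 := ln2_gt0; pose K := (e * ln 2)^-1.
have K0 : 0 < K by rewrite invr_gt0 mulr_gt0.
exists `|log2 K| => // x x1; have x0 : 0 < x by lra.
have -> : log2 x = ln (x / K) / ln 2 + log2 K.
  by rewrite /log2 ln_div ?posrE // -mulrDl subrK.
apply: lerD; last exact: ler_norm.
rewrite ler_pdivrMr //; apply: le_trans (_ : x / K <= _); last first.
  by rewrite /K invrK; lra.
by apply/ltW/ln_sublinear; rewrite divr_gt0.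
Qed.

Lemma powR2_le x y : x <= y -> 2 `^ x <= 2 `^ y :> R.
Proof. by apply: ler_powR; rewrite ler1n. Qed.

Lemma powR2D x y : 2 `^ (x + y) = 2 `^ x * 2 `^ y :> R.
Proof. by rewrite powRD // pnatr_eq0 implybT. Qed.

Lemma powR2_half x : 2 `^ (x - 1) + 2 `^ (x - 1) = 2 `^ x :> R.
Proof. by rewrite -[in RHS](subrK 1 x) (powR2D (x - 1)) powRr1 // mulr_natr mulr2n. Qed.

Lemma natr_le_powR2 n : n%:R <= 2 `^ n%:R :> R.
Proof. by rewrite powR_mulrn // -natrX ler_nat ltnW // ltn_expl. Qed.

Lemma log2_powR2 x : log2 (2 `^ x) = x.
Proof. by rewrite /log2 ln_powR mulfK // lt0r_neq0 // ln2_gt0. Qed.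

Lemma log2_le_id n : (0 < n)%N -> log2 n%:R <= n%:R :> R.
Proof.
move=> n0; rewrite -[leRHS]log2_powR2; apply: ler_log2; rewrite ?ltr0n //.
exact: natr_le_powR2.
Qed.

Lemma log2_ge1 n : (1 < n)%N -> 1 <= log2 n%:R :> R.
Proof.
move=> n1; have e : log2 2 = 1 :> R by rewrite /log2 divff // lt0r_neq0 // ln2_gt0.
by rewrite -[leLHS]e; apply: ler_log2; rewrite ?ltr0n ?ler_nat.
Qed.

(** * Growth of the quotas *)

Definition odd_bound t C := forall n, (0 < n)%N ->
  (quota (2 * t + 3) n)%:R <= 2 `^ (t`!%:R^-1 * n%:R ^+ t + C * n%:R ^+ (t - 1)%N).
Definition even_bound t C := forall n, (0 < n)%N ->
  (quota (2 * t + 4) n)%:R <= 2 `^ (t`!%:R^-1 * n%:R ^+ t * log2 n%:R + C * n%:R ^+ t).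

Lemma quota4 n : quota 4 n = (4 * n + 4)%N.
Proof. by elim: n => // n IH; rewrite quotaS IH /=; lia. Qed.

Lemma quota5 n : (quota 5 n + 8 * n + 24 = 29 * 2 ^ n)%N.
Proof. by elim: n => // n IH; rewrite quotaS quota4 expnS -[quota 3 _]/2%N; lia. Qed.

Lemma odd_bound0 : odd_bound 0 0.
Proof. by move=> n _; rewrite mul0r addr0 fact0 invr1 expr0 mulr1 powRr1. Qed.

Lemma even_bound0 : even_bound 0 3.
Proof.
move=> n n0; rewrite quota4 fact0 invr1 expr0 !mul1r mulr1 powR2D powR_log2 ?ltr0n //.
by rewrite powR_mulrn // -natrX -natrM ler_nat; lia.
Qed.

(** For t = 1 the error term is constant and does not decrease from n to n - 1, so the inductive
    step has nothing to spend; the closed form is used. *)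
Lemma odd_bound1 : odd_bound 1 5.
Proof.
move=> n n0; rewrite (_ : 1`! = 1)%N // invr1 expr1 expr0 mul1r mulr1 -natrD powR_mulrn // -natrX ler_nat.
rewrite -[quota _ n]/(quota 5 n) expnD -[(2 ^ 5)%N]/32%N.
have := quota5 n; move: (quota 5 n) (2 ^ n)%N => a b; lia.
Qed.

(** Each summand of the quota recursion may take half of the target, one unit of the exponent. In
    the product, the leading term loses x^t log x / t! from x to x - 1, which is what the factor of
    lower order supplies. The decrease of C x^(t+1), at least C x^t, pays for the rest. *)
Lemma even_step t C1 C2 : odd_bound t.+1 C1 -> even_bound t C2 -> exists C, even_bound t.+1 C.
Proof.
move=> h1 h2; have [B B0 hB] := pred_expr_le t.
pose K := quota (2 * t.+1 + 4) 1.
(* The summand K settles the start n = 1. *)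
pose C : R := `|C1| + `|C2| + B + 3 + K%:R.
have C1C : `|C1| + 3 <= C by have := normr_ge0 C2; have : 0 <= K%:R :> R by []; rewrite /C; lra.
have C2C : `|C2| + B + 1 <= C by have := normr_ge0 C1; have : 0 <= K%:R :> R by []; rewrite /C; lra.
have KC : K%:R <= C by have := normr_ge0 C1; have := normr_ge0 C2; rewrite /C; lra.
exists C; elim=> // -[_ _|n IH _].
  rewrite /log2 ln1 mul0r mulr0 add0r expr1n mulr1.
  exact: le_trans (natr_le_powR2 _) (powR2_le KC).
have := IH isT; set x : R := n.+2%:R; set y : R := n.+1%:R => {}IH.
have xy : y = x - 1 by rewrite /x /y -[n.+2]addn1 natrD addrK.
have x1 : 1 <= x by rewrite ler1n.
have y1 : 1 <= y by rewrite ler1n.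
have q : quota (2 * t.+1 + 4) n.+2 =
   (2 * quota (2 * t.+1 + 3) n.+2 + quota (2 * t + 4) n.+2 * quota (2 * t.+1 + 4) n.+1)%N.
  rewrite (_ : 2 * t.+1 + 4 = (2 * t + 2).+4)%N ?quotaS; last lia.
  by congr (2 * quota _ _ + quota _ _ * _)%N; lia.
rewrite q natrD -(powR2_half (_ + _)); apply: lerD.
  rewrite natrM -[2%:R in leLHS](@powRr1 R 2) //.
  apply: le_trans (ler_wpM2l (powR_ge0 _ _) (h1 n.+2 isT)) _; rewrite -powR2D; apply: powR2_le.
  rewrite subn1 /=; set u := _^-1; set L := log2 x; set P := x ^+ t.
  have L1 : 1 <= L by apply: log2_ge1.
  have u0 : 0 <= u by rewrite invr_ge0.
  have P1 : 1 <= P by apply: exprn_ege1.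
  have PP : P <= x ^+ t.+1 by rewrite exprS ler_peMl //; lra.
  have : u * x ^+ t.+1 <= u * x ^+ t.+1 * L by rewrite ler_peMr // mulr_ge0 //; lra.
  have : C1 * P <= `|C1| * x ^+ t.+1.
    apply: le_trans (ler_wpM2r _ (ler_norm C1)) _; first lra.
    by apply: ler_wpM2l.
  have : (`|C1| + 3) * x ^+ t.+1 <= C * x ^+ t.+1 by apply: ler_wpM2r => //; lra.
  lra.
rewrite natrM; apply: le_trans (ler_pM _ _ (h2 n.+2 isT) IH) _ => //.
rewrite -powR2D; apply: powR2_le.
have [r0 rB] := hB x x1; set r := _ + _ in r0 rB.
have L0 : 0 <= log2 y by apply: log2_ge0.
have LL : log2 y <= log2 x by apply: ler_log2; lra.
have Lx : log2 x <= x by apply: log2_le_id.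
have df : y ^+ t.+1 <= x ^+ t.+1 - x ^+ t by have := expr_pred_diff t x1; rewrite -xy; lra.
have P1 : 1 <= x ^+ t by apply: exprn_ege1.
have fu : t`!%:R^-1 = t.+1%:R * (t.+1)`!%:R^-1 :> R.
  by rewrite factS natrM invfM mulrA mulfV ?mul1r // pnatr_eq0.
have u0 : 0 <= (t.+1)`!%:R^-1 :> R by rewrite invr_ge0.
have u1 : (t.+1)`!%:R^-1 <= 1 :> R by rewrite invf_le1 ?ltr0n ?fact_gt0 // ler1n fact_gt0.
rewrite {}fu -/x; move: (t.+1)`!%:R^-1 u0 u1 => u u0 u1.
have Ye : y ^+ t.+1 = x ^+ t.+1 - t.+1%:R * x ^+ t + r by rewrite /r xy; ring.
have Y0 : 0 <= y ^+ t.+1 by rewrite exprn_ge0 //; lra.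
have C0 : 0 <= C by have := normr_ge0 C1; lra.
have h3 : u * y ^+ t.+1 * log2 y <= u * (x ^+ t.+1 - t.+1%:R * x ^+ t + r) * log2 x.
  by rewrite -Ye; apply: ler_wpM2l => //; rewrite mulr_ge0.
have h4 : u * r * log2 x <= B * x ^+ t.
  apply: le_trans rB; rewrite mulrC; apply: ler_pM => //; last by rewrite ler_piMl.
  - by apply: le_trans LL.
  - by rewrite mulr_ge0.
have h5 : C * y ^+ t.+1 <= C * (x ^+ t.+1 - x ^+ t) by apply: ler_wpM2l.
have h6 : C2 * x ^+ t <= `|C2| * x ^+ t by apply: ler_wpM2r; rewrite ?ler_norm //; lra.
have h7 : (`|C2| + B + 1) * x ^+ t <= C * x ^+ t by apply: ler_wpM2r => //; lra.
move: h3 h4 h5 h6 h7 P1; move: (x ^+ t.+1) (x ^+ t) (log2 x) (log2 y) => Px P L l.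
move: (u * y ^+ t.+1 * l) (C * y ^+ t.+1) => w z.
have -> : u * (Px - t.+1%:R * P + r) * L = u * Px * L - t.+1%:R * u * P * L + u * r * L by ring.
rewrite mulrBr; lra.
Qed.

Lemma odd_step t C1 C2 : odd_bound t.+1 C1 -> even_bound t.+1 C2 -> exists C, odd_bound t.+2 C.
Proof.
move=> h1 h2; have [B B0 hB] := pred_expr_le t.+1.
have [|D D0 hD] := @log2_le_linear t.+2%:R^-1.
  by rewrite invr_gt0 ltr0n.
pose K := quota (2 * t.+2 + 3) 1.
pose C : R := `|C1| + `|C2| + B + D + 2 + K%:R.
have K0 : 0 <= K%:R :> R by [].
have C1C : `|C1| + B + 1 <= C by have := normr_ge0 C2; rewrite /C; lra.
have C2C : `|C2| + D + 2 <= C by have := normr_ge0 C1; rewrite /C; lra.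
have KC : K%:R <= C by have := normr_ge0 C1; have := normr_ge0 C2; rewrite /C; lra.
exists C; elim=> // -[_ _|n IH _].
  rewrite !expr1n !mulr1; apply: le_trans (natr_le_powR2 _) (powR2_le _).
  by apply: le_trans KC _; rewrite lerDr invr_ge0.
have := IH isT; set x : R := n.+2%:R; set y : R := n.+1%:R => {}IH.
have xy : y = x - 1 by rewrite /x /y -[n.+2]addn1 natrD addrK.
have x1 : 1 <= x by rewrite ler1n.
have y1 : 1 <= y by rewrite ler1n.
have q : quota (2 * t.+2 + 3) n.+2 =
   (2 * quota (2 * t.+1 + 4) n.+2 + quota (2 * t.+1 + 3) n.+2 * quota (2 * t.+2 + 3) n.+1)%N.
  rewrite (_ : 2 * t.+2 + 3 = (2 * t + 3).+4)%N ?quotaS; last lia.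
  by congr (2 * quota _ _ + quota _ _ * _)%N; lia.
have e1 : (t.+2 - 1 = t.+1)%N by [].
rewrite e1 in IH; rewrite e1.
have P1 : 1 <= x ^+ t by apply: exprn_ege1.
have C0 : 0 <= C by have := normr_ge0 C1; lra.
have x0 : 0 <= x by lra.
have fu : (t.+1)`!%:R^-1 = t.+2%:R * (t.+2)`!%:R^-1 :> R.
  by rewrite (factS t.+1) natrM invfM mulrA mulfV ?mul1r // pnatr_eq0.
have u0 : 0 <= (t.+2)`!%:R^-1 :> R by rewrite invr_ge0.
have f1 : (t.+1)`!%:R^-1 <= 1 :> R by rewrite invf_le1 ?ltr0n ?fact_gt0 // ler1n fact_gt0.
have f0 : 0 <= (t.+1)`!%:R^-1 :> R by rewrite invr_ge0.
have u1 : (t.+2)`!%:R^-1 <= 1 :> R by rewrite invf_le1 ?ltr0n ?fact_gt0 // ler1n fact_gt0.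
have PP : x ^+ t <= x ^+ t.+1 by rewrite exprS ler_peMl //; lra.
rewrite q natrD -(powR2_half (_ + _)); apply: lerD.
  rewrite natrM -[2%:R in leLHS](@powRr1 R 2) //.
  apply: le_trans (ler_wpM2l (powR_ge0 _ _) (h2 n.+2 isT)) _; rewrite -powR2D; apply: powR2_le.
  rewrite -/x.
  (* The slope 1 / (t + 2) in log x <= x / (t + 2) + D is chosen to turn 1 / (t + 1)! into 1 / (t +
     2)!. *)
  have h3 : (t.+1)`!%:R^-1 * x ^+ t.+1 * log2 x <= (t.+2)`!%:R^-1 * x ^+ t.+2 + D * x ^+ t.+1.
    have Q0 : 0 <= x ^+ t.+1 by rewrite exprn_ge0.
    have -> : (t.+2)`!%:R^-1 * x ^+ t.+2 + D * x ^+ t.+1 =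
       (t.+1)`!%:R^-1 * x ^+ t.+1 * (t.+2%:R^-1 * x) + D * x ^+ t.+1.
      have tn : t.+2%:R != 0 :> R by rewrite pnatr_eq0.
      by rewrite fu [x ^+ t.+2]exprSr; move: (_`!%:R^-1) (x ^+ t.+1) => v z; field.
    apply: le_trans (ler_wpM2l _ (hD x x1)) _; first by rewrite mulr_ge0.
    rewrite mulrDr lerD2l [leRHS]mulrC; apply: ler_wpM2r => //.
    by rewrite ler_piMl.
  have h4 : C2 * x ^+ t.+1 <= `|C2| * x ^+ t.+1 by apply: ler_wpM2r; rewrite ?ler_norm ?exprn_ge0.
  have h5 : (`|C2| + D + 2) * x ^+ t.+1 <= C * x ^+ t.+1 by apply: ler_wpM2r; rewrite ?exprn_ge0.
  lra.
rewrite natrM; apply: le_trans (ler_pM _ _ (h1 n.+2 isT) IH) _ => //.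
rewrite -powR2D; apply: powR2_le; rewrite subn1 /= -/x.
have [r0 rB] := hB x x1; set r := _ + _ in r0 rB.
have rB' : r <= B * x ^+ t.
  by rewrite -(@ler_pM2l _ x) ?(lt_le_trans ltr01) // mulrCA -exprS.
have df : y ^+ t.+1 <= x ^+ t.+1 - x ^+ t by have := expr_pred_diff t x1; rewrite -xy; lra.
have Ye : y ^+ t.+2 = x ^+ t.+2 - t.+2%:R * x ^+ t.+1 + r by rewrite /r xy; ring.
rewrite {}fu Ye; move: (t.+2)`!%:R^-1 u0 u1 => u u0 u1.
have h4 : u * r <= B * x ^+ t by apply: le_trans rB'; rewrite ler_piMl.
have h5 : C * y ^+ t.+1 <= C * (x ^+ t.+1 - x ^+ t) by apply: ler_wpM2l.
have h6 : C1 * x ^+ t <= `|C1| * x ^+ t by apply: ler_wpM2r; rewrite ?ler_norm //; lra.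
have h7 : (`|C1| + B + 1) * x ^+ t <= C * x ^+ t by apply: ler_wpM2r => //; lra.
move: h4 h5 h6 h7 P1; move: (x ^+ t.+2) (x ^+ t.+1) (x ^+ t) (C * _) => X Q P z.
have -> : u * (X - t.+2%:R * Q + r) = u * X - t.+2%:R * u * Q + u * r by ring.
rewrite mulrBr; lra.
Qed.

Lemma quota_bounds t : (exists C, odd_bound t C) /\ (exists C, even_bound t C).
Proof.
elim: t => [|t [[C1 h1] [C2 h2]]]; first by split; [exists 0; exact: odd_bound0|exists 3; exact: even_bound0].
have [C h] : exists C, odd_bound t.+1 C.
  case: t h1 h2 => [|t] h1 h2; first by exists 5; exact: odd_bound1.
  exact: odd_step h1 h2.
by split; [exists C|exact: even_step h h2].
Qed.
End Reals.

(** * Passage to the asymptotic statements *)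

Section Final.
Variable R : realType.

Lemma near_alpha d (P : nat -> Prop) :
  (forall n, (d < alpha n)%N -> P n) -> \forall n \near \oo, P n.
Proof.
move=> h; apply: filterS (nbhs_infty_gt (ack d 3)) => n; rewrite -ltn_alpha => lt.
by apply: h; apply: ltnW.
Qed.

Lemma p3_lower : exists2 C : R, 0 < C & \forall n \near \oo,
  2 * n%:R * (alpha n)%:R - C * n%:R <= (p 3 n)%:R.
Proof.
(* With d = [alpha n] - 8 the coefficient 2 d + 1 equals 2 [alpha n] - 15. *)
exists 16 => //; apply: (@near_alpha 8) => n a8.
have [d Ed] : exists d, alpha n = (d + 8)%N by exists (alpha n - 8)%N; lia.
have led : (ack (d + 6) 3 <= n)%N by apply: ltnW; rewrite -ltn_alpha Ed; lia.
have : (n * (2 * d).+1)%N%:R <= (p 3 n)%:R :> R by rewrite ler_nat p_lower3.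
apply: le_trans; rewrite Ed natrM -(addn1 (2 * d)%N) (natrD _ (2 * d)%N) (natrM _ 2%N d) (natrD _ d 8%N).
have : 0 <= n%:R :> R by [].
move: (n%:R) (d%:R) => x y x0; rewrite -subr_ge0.
by rewrite (_ : _ - _ = x); [|ring].
Qed.

Lemma p3_upper : exists2 C : R, 0 < C & \forall n \near \oo,
  (p 3 n)%:R <= C * (n%:R * (alpha n)%:R).
Proof.
have [C hC] := p_upper 2; exists (C.+1 * 9)%N%:R => //; apply: (@near_alpha 1) => n a1.
rewrite -!natrM ler_nat; apply: leq_trans (hC n a1) _.
rewrite quota4 -mulnA; apply: leq_mul; first exact: leqnSn.
by rewrite mulnCA leq_mul2l; apply/orP; right; lia.
Qed.

(** Constant factors move into the exponent: quota + 1 is at most twice 2^x, and C is at most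
    2^C. *)
Lemma p_upper_exp k (n C : nat) (x : R) : 0 <= x -> (p k n <= C * (n * (quota k.+1 (alpha n)).+1))%N ->
  (quota k.+1 (alpha n))%:R <= 2 `^ x -> (p k n)%:R <= n%:R * 2 `^ (x + C.+1%:R) :> R.
Proof.
move=> x0 hp hq; have : (p k n)%:R <= (C * (n * (quota k.+1 (alpha n)).+1))%N%:R :> R by rewrite ler_nat.
move/le_trans; apply; rewrite mulnCA natrM; apply: ler_wpM2l => //.
rewrite natrM -[_.+1 in leLHS]addn1 natrD.
have h1 : 1 <= 2 `^ x :> R by rewrite -[leLHS](powRr0 2); apply: powR2_le.
have h2 : C%:R <= 2 `^ C%:R :> R := natr_le_powR2 _ _.
rewrite -[C.+1]addn1 natrD !powR2D powRr1 // mulrA mulrC.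
apply: (@le_trans _ _ (2 `^ C%:R * (2 `^ x + 2 `^ x))); last by rewrite [2 `^ x * _]mulrC; lra.
by rewrite mulrC; apply: ler_pM => //; lra.
Qed.

Lemma p_upper_even t : (1 <= t)%N -> exists2 C : R, 0 < C & \forall n \near \oo,
  (p (2 * t + 2) n)%:R <= n%:R * 2 `^ (t`!%:R^-1 * (alpha n)%:R ^+ t + C * (alpha n)%:R ^+ (t - 1)%N).
Proof.
move=> t1; have [[C1 h1] _] := quota_bounds R t; have [C hC] := p_upper (2 * t + 1).
exists (`|C1| + C.+1%:R); first by rewrite ltr_wpDl.
apply: (@near_alpha 1) => n a1; have a0 : (0 < alpha n)%N by lia.
have x1 : 1 <= (alpha n)%:R :> R by rewrite ler1n.
have P1 : 1 <= (alpha n)%:R ^+ (t - 1)%N :> R by apply: exprn_ege1.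
have hp := hC n a1; rewrite -addnS in hp.
have hq := h1 _ a0.
have u0 : 0 <= t`!%:R^-1 * (alpha n)%:R ^+ t :> R by rewrite mulr_ge0 ?invr_ge0 ?exprn_ge0.
have C0 := normr_ge0 C1.
have {}hq : (quota (2 * t + 2).+1 (alpha n))%:R <= 2 `^ (t`!%:R^-1 * (alpha n)%:R ^+ t + `|C1| * (alpha n)%:R ^+ (t - 1)%N) :> R.
  rewrite -addnS; apply: le_trans hq _; apply: powR2_le; rewrite lerD2l.
  by apply: ler_wpM2r; rewrite ?ler_norm //; lra.
apply: le_trans (p_upper_exp _ hp hq) _.
  by rewrite addr_ge0 // mulr_ge0 //; lra.
apply: ler_wpM2l => //; apply: powR2_le; rewrite mulrDl addrA lerD2l.
by rewrite ler_peMr.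
Qed.

Lemma p_upper_odd t : (1 <= t)%N -> exists2 C : R, 0 < C & \forall n \near \oo,
  (p (2 * t + 3) n)%:R <= n%:R * 2 `^ (t`!%:R^-1 * (alpha n)%:R ^+ t * (ln (alpha n)%:R / ln 2)
                           + C * (alpha n)%:R ^+ t).
Proof.
move=> t1; have [_ [C1 h1]] := quota_bounds R t; have [C hC] := p_upper (2 * t + 2).
exists (`|C1| + C.+1%:R); first by rewrite ltr_wpDl.
apply: (@near_alpha 1) => n a1; have a0 : (0 < alpha n)%N by lia.
have x1 : 1 <= (alpha n)%:R :> R by rewrite ler1n.
have P1 : 1 <= (alpha n)%:R ^+ t :> R by apply: exprn_ege1.
have hp := hC n a1; rewrite -addnS in hp.
have hq := h1 _ a0; rewrite -/(log2 _).
have u0 : 0 <= t`!%:R^-1 * (alpha n)%:R ^+ t * log2 (alpha n)%:R :> R.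
  by rewrite mulr_ge0 ?log2_ge0 // mulr_ge0 ?invr_ge0 ?exprn_ge0.
have C0 := normr_ge0 C1.
have {}hq : (quota (2 * t + 3).+1 (alpha n))%:R <= 2 `^ (t`!%:R^-1 * (alpha n)%:R ^+ t * log2 (alpha n)%:R + `|C1| * (alpha n)%:R ^+ t) :> R.
  rewrite -addnS; apply: le_trans hq _; apply: powR2_le; rewrite lerD2l.
  by apply: ler_wpM2r; rewrite ?ler_norm //; lra.
apply: le_trans (p_upper_exp _ hp hq) _.
  by rewrite addr_ge0 // mulr_ge0 //; lra.
apply: ler_wpM2l => //; apply: powR2_le; rewrite mulrDl addrA lerD2l.
by rewrite ler_peMr.
Qed.

Lemma exp_leq_ffact n t : ((n - t) ^ t <= n ^_ t)%N.
Proof.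
elim: t => // t IH; rewrite ffactnSr expnSr; apply: leq_mul; last by lia.
by apply: leq_trans IH; case: (t) => // s; rewrite leq_exp2r //; lia.
Qed.

(** With k = [alpha n] - 6, the binomial C(k,t) is at least ([alpha n] - t - 6)^t / t!, and the
    shift by t + 6 costs a multiple of [alpha n]^(t-1). The additional 1 in the constant absorbs the
    factor 2 of [p_lower_even]. *)
Lemma p_lower_exp t K : (1 <= t)%N -> (2 * t + 2 <= K)%N ->
  exists2 C : R, 0 < C & \forall n \near \oo,
  n%:R * 2 `^ (t`!%:R^-1 * (alpha n)%:R ^+ t - C * (alpha n)%:R ^+ (t - 1)%N) <= (p K n)%:R.
Proof.
case: t => // t _ tK; pose c : R := (t.+1 + 6)%:R.
exists (c * t.+1%:R + 1); first by rewrite ltr_wpDl // mulr_ge0.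
apply: (@near_alpha (t.+1 + 6)%N) => n an.
have [k Ek] : exists k, alpha n = (k + 6)%N by exists (alpha n - 6)%N; lia.
have lek : (ack k.+4 3 <= n)%N by apply: ltnW; rewrite -ltn_alpha Ek; lia.
have := @p_lower_even t.+1 K k n; rewrite -mul2n addn2 in tK *.
move=> /(_ tK lek) hp.
have a0 : (0 < alpha n)%N by lia.
set x : R := (alpha n)%:R; have x1 : 1 <= x by rewrite ler1n.
have cx : 0 <= c <= x by rewrite ler0n ler_nat ltnW.
have hb : t.+1`!%:R^-1 * x ^+ t.+1 - c * t.+1%:R * x ^+ t <= 'C(k, t.+1)%:R.
  have h1 : (x - c) ^+ t.+1 <= 'C(k, t.+1)%:R * t.+1`!%:R.
    rewrite -natrM bin_ffact; apply: le_trans (_ : ((k - t.+1) ^ t.+1)%N%:R <= _).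
      rewrite natrX; have -> // : x - c = (k - t.+1)%N%:R.
      by rewrite /x /c Ek -natrB; [congr (_%:R); lia|lia].
    by rewrite ler_nat exp_leq_ffact.
  have f0 : 0 < t.+1`!%:R :> R by rewrite ltr0n fact_gt0.
  have f1 : 1 <= t.+1`!%:R :> R by rewrite ler1n fact_gt0.
  rewrite -(ler_pM2r f0); apply: le_trans h1.
  apply: le_trans (pred_expr_ge t cx); rewrite mulrBl mulrAC mulVf ?lt0r_neq0 // mul1r lerD2l lerN2.
  by rewrite ler_peMr // mulr_ge0 ?exprn_ge0 ?mulr_ge0 //; lra.
have {}hp : n%:R * 2 `^ 'C(k, t.+1)%:R <= 2 * (p K n)%:R :> R.
  by rewrite powR_mulrn // -natrX -!natrM ler_nat.
have P1 : 1 <= x ^+ t by apply: exprn_ege1.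
rewrite -(ler_pM2l (_ : 0 < 2)) //; apply: le_trans hp.
rewrite mulrCA; apply: ler_wpM2l => //.
rewrite -[X in X * _](powRr1 (ler0n R 2)) -powR2D; apply: powR2_le.
rewrite (_ : t.+1 - 1 = t)%N; last by lia.
lra.
Qed.
End Final.

Theorem theorem1p3 (R : realType) :
  [/\ (exists2 C : R, 0 < C & \forall n \near \oo,
         2 * n%:R * (alpha n)%:R - C * n%:R <= (p 3 n)%:R),
      (exists2 C : R, 0 < C & \forall n \near \oo,
         (p 3 n)%:R <= C * (n%:R * (alpha n)%:R)),
      (forall t : nat, (1 <= t)%N -> exists2 C : R, 0 < C & \forall n \near \oo,
         n%:R * 2 `^ ((t`!%:R)^-1 * (alpha n)%:R ^+ t - C * (alpha n)%:R ^+ (t - 1)%N)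
           <= (p (2 * t + 2)%N n)%:R
           <= n%:R * 2 `^ ((t`!%:R)^-1 * (alpha n)%:R ^+ t
                            + C * (alpha n)%:R ^+ (t - 1)%N)),
      (forall t : nat, (1 <= t)%N -> exists2 C : R, 0 < C & \forall n \near \oo,
         n%:R * 2 `^ ((t`!%:R)^-1 * (alpha n)%:R ^+ t - C * (alpha n)%:R ^+ (t - 1)%N)
           <= (p (2 * t + 3)%N n)%:R)
    & (forall t : nat, (1 <= t)%N -> exists2 C : R, 0 < C & \forall n \near \oo,
         (p (2 * t + 3)%N n)%:R
           <= n%:R * 2 `^ ((t`!%:R)^-1 * (alpha n)%:R ^+ t
                             * (ln (alpha n)%:R / ln 2)
                           + C * (alpha n)%:R ^+ t))].
Proof.
split; [exact: p3_lower|exact: p3_upper| | |exact: p_upper_odd].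
  move=> t t1; have [C1 C10 h1] := p_lower_exp R t1 (leqnn _); have [C2 C20 h2] := p_upper_even R t1.
  exists (C1 + C2); first exact: addr_gt0.
  apply: filterS2 h1 h2 => n h1 h2.
  have P0 : 0 <= (alpha n)%:R ^+ (t - 1)%N :> R by rewrite exprn_ge0.
  have hC1 : C1 * (alpha n)%:R ^+ (t - 1)%N <= (C1 + C2) * (alpha n)%:R ^+ (t - 1)%N.
    by apply: ler_wpM2r => //; lra.
  have hC2 : C2 * (alpha n)%:R ^+ (t - 1)%N <= (C1 + C2) * (alpha n)%:R ^+ (t - 1)%N.
    by apply: ler_wpM2r => //; lra.
  apply/andP; split; [apply: le_trans h1|apply: le_trans h2 _];
    by apply: ler_wpM2l => //; apply: powR2_le; lra.
(* The sequences of order 2 t + 2 are admissible for 2 t + 3 as well. *)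
by move=> t t1; apply: p_lower_exp => //; rewrite leq_add2l.
Qed.
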